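(* Let $(\lambda,\Psi)\in P_l$ be an $l$-weight and let $L(\lambda,\Psi)$ be the simple $\mathcal{U}_q(\hat{\mathfrak{g}})$-module of $l$-highest weight $(\lambda,\Psi)$. Then $L(\lambda,\Psi)$ is integrable if and only if $(\lambda,\Psi)\in P_l^+$.
   Context: $q\in\mathbb{C}^*$ is not a root of unity; a logarithm of $q$ is fixed so that $q^a$ makes sense for $a\in\mathbb{Q}$. $C=(C_{i,j})_{i,j\in I}$, $I=\{1,\dots,n\}$, is a generalized Cartan matrix: $C_{i,j}\in\mathbb{Z}$, $C_{i,i}=2$, $C_{i,j}\le 0$ for $i\neq j$, $C_{i,j}=0\Leftrightarrow C_{j,i}=0$. It is symmetrizable: positive integers $r_1,\dots,r_n$ are fixed such that $B=(B_{i,j})$, $B_{i,j}=r_iC_{i,j}$, is symmetric. $q_i=q^{r_i}$, $[m]_z=\frac{z^m-z^{-m}}{z-z^{-1}}$, and $\begin{bmatrix}s\\k\end{bmatrix}_z$ is the corresponding symmetric Gaussian binomial coefficient. A realization of $C$ is fixed: $\mathfrak{h}$ is a $\mathbb{Q}$-vector space of dimension $2n-\mathrm{rank}(C)$, with linearly independent families $\alpha_1,\dots,\alpha_n\in\mathfrak{h}^*$ and $\alpha_1^\vee,\dots,\alpha_n^\vee\in\mathfrak{h}$ satisfying $\alpha_j(\alpha_i^\vee)=C_{i,j}$. The quantum affinization $\mathcal{U}_q(\hat{\mathfrak{g}})$ is the $\mathbb{C}$-algebra with generators $x_{i,r}^{\pm}$ ($i\in I,r\in\mathbb{Z}$), $k_h$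 ($h\in\mathfrak{h}$), $h_{i,m}$ ($i\in I$, $m\in\mathbb{Z}\setminus\{0\}$) and relations (R1) $k_hk_{h'}=k_{h+h'}$, $k_0=1$, $[k_h,h_{j,m}]=0$, $[h_{i,m},h_{j,m'}]=0$; (R2) $k_hx_{j,r}^{\pm}k_{-h}=q^{\pm\alpha_j(h)}x_{j,r}^{\pm}$; (R3) $[h_{i,m},x_{j,r}^{\pm}]=\pm\frac1m[mB_{i,j}]_q\,x_{j,m+r}^{\pm}$; (R4) $[x_{i,r}^+,x_{j,r'}^-]=\delta_{i,j}\frac{\phi^+_{i,r+r'}-\phi^-_{i,r+r'}}{q_i-q_i^{-1}}$; (R5) $x_{i,r+1}^{\pm}x_{j,r'}^{\pm}-q^{\pm B_{i,j}}x_{j,r'}^{\pm}x_{i,r+1}^{\pm}=q^{\pm B_{i,j}}x_{i,r}^{\pm}x_{j,r'+1}^{\pm}-x_{j,r'+1}^{\pm}x_{i,r}^{\pm}$; (R6) $\sum_{\pi\in\Sigma_s}\sum_{k=0}^{s}(-1)^k\begin{bmatrix}s\\k\end{bmatrix}_{q_i}x_{i,r_{\pi(1)}}^{\pm}\cdots x_{i,r_{\pi(k)}}^{\pm}x_{j,r'}^{\pm}x_{i,r_{\pi(k+1)}}^{\pm}\cdots x_{i,r_{\pi(s)}}^{\pm}=0$ for all $i\neq j$, $s=1-C_{i,j}$, and all $r_1,\dots,r_s,r'\in\mathbb{Z}$. Here $\phi_{i,m}^{\pm}$ is defined by $\sum_{m\ge0}\phi_{i,\pm m}^{\pm}z^{\pm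 m}=k_{\pm r_i\alpha_i^\vee}\exp\big(\pm(q-q^{-1})\sum_{m'\ge1}h_{i,\pm m'}z^{\pm m'}\big)$, with $\phi^+_{i,m}=0$ for $m<0$ and $\phi^-_{i,m}=0$ for $m>0$. For a $\mathcal{U}_q(\hat{\mathfrak{g}})$-module $V$ and $\omega\in\mathfrak{h}^*$, $V_\omega=\{v\in V:\ k_h.v=q^{\omega(h)}v\ \forall h\in\mathfrak{h}\}$. $V$ is integrable if $V=\bigoplus_{\omega\in\mathfrak{h}^*}V_\omega$, every $V_\omega$ is finite dimensional, and for all $\mu\in\mathfrak{h}^*$, $i\in I$ there is $R\ge0$ such that $V_{\mu\pm r\alpha_i}=\{0\}$ for all integers $r\ge R$. An $l$-weight is a pair $(\lambda,\Psi)$ with $\lambda\in\mathfrak{h}^*$, $\Psi=(\Psi_{i,\pm m}^{\pm})_{i\in I,m\ge0}$, $\Psi_{i,\pm m}^{\pm}\in\mathbb{C}$ and $\Psi_{i,0}^{\pm}=q_i^{\pm\lambda(\alpha_i^\vee)}$; $P_l$ is the set of $l$-weights. A module $V$ is of $l$-highest weight $(\lambda,\Psi)$ if there is $v\in V$ with $V=\mathcal{U}_q(\hat{\mathfrak{g}}).v$ and $x_{i,r}^+.v=0$, $\phi_{i,\pm m}^{\pm}.v=\Psi_{i,\pm m}^{\pm}v$, $k_h.v=q^{\lambda(h)}v$ for all $i\in I,r\in\mathbb{Z},m\ge0,h\in\mathfrak{h}$. For each $(\lambda,\Psi)\in P_l$ there is, up to isomorphism, a unique simple module $L(\lambda,\Psi)$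 of $l$-highest weight $(\lambda,\Psi)$. $P_l^+$ is the set of $(\lambda,\Psi)\in P_l$ for which there exist polynomials $P_i(z)\in\mathbb{C}[z]$ ($i\in I$) with constant term $1$ such that in $\mathbb{C}[[z]]$ (for $+$) and in $\mathbb{C}[[z^{-1}]]$ (for $-$): $\sum_{m\ge0}\Psi_{i,\pm m}^{\pm}z^{\pm m}=q_i^{\deg(P_i)}\frac{P_i(zq_i^{-1})}{P_i(zq_i)}$. *)

(* Defs.v *)
From HB Require Import structures.
From mathcomp Require Import all_boot all_order all_algebra all_fingroup.
From mathcomp Require Import finmap generic_quotient ring_quotient.
From mathcomp Require Import boolp reals sequences exp trigo.
From mathcomp Require Import complex monalg.

Set Implicit Arguments.
Unset Strict Implicit.
Unset Printing Implicit Defensive.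

Import Order.TTheory GRing.Theory Num.Theory.

Local Open Scope ring_scope.
Local Open Scope complex_scope.
Local Open Scope quotient_scope.

Definition cexp (R : realType) (z : R[i]) : R[i] :=
  let: x +i* y := z in (expR x)%:C * (cos y +i* sin y).

(* q ^ a for a rational, where l is the chosen logarithm of q. *)
Definition cpow (R : realType) (l : R[i]) (a : rat) : R[i] := cexp (ratr a * l).

Section QuantumIntegers.
Variable K : fieldType.

Definition qint (z : K) (m : int) : K := (z ^ m - z ^ (- m)) / (z - z^-1).

Definition qfact (z : K) (m : nat) : K := \prod_(1 <= j < m.+1) qint z j.

Definition qbin (z : K) (s k : nat) : K :=
  qfact z s / (qfact z k * qfact z (s - k)).

End QuantumIntegers.

Record symmetrizable_gcm (n : nat) := SymmetrizableGCM {
  gcm :> 'M[int]_n;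
  gcm_diag : forall i, gcm i i = 2;
  gcm_offdiag : forall i j, i != j -> gcm i j <= 0;
  gcm_eq0 : forall i j, gcm i j = 0 <-> gcm j i = 0;
  gcm_r : 'I_n -> nat;
  gcm_r_gt0 : forall i, (0 < gcm_r i)%N;
  gcm_sym : forall i j, (gcm_r i)%:Z * gcm i j = (gcm_r j)%:Z * gcm j i
}.

Record realization (n : nat) (A : symmetrizable_gcm n) := Realization {
  cartan : vectType rat;
  root : 'I_n -> 'Hom(cartan, rat^o);
  coroot : 'I_n -> cartan;
  dim_cartan :
    \dim {: cartan} = (2 * n - \rank (map_mx intr A : 'M[rat]_n))%N;
  root_free : free (codom root);
  coroot_free : free (codom coroot);
  root_coroot : forall i j, root j (coroot i) = (A i j)%:~R
}.

Fact mul_sub_split (S : pzRingType) (a b x y : S) :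
  a * b - x * y = (a - x) * b + x * (b - y).
Proof. by rewrite mulrBl mulrBr addrA subrK. Qed.

Fact malg_scaleAr (S : comNzRingType) (M : monomType) (c : S)
    (x y : {malg S[M]}) :
  c *: (x * y) = x * (c *: y).
Proof.
apply/malgP => k; rewrite mcoeffZ (mcoeffMlw _ (fsubset_refl _) (msuppZ_le c y)).
rewrite (mcoeffMl x y) mulr_sumr; apply: eq_bigr => k1 _.
rewrite mulr_sumr; apply: eq_bigr => k2 _.
by rewrite mulrnAr mcoeffZ mulrCA.
Qed.

(* Signs: true stands for + and false for -. *)
Definition sg (s : bool) : int := if s then 1 else -1.

Section QuantumAffinization.
Variables (K : fieldType) (q : K) (qp : rat -> K).
Variables (n : nat) (A : symmetrizable_gcm n) (H : realization A).

Local Notation h := (cartan H).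

Definition qi (i : 'I_n) : K := q ^+ gcm_r A i.

Definition qipow (i : 'I_n) (a : rat) : K := qp ((gcm_r A i)%:R * a).

Definition symB (i j : 'I_n) : int := (gcm_r A i)%:Z * A i j.

(* The generators x^s_{i,r}, k_a and h_{i,m} (m <> 0), in this order. *)
Definition gen : choiceType :=
  (bool * 'I_n * int + h + 'I_n * {m : int | m != 0})%type.

Section Relations.
Variables (F : lalgType K) (g : gen -> F).

Definition ux (s : bool) (i : 'I_n) (r : int) : F :=
  g (inl (inl (s, i, r))).

Definition uk (a : h) : F := g (inl (inr a)).

(* Made total in m by the junk value 0 at m = 0, which is never used. *)
Definition uh (i : 'I_n) (m : int) : F :=
  if insub m is Some u then g (inr (i, u)) else 0.

(* Coefficient of z^m in exp (\sum_(k >= 1) f k z^k): the powers of the       *)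
(* exponent of order > m and its terms of degree > m do not contribute.       *)
Definition exp_coef (f : nat -> F) (m : nat) : F :=
  \sum_(N < m.+1)
    (N`!%:R^-1 : K) *: ((\sum_(1 <= k < m.+1) f k *: 'X^k) ^+ N : {poly F})`_m.

(* phi^s_{i,m} for all m : int, vanishing when the sign of m is opposite to s. *)
Definition uphi (s : bool) (i : 'I_n) (m : int) : F :=
  if 0 <= sg s * m then
    uk (((sg s)%:~R * (gcm_r A i)%:R : rat) *: coroot H i) *
    exp_coef (fun k => ((sg s)%:~R * (q - q^-1)) *: uh i (sg s * k%:Z)) `|m|%N
  else 0.

Definition serre (s : bool) (i j : 'I_n) (d : nat)
    (r : 'I_d -> int) (r' : int) : F :=
  \sum_(p : 'S_d) \sum_(k < d.+1)
    ((-1) ^+ k * qbin (qi i) d k) *: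
      ((\prod_(l < d | (l < k)%N) ux s i (r (p l))) * ux s j r' *
       (\prod_(l < d | (k <= l)%N) ux s i (r (p l)))).

Inductive defrel : F -> F -> Prop :=
| rel_kk a b : defrel (uk a * uk b) (uk (a + b))
| rel_k0 : defrel (uk 0) 1
| rel_kh a j m : m != 0 -> defrel (uk a * uh j m) (uh j m * uk a)
| rel_hh i j m m' : m != 0 -> m' != 0 ->
    defrel (uh i m * uh j m') (uh j m' * uh i m)
| rel_kx s a j r :
    defrel (uk a * ux s j r * uk (- a))
           (qp ((sg s)%:~R * root H j a) *: ux s j r)
| rel_hx s i j m r : m != 0 ->
    defrel (uh i m * ux s j r - ux s j r * uh i m)
           (((sg s)%:~R * m%:~R^-1 * qint q (m * symB i j)) *:
              ux s j (m + r))
| rel_xx i j r r' :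
    defrel (ux true i r * ux false j r' - ux false j r' * ux true i r)
           (((i == j)%:R / (qi i - (qi i)^-1)) *:
              (uphi true i (r + r') - uphi false i (r + r')))
| rel_quad s i j r r' :
    defrel (ux s i (r + 1) * ux s j r' -
              (q ^ (sg s * symB i j)) *: (ux s j r' * ux s i (r + 1)))
           ((q ^ (sg s * symB i j)) *: (ux s i r * ux s j (r' + 1)) -
              ux s j (r' + 1) * ux s i r)
| rel_serre s i j d (r : 'I_d -> int) r' : i != j -> d%:Z = 1 - A i j ->
    defrel (serre s i j r r') 0.

End Relations.

Section RelationsMorphism.
Variables (F F' : lalgType K) (g : gen -> F) (f : {lrmorphism F -> F'}).

Let f0 : f 0 = 0. Proof. exact: raddf0. Qed.
Let f1 : f 1 = 1. Proof. exact: rmorph1. Qed.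
Let fB x y : f (x - y) = f x - f y. Proof. exact: raddfB. Qed.
Let fM x y : f (x * y) = f x * f y. Proof. exact: rmorphM. Qed.
Let fZ c x : f (c *: x) = c *: f x. Proof. exact: linearZ. Qed.
Let f_sum (J : Type) (r : seq J) (P : pred J) (u : J -> F) :
  f (\sum_(j <- r | P j) u j) = \sum_(j <- r | P j) f (u j).
Proof. exact: raddf_sum. Qed.
Let f_prod (J : Type) (r : seq J) (P : pred J) (u : J -> F) :
  f (\prod_(j <- r | P j) u j) = \prod_(j <- r | P j) f (u j).
Proof. exact: rmorph_prod. Qed.

Lemma uh_morph i m : f (uh g i m) = uh (f \o g) i m.
Proof. by rewrite /uh; case: insub => [u|]; rewrite ?f0. Qed.

Lemma exp_coef_morph u m : f (exp_coef u m) = exp_coef (f \o u) m.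
Proof.
rewrite /exp_coef f_sum; apply: eq_bigr => N _; rewrite fZ; congr (_ *: _).
rewrite -coef_map rmorphXn rmorph_sum /=.
by under [in LHS]eq_bigr do rewrite map_polyZ map_polyXn.
Qed.

Lemma uphi_morph s i m : f (uphi g s i m) = uphi (f \o g) s i m.
Proof.
rewrite /uphi; case: ifP => _; last exact: f0.
rewrite fM exp_coef_morph; congr (_ * exp_coef _ _).
by apply: funext => k /=; rewrite fZ uh_morph.
Qed.

Lemma serre_morph s i j d (r : 'I_d -> int) r' :
  f (serre g s i j r r') = serre (f \o g) s i j r r'.
Proof.
rewrite /serre f_sum; apply: eq_bigr => p _; rewrite f_sum.
by apply: eq_bigr => k _; rewrite fZ !fM !f_prod.
Qed.

Lemma defrel_morph u v : defrel (f \o g) u v ->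
  exists x y, [/\ f x = u, f y = v & defrel g x y].
Proof.
case=> [a b||a j m m0|i j m m' m0 m'0|s a j r|s i j m r m0|i j r r'|s i j r r'|s i j d r r' ij dE].
- by do 2!eexists; split; last exact: (rel_kk _ a b); rewrite ?fM.
- by do 2!eexists; split; last exact: rel_k0; rewrite ?f1.
- by do 2!eexists; split; last exact: (rel_kh _ a j m0);
    rewrite fM uh_morph.
- by do 2!eexists; split; last exact: (rel_hh _ i j m0 m'0);
    rewrite fM !uh_morph.
- by do 2!eexists; split; last exact: (rel_kx _ s a j r); rewrite ?fZ ?fM.
- by do 2!eexists; split; last exact: (rel_hx _ s i j r m0);
    rewrite ?fB ?fZ ?fM ?uh_morph.
- by do 2!eexists; split; last exact: (rel_xx _ i j r r');
    rewrite ?fZ ?fB ?fM ?uphi_morph.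
- by do 2!eexists; split; last exact: (rel_quad _ s i j r r');
    rewrite fB fZ !fM.
- by do 2!eexists; split; last exact: (rel_serre _ s r r' ij dE);
    rewrite ?serre_morph ?f0.
Qed.

End RelationsMorphism.

(* The trivial one-dimensional representation, which shows that 1 <> 0 in Uq. *)
Definition aug_gen (g : gen) : K := if g is inl (inr _) then 1 else 0.

Section Augmentation.
Variables (F : lalgType K) (g : gen -> F) (eps : {lrmorphism F -> K | *%R}).
Hypothesis eps_gen : forall x, eps (g x) = aug_gen x.

Let eps0 : eps 0 = 0. Proof. exact: raddf0. Qed.
Let eps1 : eps 1 = 1. Proof. exact: rmorph1. Qed.
Let epsB x y : eps (x - y) = eps x - eps y. Proof. exact: raddfB. Qed.
Let epsM x y : eps (x * y) = eps x * eps y. Proof. exact: rmorphM. Qed.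
Let epsZ c x : eps (c *: x) = c * eps x. Proof. exact: linearZ. Qed.
Let eps_sum (J : Type) (r : seq J) (P : pred J) (f : J -> F) :
  eps (\sum_(j <- r | P j) f j) = \sum_(j <- r | P j) eps (f j).
Proof. exact: raddf_sum. Qed.

Lemma aug_fx s i r : eps (ux g s i r) = 0. Proof. exact: eps_gen. Qed.
Lemma aug_fk a : eps (uk g a) = 1. Proof. exact: eps_gen. Qed.
Lemma aug_fh i m : eps (uh g i m) = 0.
Proof. by rewrite /uh; case: insubP => *; [exact: eps_gen|exact: eps0]. Qed.

Lemma aug_exp_coef f m : (forall k, eps (f k) = 0) ->
  eps (exp_coef f m) = (m == 0)%:R.
Proof.
move=> f0; rewrite /exp_coef; set p := \sum_(1 <= k < m.+1) f k *: 'X^k : {poly F}.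
have p0 j : eps p`_j = 0.
  rewrite /p coef_sum eps_sum big1 // => k _.
  by rewrite coefZ epsM f0 mul0r.
have pN N : eps (p ^+ N.+1)`_m = 0.
  rewrite exprS coefM eps_sum big1 // => k _.
  by rewrite epsM p0 mul0r.
rewrite eps_sum big_ord_recl big1 => [|N _]; last first.
  by rewrite epsZ pN mulr0.
rewrite addr0 epsZ expr0 coef1 invr1 mul1r.
by case: eqP => _; rewrite ?eps1 ?eps0.
Qed.

Lemma aug_fphi s i m : eps (uphi g s i m) = (m == 0)%:R.
Proof.
rewrite /uphi; case: ifP => [_|/negP m0]; last first.
  rewrite eps0; case: eqP m0 => // ->; by rewrite mulr0.
rewrite epsM aug_fk mul1r aug_exp_coef ?absz_eq0 // => k.
by rewrite epsZ aug_fh mulr0.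
Qed.

Lemma aug_serre s i j d (r : 'I_d -> int) r' : eps (serre g s i j r r') = 0.
Proof.
rewrite /serre eps_sum big1 // => p _; rewrite eps_sum big1 // => k _.
by rewrite epsZ !epsM aug_fx mulr0 mul0r mulr0.
Qed.

Lemma aug_defrel x y : defrel g x y -> eps (x - y) = 0.
Proof.
case=> [a b||a j m _|i j m m' _ _|s a j r|s i j m r _|i j r r'|s i j r r'|s i j d r r' _ _].
- by rewrite epsB epsM !aug_fk mulr1 subrr.
- by rewrite epsB aug_fk eps1 subrr.
- by rewrite epsB !epsM aug_fk aug_fh mulr0 mul0r subrr.
- by rewrite epsB !epsM !aug_fh mulr0 subrr.
- by rewrite epsB epsZ !epsM aug_fx !mulr0 mul0r subrr.
- by rewrite !epsB epsZ !epsM !aug_fx !mulr0 mul0r !subrr.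
- by rewrite !epsB epsZ epsB !epsM !aug_fx !aug_fphi !mulr0 !subrr mulr0 subrr.
- by rewrite !epsB !epsZ !epsM !aug_fx !mulr0 !subrr.
- by rewrite epsB aug_serre eps0 subrr.
Qed.

End Augmentation.

Definition freeAlg : Type := {malg K[{fmonom gen}]}.
HB.instance Definition _ := GRing.Lalgebra.on freeAlg.

Definition fgen (x : gen) : freeAlg := << fmu x >>.

Inductive relideal : freeAlg -> Prop :=
| relideal_rel x y : defrel fgen x y -> relideal (x - y)
| relideal0 : relideal 0
| relidealD x y : relideal x -> relideal y -> relideal (x + y)
| relidealMl x y : relideal y -> relideal (x * y)
| relidealMr x y : relideal x -> relideal (x * y).

Definition relidealb : {pred freeAlg} := fun x => `[< relideal x >].

Lemma relidealP x : reflect (relideal x) (x \in relidealb).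
Proof. exact: asboolP. Qed.

Fact relidealb_zmod_closed : zmod_closed relidealb.
Proof.
split=> [|x y /relidealP Ix /relidealP Iy]; apply/relidealP.
  exact: relideal0.
by apply: relidealD => //; rewrite -mulN1r; apply: relidealMl.
Qed.

HB.instance Definition _ :=
  GRing.isZmodClosed.Build freeAlg relidealb relidealb_zmod_closed.

Definition Uq := {ideal_quot relidealb}.

HB.instance Definition _ := GRing.Zmodule.on Uq.
HB.instance Definition _ : EqQuotient freeAlg (Quotient.equiv relidealb) Uq :=
  EqQuotient.on Uq.

Definition Upi (x : freeAlg) : Uq := \pi_Uq x.

Lemma Upi_eq x y : Upi x = Upi y <-> relideal (x - y).
Proof.
split=> [e|I]; first by apply/relidealP; rewrite Quotient.idealrBE; apply/eqP.
by apply/eqP; rewrite /Upi -Quotient.idealrBE; apply/relidealP.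
Qed.

Lemma UpiD : {morph Upi : x y / x + y}. Proof. exact: Quotient.pi_add. Qed.
Lemma UpiN : {morph Upi : x / - x}. Proof. exact: Quotient.pi_opp. Qed.

Lemma Upi_surj (u : Uq) : exists x, Upi x = u.
Proof. by exists (repr u); rewrite /Upi reprK. Qed.

Definition Uone : Uq := Upi 1.
Definition Umul (u v : Uq) : Uq := Upi (repr u * repr v).
Definition Uscale (c : K) (u : Uq) : Uq := Upi (c *: repr u).

Lemma repr_Upi x : relideal (repr (Upi x) - x).
Proof. by apply/Upi_eq; rewrite /Upi reprK. Qed.

Lemma UpiM : {morph Upi : x y / x * y >-> Umul x y}.
Proof.
move=> x y; apply: esym; apply/Upi_eq.
rewrite mul_sub_split.
by apply: relidealD; [apply: relidealMr|apply: relidealMl]; apply: repr_Upi.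
Qed.

Lemma UpiZ c : {morph Upi : x / c *: x >-> Uscale c x}.
Proof.
move=> x; apply: esym; apply/Upi_eq; rewrite -scalerBr -mul_malgC.
by apply: relidealMl; apply: repr_Upi.
Qed.

Fact UmulA : associative Umul.
Proof.
move=> u v w; have [[x <-] [y <-] [z <-]] := And3 (Upi_surj u) (Upi_surj v) (Upi_surj w).
by rewrite -!UpiM mulrA.
Qed.

Fact Umul1 : left_id Uone Umul.
Proof. by move=> u; have [x <-] := Upi_surj u; rewrite -UpiM mul1r. Qed.

Fact Umulr1 : right_id Uone Umul.
Proof. by move=> u; have [x <-] := Upi_surj u; rewrite -UpiM mulr1. Qed.

Fact UmulDl : left_distributive Umul +%R.
Proof.
move=> u v w; have [[x <-] [y <-] [z <-]] := And3 (Upi_surj u) (Upi_surj v) (Upi_surj w).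
by rewrite -!(UpiM, UpiD) mulrDl.
Qed.

Fact UmulDr : right_distributive Umul +%R.
Proof.
move=> u v w; have [[x <-] [y <-] [z <-]] := And3 (Upi_surj u) (Upi_surj v) (Upi_surj w).
by rewrite -!(UpiM, UpiD) mulrDr.
Qed.

Definition aug_mon (m : {fmonom gen}) : K := \prod_(g <- m) aug_gen g.

Fact aug_mon_mmorphism : mmorphism aug_mon.
Proof.
split=> [x y|]; rewrite /aug_mon; last by rewrite fm1 big_nil.
by rewrite fmM big_cat.
Qed.
HB.instance Definition _ :=
  monalg.isMultiplicative.Build {fmonom gen} K aug_mon aug_mon_mmorphism.

Definition aug (x : freeAlg) : K := mmap idfun aug_mon x.

Lemma augD : {morph aug : x y / x + y}. Proof. exact: raddfD. Qed.
Lemma aug1 : aug 1 = 1. Proof. exact: rmorph1. Qed.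
Lemma aug0 : aug 0 = 0. Proof. exact: raddf0. Qed.
Lemma augM : {morph aug : x y / x * y}. Proof. exact: rmorphM. Qed.

Lemma aug_fgen g : aug (fgen g) = aug_gen g.
Proof. by rewrite /aug mmapU mul1r /aug_mon fmU big_seq1. Qed.


Lemma aug_relideal x : relideal x -> aug x = 0.
Proof.
elim=> {x} [x y xy||x y _ x0 _ y0|x y _ y0|x y _ x0].
- exact: (aug_defrel (eps := mmap idfun aug_mon) aug_fgen).
- exact: aug0.
- by rewrite augD x0 y0 addr0.
- by rewrite augM y0 mulr0.
- by rewrite augM x0 mul0r.
Qed.

Fact Uone_neq0 : Uone != 0.
Proof.
apply/eqP => e; suff /aug_relideal : relideal (1 - 0).
  by rewrite subr0 aug1 => /eqP; rewrite oner_eq0.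
by apply/Upi_eq; rewrite -[LHS]/Uone e -(subrr (0 : freeAlg)) UpiD UpiN subrr.
Qed.

HB.instance Definition _ := GRing.Zmodule_isNzRing.Build Uq
  UmulA Umul1 Umulr1 UmulDl UmulDr Uone_neq0.

Fact UscaleA c d u : Uscale c (Uscale d u) = Uscale (c * d) u.
Proof. by have [x <-] := Upi_surj u; rewrite -!UpiZ scalerA. Qed.

Fact Uscale1 : left_id 1 Uscale.
Proof. by move=> u; have [x <-] := Upi_surj u; rewrite -UpiZ scale1r. Qed.

Fact UscaleDr : right_distributive Uscale +%R.
Proof.
move=> c u v; have [[x <-] [y <-]] := conj (Upi_surj u) (Upi_surj v).
by rewrite -!(UpiZ, UpiD) scalerDr.
Qed.

Fact UscaleDl u : {morph Uscale^~ u : c d / c + d}.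
Proof.
by move=> c d; have [x <-] := Upi_surj u; rewrite -!(UpiZ, UpiD) scalerDl.
Qed.

HB.instance Definition _ := GRing.Zmodule_isLmodule.Build K Uq
  UscaleA Uscale1 UscaleDr UscaleDl.

Fact UscaleAl (c : K) (u v : Uq) : c *: (u * v) = c *: u * v.
Proof.
have [[x <-] [y <-]] := conj (Upi_surj u) (Upi_surj v).
by rewrite -[LHS]/(Uscale c (Umul _ _)) -[RHS]/(Umul (Uscale c _) _)
  -!(UpiZ, UpiM) scalerAl.
Qed.

HB.instance Definition _ := GRing.Lmodule_isLalgebra.Build K Uq UscaleAl.

Fact UscaleAr (c : K) (u v : Uq) : c *: (u * v) = u * (c *: v).
Proof.
have [[x <-] [y <-]] := conj (Upi_surj u) (Upi_surj v).
by rewrite -[LHS]/(Uscale c (Umul _ _)) -[RHS]/(Umul _ (Uscale c _))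
  -!(UpiZ, UpiM) malg_scaleAr.
Qed.

HB.instance Definition _ := GRing.Lalgebra_isAlgebra.Build K Uq UscaleAr.

Fact Upi_zmod_morphism : zmod_morphism Upi.
Proof. by move=> x y; rewrite UpiD UpiN. Qed.

HB.instance Definition _ :=
  GRing.isZmodMorphism.Build freeAlg Uq Upi Upi_zmod_morphism.

Fact Upi_monoid_morphism : monoid_morphism Upi.
Proof. split; [exact: erefl | exact: UpiM]. Qed.

HB.instance Definition _ :=
  GRing.isMonoidMorphism.Build freeAlg Uq Upi Upi_monoid_morphism.

HB.instance Definition _ :=
  GRing.isScalable.Build K freeAlg Uq *:%R Upi UpiZ.

Definition Ugen (x : gen) : Uq := Upi (fgen x).

Lemma Ugen_rel u v : defrel Ugen u v -> u = v.
Proof.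
case/(defrel_morph (f := Upi)) => x [y [<- <- xy]].
by apply/Upi_eq; apply: relideal_rel.
Qed.

End QuantumAffinization.

Section PowerSeries.
Variable K : fieldType.

(* \sum_(m >= 0) a m z^m = F(z) / G(z) in K[[z]], for G`_0 != 0; the product  *)
(* of the series by G is compared with F coefficientwise.                     *)
Definition expansion_at_0 (a : nat -> K) (F G : {poly K}) : Prop :=
  forall N : nat, \sum_(j < N.+1) a (N - j)%N * G`_j = F`_N.

(* \sum_(m >= 0) a m z^(-m) = F(z) / G(z) in K((z^-1)), for G != 0; N is the  *)
(* exponent of z.                                                             *)
Definition expansion_at_infty (a : nat -> K) (F G : {poly K}) : Prop :=
  forall N : int,
    \sum_(j < size G | N <= j%:Z) a `|j%:Z - N|%N * G`_j
    = if N is Posz k then F`_k else 0.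

End PowerSeries.

Definition simple_module (S : nzRingType) (V : lmodType S) : Prop :=
  (exists v : V, v != 0) /\
  forall W : {pred V}, submod_closed W -> W =i pred1 0 \/ W =i predT.

Section Modules.
Variables (K : fieldType) (q : K) (qp : rat -> K).
Variables (n : nat) (A : symmetrizable_gcm n) (H : realization A).

Local Notation h := (cartan H).
Local Notation hdual := 'Hom(h, rat^o).
Local Notation U := (Uq q qp H).
Local Notation gen := (@Ugen K q qp n A H).

(* A vector space structure over K on a U-module comes from the structure map *)
(* c |-> c%:A of the K-algebra U.                                             *)
Definition weight_space (V : lmodType U) (w : hdual) (v : V) : Prop :=
  forall a : h, uk gen a *: v = (qp (w a))%:A *: v.

Record integrable (V : lmodType U) : Prop := Integrable {
  weight_sum : forall v : V, exists (s : seq hdual) (u : hdual -> V),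
    (forall w, weight_space w (u w)) /\ v = \sum_(w <- s) u w;
  weight_direct : forall (s : seq hdual) (u : hdual -> V), uniq s ->
    (forall w, weight_space w (u w)) -> \sum_(w <- s) u w = 0 ->
    forall w, w \in s -> u w = 0;
  weight_findim : forall w : hdual, exists b : seq V,
    (forall v, v \in b -> weight_space w v) /\
    forall v, weight_space w v ->
      exists c : nat -> K, v = \sum_(k < size b) (c k)%:A *: b`_k;
  weight_vanish : forall (mu : hdual) (i : 'I_n), exists N : nat,
    forall r : nat, (N <= r)%N -> forall v : V,
      (weight_space (mu + root H i *+ r) v -> v = 0) /\
      (weight_space (mu - root H i *+ r) v -> v = 0)
}.

(* lw_psi s i m is Psi^s_{i, s m} for m >= 0.                                 *)
Record lweight := LWeight {
  lw_wt : hdual;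
  lw_psi : bool -> 'I_n -> nat -> K;
  lw_psi0 : forall s i,
    lw_psi s i 0 = qipow qp A i ((sg s)%:~R * lw_wt (coroot H i))
}.

Definition of_l_highest_weight (x : lweight) (V : lmodType U) : Prop :=
  exists v : V,
    [/\ forall w : V, exists u : U, w = u *: v,
        forall i r, ux gen true i r *: v = 0,
        forall s i (m : nat),
          uphi q gen s i (sg s * m%:Z) *: v = (lw_psi x s i m)%:A *: v
      & weight_space (lw_wt x) v].

Definition dominant (x : lweight) : Prop :=
  exists P : 'I_n -> {poly K}, forall i,
    let F := qi q A i ^+ (size (P i)).-1 *: (P i \Po ((qi q A i)^-1 *: 'X)) in
    let G := P i \Po (qi q A i *: 'X) in
    [/\ (P i)`_0 = 1,
        expansion_at_0 (lw_psi x true i) F G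
      & expansion_at_infty (lw_psi x false i) F G].

End Modules.

(* Main.v *)
Require Import Defs.
From HB Require Import structures.
From mathcomp Require Import all_boot all_order all_algebra.
From mathcomp Require Import perm monalg boolp.
From mathcomp Require Import reals exp trigo complex.
From mathcomp Require Import ring lra zify.

Set Implicit Arguments.
Unset Strict Implicit.
Unset Printing Implicit Defensive.

Import Order.TTheory GRing.Theory Num.Theory.

Local Open Scope ring_scope.
Local Open Scope complex_scope.

(* Fix i, put c = q_i^2, and write x^+_r, x^-_r for the currents of index i.
   Any series Psi^+ with constant term q_i^d is q_i^d G(z/c) / G(z) for a unique
   G with G(0) = 1.  Exponentiating the h_{i,m} with m > 0 gives a series
   B(z) = \sum_m B_m z^m in commuting operators that fixes the highest weight
   vector v and satisfies B(z) x^-_r = (\sum_k z^k x^-_{r+k}) B(z); put H = G B.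
   With V_N = (x^-_0)^N v, the operator x^+_0 maps H_m V_{N+1} to a multiple of
   H_m V_N which is nonzero unless m + N = d.
   - If (x^-_0)^{d+1} v = 0, then descending in N gives H_m V_N = 0 for
     m + N > d.  At N = 0 this says that G is a polynomial of degree at most d;
     at N = 1 it is a recurrence for the x^-_r v, which yields
     G(z) (Psi^+(z) - Psi^-(z)) = 0 and hence the expansion of Psi^-.
   - If G is a polynomial of degree d, then ascending in N, the vectors H_m V_N
     with m + N > d are killed by all x^+_s with s > 0; a finite-dimensional
     Krylov argument with h_{i,-1} extends this to all s, so they are singular
     and vanish by simplicity.  At m = 0 this is (x^-_0)^{d+1} v = 0.
   The quadratic and Serre relations propagate nilpotency of x^-_{i,0} from v to
   the whole module, and sl_2-strings bound the weights.  Weight spaces are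
   finite-dimensional because the recurrence bounds the indices r needed in
   x^-_{i,r} v, and the quadratic relations then bound them in longer words. *)

(** * Formal power series *)

(** The form of $H = GB$ is dictated by the computation of $x^+_0V_{N+1}$. Moving $x^+_0$ through
    $(x^-_0)^{N+1}$ leaves a sum of terms $(x^-_0)^a\phi^+(x^-_0)^b$, which the quadratic relation
    collapses to a scalar times $y^N\phi^+$; here $y(z)$ is $x^-_0$ twisted by
    $(1-z\xi)/(1-z\xi/c)$, with $\xi$ the shift of the index. Conjugation by $B(z)$ cancels the
    numerator, conjugation by $B(z/c)$ undoes the rest, and $G\Psi^+=\Psi_0G(z/c)$ supplies the
    matching scalar series. Hence $Hy^N\phi^+v=\Psi_0H(z/c)V_N$, the source of the factor $c^{-m}$
    and of the exceptional line $m+N=d$. Only $\phi^+$, the zero mode of $\phi^-$ and the $x^+_s$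
    with $s\ge0$ enter here, so all series are one-sided. The price is paid afterwards: negative $s$
    requires the Krylov argument, and $\Psi^-$ is recovered by letting every $x^+_s$ act on a
    recurrence. Until the last section the algebra is any one that satisfies the relations, over a
    field of characteristic 0. *)

Definition fps (S : Type) : Type := nat -> S.

HB.instance Definition _ (S : Type) := gen_eqMixin (fps S).
HB.instance Definition _ (S : Type) := gen_choiceMixin (fps S).

Section FpsZmodule.
Variable S : zmodType.

Fact fps_addA : associative (fun f g : fps S => (fun m => f m + g m) : fps S).
Proof. by move=> f g h; apply/funext => m; rewrite addrA. Qed.
Fact fps_addC : commutative (fun f g : fps S => (fun m => f m + g m) : fps S).
Proof. by move=> f g; apply/funext => m; rewrite addrC. Qed.
Fact fps_add0 :
  left_id ((fun=> 0) : fps S) (fun f g : fps S => (fun m => f m + g m) : fps S).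
Proof. by move=> f; apply/funext => m; rewrite add0r. Qed.
Fact fps_addN : left_inverse ((fun=> 0) : fps S)
  (fun f : fps S => (fun m => - f m) : fps S)
  (fun f g : fps S => (fun m => f m + g m) : fps S).
Proof. by move=> f; apply/funext => m; rewrite addNr. Qed.

HB.instance Definition _ := GRing.isZmodule.Build (fps S)
  fps_addA fps_addC fps_add0 fps_addN.

Lemma fpsD (f g : fps S) m : (f + g) m = f m + g m. Proof. by []. Qed.
Lemma fpsN (f : fps S) m : (- f) m = - f m. Proof. by []. Qed.
Lemma fpsB (f g : fps S) m : (f - g) m = f m - g m. Proof. by []. Qed.

End FpsZmodule.

Section FpsRing.
Variable S : nzRingType.
Implicit Types f g h : fps S.

Definition fps_const (c : S) : fps S := fun m => if m == 0%N then c else 0.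

Definition fps_mul f g : fps S :=
  fun m => \sum_(k < m.+1) f k * g (m - k)%N.

Definition fps_trunc (m : nat) f : {poly S} := \poly_(k < m.+1) f k.

(** Up to degree [m] the product is that of truncated polynomials, so associativity is inherited
    from [{poly S}]. *)
Lemma fps_mul_trunc f g j m : (j <= m)%N ->
  fps_mul f g j = (fps_trunc m f * fps_trunc m g)`_j.
Proof.
move=> jm; rewrite coefM; apply: eq_bigr => k _.
rewrite !coef_poly !ltnS (leq_trans (leq_subr _ _) jm).
by rewrite (leq_trans (leq_ord k) jm).
Qed.

Fact fps_mulA : associative fps_mul.
Proof.
move=> f g h; apply/funext => m.
have E : fps_mul f (fps_mul g h) m =
         (fps_trunc m f * (fps_trunc m g * fps_trunc m h))`_m.
  rewrite coefM; apply: eq_bigr => k _.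
  by rewrite (fps_mul_trunc _ _ (leq_subr k m)) coef_poly ltn_ord.
rewrite E mulrA coefM; apply: eq_bigr => k _.
by rewrite (fps_mul_trunc _ _ (leq_ord k)) coef_poly ltnS leq_subr.
Qed.

Fact fps_mul1 : left_id (fps_const 1) fps_mul.
Proof.
move=> f; apply/funext => m; rewrite /fps_mul big_ord_recl big1 => [|k _].
  by rewrite mul1r addr0 subn0.
by rewrite mul0r.
Qed.

Fact fps_mulr1 : right_id (fps_const 1) fps_mul.
Proof.
move=> f; apply/funext => m; rewrite /fps_mul big_ord_recr big1 => [|k _] /=.
  by rewrite add0r subnn mulr1.
by rewrite /fps_const subn_eq0 leqNgt ltn_ord mulr0.
Qed.

Fact fps_mulDl : left_distributive fps_mul +%R.
Proof.
move=> f g h; apply/funext => m; rewrite /fps_mul [RHS]fpsD -big_split.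
by apply: eq_bigr => k _; rewrite mulrDl.
Qed.

Fact fps_mulDr : right_distributive fps_mul +%R.
Proof.
move=> f g h; apply/funext => m; rewrite /fps_mul [RHS]fpsD -big_split.
by apply: eq_bigr => k _; rewrite mulrDr.
Qed.

Fact fps_1_neq0 : fps_const 1 != 0.
Proof. by apply/eqP => /(congr1 (@^~ 0%N))/eqP; rewrite oner_eq0. Qed.

HB.instance Definition _ := GRing.Zmodule_isNzRing.Build (fps S)
  fps_mulA fps_mul1 fps_mulr1 fps_mulDl fps_mulDr fps_1_neq0.

Lemma fpsM f g m : (f * g) m = \sum_(k < m.+1) f k * g (m - k)%N.
Proof. by []. Qed.

Lemma fps1 m : (1 : fps S) m = (m == 0%N)%:R.
Proof. by rewrite -[LHS]/(fps_const 1 m) /fps_const; case: eqP. Qed.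

Lemma fps_sum (J : Type) (r : seq J) (P : pred J) (F : J -> fps S) m :
  (\sum_(j <- r | P j) F j) m = \sum_(j <- r | P j) F j m.
Proof. exact: (big_morph (fun f : fps S => f m)). Qed.

Lemma fps_constM c f m : (fps_const c * f) m = c * f m.
Proof.
by rewrite fpsM big_ord_recl subn0 big1 ?addr0 // => k _; rewrite mul0r.
Qed.

Lemma fpsMconst c f m : (f * fps_const c) m = f m * c.
Proof.
rewrite fpsM big_ord_recr big1 /= => [|k _]; first by rewrite add0r subnn.
by rewrite /fps_const subn_eq0 leqNgt ltn_ord mulr0.
Qed.

Fact fps_const_zmod_morphism : zmod_morphism fps_const.
Proof.
by move=> c d; apply/funext => -[|m]; rewrite fpsB /fps_const /= ?subr0.
Qed.
HB.instance Definition _ := GRing.isZmodMorphism.Build S (fps S) fps_const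
  fps_const_zmod_morphism.

Fact fps_const_monoid_morphism : monoid_morphism fps_const.
Proof.
split=> // c d; apply/funext => m; rewrite fps_constM /fps_const.
by case: eqP; rewrite ?mulr0.
Qed.
HB.instance Definition _ := GRing.isMonoidMorphism.Build S (fps S) fps_const
  fps_const_monoid_morphism.

(** The Euler derivation $z\,d/dz$. It preserves degrees and, in characteristic 0, determines a
    series up to its constant term; exponentials are handled through [fps_theta E = h * E]. *)
Definition fps_theta f : fps S := fun m => f m *+ m.

Lemma fps_theta_mul f g :
  fps_theta (f * g) = fps_theta f * g + f * fps_theta g.
Proof.
apply/funext => m; rewrite /fps_theta fpsD !fpsM -sumrMnl -big_split.
apply: eq_bigr => k _.
rewrite /= mulrnAl mulrnAr -mulrnDr subnKC //.
by rewrite -ltnS.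
Qed.

Lemma fps_theta_exp f k : f * fps_theta f = fps_theta f * f ->
  fps_theta (f ^+ k.+1) = (fps_theta f * f ^+ k) *+ k.+1.
Proof.
move=> fC; elim: k => [|k IH]; first by rewrite expr1 expr0 mulr1.
rewrite exprS fps_theta_mul IH mulrnAr mulrA fC -mulrA -exprS.
by rewrite [in RHS]mulrS.
Qed.

End FpsRing.

Section FpsComRing.
Variable K : comNzRingType.

Fact fps_mulC : commutative (@fps_mul K).
Proof.
move=> f g; apply/funext => m; rewrite /fps_mul (reindex_inj rev_ord_inj) /=.
apply: eq_bigr => k _; rewrite mulrC subSS; congr (g _ * _).
by rewrite subKn // -ltnS.
Qed.

HB.instance Definition _ := GRing.PzRing_hasCommutativeMul.Build (fps K) fps_mulC.

Definition geom (c : K) : fps K := fun m => c ^+ m.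

Definition fps_var : fps K := fun m => (m == 1%N)%:R.

Lemma fps_varM f m : (fps_var * f) m = if m is k.+1 then f k else 0.
Proof.
rewrite fpsM; case: m => [|m]; first by rewrite big_ord1 mul0r.
rewrite 2!big_ord_recl mul0r add0r mul1r subn1 big1 ?addr0 // => k _.
by rewrite mul0r.
Qed.

Lemma geomE (c : K) : (1 - fps_const c * fps_var) * geom c = 1.
Proof.
apply/funext => m; rewrite mulrBl mul1r fpsB -mulrA fps_constM fps_varM fps1.
by case: m => [|m] /=; rewrite ?mulr0 ?subr0 // /geom exprS subrr.
Qed.

Lemma fps_theta_const (c : K) : fps_theta (fps_const c) = 0.
Proof. by apply/funext => -[|m]; rewrite /fps_theta /fps_const ?mul0rn. Qed.

Lemma fps_theta_var : fps_theta fps_var = fps_var.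
Proof. by apply/funext => -[|[|m]]; rewrite /fps_theta /fps_var ?mul0rn. Qed.

Lemma fps_thetaB (f g : fps K) : fps_theta (f - g) = fps_theta f - fps_theta g.
Proof. by apply/funext => m; rewrite /fps_theta !fpsB mulrnBl. Qed.

Lemma fps_theta_geom (c : K) :
  fps_theta (geom c) = fps_const c * fps_var * geom c ^+ 2.
Proof.
have := congr1 (@fps_theta K) (geomE c).
rewrite fps_theta_mul fps_thetaB fps_theta_mul fps_theta_const fps_theta_var.
rewrite -[X in fps_theta X - _]/(fps_const 1) -[X in _ = fps_theta X]/(fps_const 1).
rewrite !fps_theta_const => /(congr1 (fun f => geom c * f)).
have := geomE c; set u := fps_const c * fps_var; set w := geom c.
set t := fps_theta w => uw; rewrite mulr0 => E.
transitivity (w * (1 - u) * t); first by rewrite [w * _]mulrC uw mul1r.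
by apply/eqP; rewrite -subr_eq0 -[X in _ == X]E; apply/eqP; ring.
Qed.

End FpsComRing.

Section FpsAlgebra.
Variables (K : comNzRingType) (A : algType K).
Implicit Types f g : fps A.

Definition fps_scale (c : K) f : fps A := fun m => c *: f m.

Fact fps_scaleA c d f : fps_scale c (fps_scale d f) = fps_scale (c * d) f.
Proof. by apply/funext => m; rewrite /fps_scale scalerA. Qed.
Fact fps_scale1 : left_id 1 fps_scale.
Proof. by move=> f; apply/funext => m; rewrite /fps_scale scale1r. Qed.
Fact fps_scaleDr : right_distributive fps_scale +%R.
Proof. by move=> c f g; apply/funext => m; rewrite /fps_scale scalerDr. Qed.
Fact fps_scaleDl f : {morph fps_scale^~ f : c d / c + d}.
Proof. by move=> c d; apply/funext => m; rewrite /fps_scale scalerDl. Qed.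

HB.instance Definition _ := GRing.Zmodule_isLmodule.Build K (fps A)
  fps_scaleA fps_scale1 fps_scaleDr fps_scaleDl.

Lemma fpsZ (c : K) f m : (c *: f) m = c *: f m. Proof. by []. Qed.

Fact fps_scaleAl (c : K) f g : c *: (f * g) = c *: f * g.
Proof.
apply/funext => m; rewrite fpsZ !fpsM scaler_sumr.
by apply: eq_bigr => k _; rewrite fpsZ scalerAl.
Qed.
HB.instance Definition _ := GRing.Lmodule_isLalgebra.Build K (fps A) fps_scaleAl.

Fact fps_scaleAr (c : K) f g : c *: (f * g) = f * (c *: g).
Proof.
apply/funext => m; rewrite fpsZ !fpsM scaler_sumr.
by apply: eq_bigr => k _; rewrite fpsZ scalerAr.
Qed.
HB.instance Definition _ := GRing.Lalgebra_isAlgebra.Build K (fps A) fps_scaleAr.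

End FpsAlgebra.

Lemma sum_triangle (V : nmodType) (F : nat -> nat -> V) m :
  \sum_(l < m.+1) \sum_(k < (m - l).+1) F l k =
  \sum_(i < m.+1) \sum_(k < i.+1) F (i - k)%N k.
Proof.
elim: m => [|m IH]; first by rewrite !big_ord1 /= ?subnn ?big_ord1.
rewrite [RHS]big_ord_recr -IH /= big_ord_recr /= subnn big_ord1.
under eq_bigr => l _ do rewrite (subSn (leq_ord l)) big_ord_recr /=.
rewrite big_split /= -addrA; congr (_ + _).
rewrite [RHS](reindex_inj rev_ord_inj) /= [RHS]big_ord_recr /=.
rewrite !subSS subnn subn0; congr (_ + _); apply: eq_bigr => l _.
have lm : (l <= m)%N by rewrite -ltnS.
by rewrite subSS subKn ?subSn // leqW.
Qed.

(** * Currents and exponential series *)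

Section Currents.
Variables (K : fieldType) (A : algType K) (x : int -> A).
Implicit Types (f a b : fps K) (E h : fps A).

(** With $\xi$ the shift $x_s\mapsto x_{s+1}$, this is $f(z\xi)x_r$: a half-current in which only
    indices $\ge r$ occur. *)
Definition current (r : int) f : fps A := fun m => f m *: x (r + m%:Z).

Lemma currentD r f g : current r (f + g) = current r f + current r g.
Proof. by apply/funext => m; rewrite /current fpsD scalerDl. Qed.

Lemma currentZ r c f :
  current r (fps_const c * f) = c *: current r f.
Proof.
by apply/funext => m; rewrite /current fps_constM fpsZ scalerA.
Qed.

Lemma current1 r : current r 1 = fps_const (x r).
Proof.
apply/funext => m; rewrite /current fps1 /fps_const.
by case: eqP => [->|_]; rewrite ?scale0r // addr0 scale1r.
Qed.

Lemma theta_current r f : fps_theta (current r f) = current r (fps_theta f).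
Proof. by apply/funext => m; rewrite /current /fps_theta scalerMnl. Qed.

(* Conjugation by E multiplies the current x(z) by a(z xi). *)
Definition twists E a :=
  forall r, E * fps_const (x r) = current r a * E.

Lemma twistsE E a r m : twists E a ->
  E m * x r = \sum_(k < m.+1) a k *: (x (r + k%:Z) * E (m - k)%N).
Proof.
move=> /(_ r) /(congr1 (fun f : fps A => f m)); rewrite fpsMconst => ->.
by rewrite fpsM; apply: eq_bigr => k _; rewrite -scalerAl.
Qed.

(** Conjugation acts by $a(z\xi)$, and power series in $\xi$ compose by multiplication; in
    coefficients this is the reindexing [sum_triangle]. *)
Lemma twists_current E a f : twists E a ->
  E * current 0 f = current 0 (a * f) * E.
Proof.
move=> Ea; apply/funext => m; rewrite !fpsM (reindex_inj rev_ord_inj) /=.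
pose F l k := (f l * a k) *: (x ((l + k)%:Z) * E (m - (l + k))%N).
transitivity (\sum_(l < m.+1) \sum_(k < (m - l).+1) F l k).
  apply: eq_bigr => l _; have lm : (l <= m)%N by rewrite -ltnS.
  rewrite subSS subKn // /current -scalerAr (twistsE _ _ Ea) scaler_sumr.
  apply: eq_bigr => k _; by rewrite scalerA /F add0r PoszD subnDA.
rewrite sum_triangle; apply: eq_bigr => i _.
rewrite /current fpsM scaler_suml mulr_suml; apply: eq_bigr => k _.
rewrite /F subnK -1?ltnS // -scalerAl; congr (_ *: _); exact: mulrC.
Qed.

Hypothesis char0 : forall m, m.+1%:R != 0 :> K.

Lemma natmul_eq0 (V : lmodType K) (u : V) m : u *+ m.+1 = 0 -> u = 0.
Proof.
rewrite -scaler_nat => /(congr1 (fun w => m.+1%:R^-1 *: w)).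
by rewrite scalerA mulVf ?char0 // scale1r scaler0.
Qed.

(* E = exp (\sum_j h_j xi^j / j); the twisting relation is propagated by the
   differential equation, which avoids logarithms. *)
Lemma exp_twists E h a b :
  E 0%N = 1 -> h 0%N = 0 -> fps_theta E = h * E ->
  a 0%N = 1 -> fps_theta a = b * a ->
  (forall j r, h j * x r - x r * h j = b j *: x (r + j%:Z)) ->
  twists E a.
Proof.
move=> E0 h0 dE a0 da hx r.
(* The defect [D] satisfies the same equation [fps_theta D = h * D] and starts at 0. As [h] has no
   constant term, each coefficient of [D] is determined by the earlier ones. *)
pose D := E * fps_const (x r) - current r a * E.
suff D0 : D = 0 by apply/eqP; rewrite -subr_eq0; apply/eqP.
have hcur : h * current r a = current r a * h + current r (b * a).
  apply/funext => m; rewrite fpsD !fpsM.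
  rewrite [X in _ = X + _](reindex_inj rev_ord_inj) /=.
  rewrite /current fpsM scaler_suml -big_split; apply: eq_bigr => j _ /=.
  have jm : (j <= m)%N by rewrite -ltnS.
  rewrite subSS subKn // -scalerAr -scalerAl.
  have -> : h j * x (r + (m - j)%N) =
      x (r + (m - j)%N) * h j + b j *: x (r + m%:Z).
    have := hx j (r + (m - j)%N).
    rewrite -addrA -PoszD subnK // => <-; by rewrite [RHS]addrC subrK.
  by rewrite scalerDr scalerA [a _ * _]mulrC.
have dD : fps_theta D = h * D.
  have tB (u w : fps A) : fps_theta (u - w) = fps_theta u - fps_theta w.
    by apply/funext => m; rewrite /fps_theta !fpsB mulrnBl.
  rewrite /D tB !fps_theta_mul theta_current dE da.
  have -> : fps_theta (fps_const (x r)) = 0.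
    by apply/funext => -[|m]; rewrite /fps_theta /fps_const ?mul0rn.
  rewrite mulr0 addr0 [RHS]mulrBr [h * (current _ _ * _)]mulrA hcur mulrDl.
  by rewrite [X in _ - X]addrC !mulrA.
apply/funext => m; elim/ltn_ind: m => -[|m] IH.
  by rewrite /D fpsB fpsMconst fpsM big_ord1 /= E0 /current a0 addr0 scale1r
    mul1r mulr1 subrr.
apply: (@natmul_eq0 _ _ m).
have := congr1 (fun f : fps A => f m.+1) dD; rewrite {1}/fps_theta => ->.
rewrite fpsM big_ord_recl h0 mul0r add0r big1 // => k _.
by rewrite IH ?mulr0 // subSS ltnS leq_subr.
Qed.

End Currents.

(** * Powers under a quadratic exchange relation *)

Section QuadraticExchange.
Variables (K : fieldType) (A : algType K) (c : K) (x Y : A).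
Hypothesis c0 : c != 0.
Hypothesis xY : x * Y = c *: (Y * x) - (1 - c) *: (Y * Y).

Definition geom_sum N : K := \sum_(j < N) c^-1 ^+ j.

Lemma geom_sumS N : geom_sum N.+1 = 1 + c^-1 * geom_sum N.
Proof.
rewrite /geom_sum big_ord_recl mulr_sumr; congr (_ + _).
by apply: eq_bigr => j _; rewrite exprS.
Qed.

Lemma geom_sum_tele N : (1 - c) * geom_sum N.+1 = c^-1 ^+ N - c.
Proof.
elim: N => [|N IH]; first by rewrite geom_sumS /geom_sum big_ord0; ring.
by rewrite geom_sumS mulrDr mulrCA IH exprS; field.
Qed.

(** The $Y^2$ terms cancel whatever [e] is, and the $Yx$ terms add up to $1-e$. With $e=c^{-k}$ this
    advances the induction in [exchange_pow]. *)
Lemma exchange_step e : (x + (1 - c) *: Y) * (x + (1 - c^-1 * e) *: Y) =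
  (x + (1 - e) *: Y) * x.
Proof.
rewrite mulrDl !mulrDr -!scalerAl -!scalerAr xY scalerBr !scalerA [RHS]mulrDl.
rewrite -[in RHS]scalerAl -!addrA; congr (_ + _).
rewrite [(1 - c) * (1 - _)]mulrC [- _ + _]addrC addrK.
by rewrite -scalerDl; congr (_ *: _); field.
Qed.

Lemma exchange_pow k :
  (x + (1 - c) *: Y) ^+ k * (x + (1 - c^-1 ^+ k) *: Y) = x ^+ k.+1.
Proof.
elim: k => [|k IH]; first by rewrite subrr scale0r addr0 mul1r.
by rewrite exprSr -mulrA exprS exchange_step mulrA IH -exprSr.
Qed.

(** In the application $\phi x=c^{-1}(x+(1-c^2)Y)\phi$. This is then the sum of all $x^a\phi x^b$
    with $a+b=N-1$, after $\phi$ has been moved to the right and dropped. *)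
Fixpoint exchange_sum N : A := if N is N'.+1 then
  exchange_sum N' * (c^-1 *: (x + (1 - c ^+ 2) *: Y)) + x ^+ N' else 0.

(** By [exchange_pow], $x^{N+1}$ has the left factor $(x+(1-c)Y)^N$, and so has the summand known by
    induction; what remains is an identity linear in [x] and [Y]. *)
Lemma exchange_sumE N :
  exchange_sum N.+1 = geom_sum N.+1 *: (x + (1 - c) *: Y) ^+ N.
Proof.
elim: N => [|N IH].
  by rewrite /= mul0r add0r geom_sumS /geom_sum big_ord0 mulr0 addr0 scale1r.
rewrite [LHS]/= -/(exchange_sum N.+1) IH -(exchange_pow N) -scalerAl -scalerAr.
rewrite scalerA scalerAr -mulrDr [_ ^+ N.+1]exprSr scalerAr; congr (_ * _).
rewrite geom_sumS scalerDr addrACA -[X in _ + X]addrC !scalerDr !scalerA.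
rewrite -addrA -scalerDl addrA.
rewrite -[X in _ + X + _]scale1r -scalerDl; congr (_ *: _ + _ *: _).
  by rewrite !geom_sumS; field.
have := geom_sum_tele N; rewrite !geom_sumS; set d := c^-1 ^+ N => sd.
have -> : d = (1 - c) * (1 + c^-1 * geom_sum N) + c by rewrite sd subrK.
by field.
Qed.

End QuadraticExchange.

Section QuadraticSum.
Variables (K : fieldType) (A : algType K) (c : K) (x : int -> A).
Hypothesis c0 : c != 0.
Hypothesis char0 : forall m, m.+1%:R != 0 :> K.
Hypothesis quad : forall r s,
  x (r + 1) * x s - c^-1 *: (x s * x (r + 1)) =
  c^-1 *: (x r * x (s + 1)) - x (s + 1) * x r.

(** Add the relations with $r+s=n$. Since [P] and [Q] are invariant under reversal of the summation,
    the two sides become opposite and $2(Q-c^{-1}P)=0$. The correction terms involve only indices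
    strictly between $0$ and $n+1$. *)
Lemma quad_sum (n : nat) :
  x 0 * x n.+1%:Z =
    c *: (x n.+1%:Z * x 0) +
    (c - 1) *: \sum_(i < n) x i.+1%:Z * x (n - i)%N%:Z.
Proof.
set T := \sum_(i < n) _.
pose P := \sum_(i < n.+1) x i%:Z * x (n.+1 - i)%N%:Z.
pose Q := \sum_(i < n.+1) x i.+1%:Z * x (n - i)%N%:Z.
have PE : P = x 0 * x n.+1%:Z + T by rewrite /P big_ord_recl subn0.
have QE : Q = T + x n.+1%:Z * x 0 by rewrite /Q big_ord_recr /= subnn.
have PR : P = \sum_(i < n.+1) x (n - i)%N%:Z * x i.+1%:Z.
  rewrite /P (reindex_inj rev_ord_inj) /=; apply: eq_bigr => i _.
  by rewrite subSS (subSn (leq_subr _ _)) subKn // -ltnS.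
have QR : Q = \sum_(i < n.+1) x (n.+1 - i)%N%:Z * x i%:Z.
  rewrite /Q (reindex_inj rev_ord_inj) /=; apply: eq_bigr => i _.
  by rewrite subSS subKn -?subSn // -ltnS.
have : Q - c^-1 *: P = c^-1 *: P - Q.
  rewrite {1}PR {2}QR /P /Q !scaler_sumr -!sumrB; apply: eq_bigr => i _.
  have := quad i%:Z (n - i)%N%:Z.
  by rewrite -!(PoszD _ 1) !addn1 -subSn // -ltnS.
move=> E; have {E} : (Q - c^-1 *: P) *+ 2 = 0 by rewrite mulr2n {2}E addrA subrK subrr.
move=> /(natmul_eq0 char0)/eqP; rewrite subr_eq0 => /eqP.
rewrite PE QE => /(congr1 (fun u => c *: u)); rewrite scalerA divff // scale1r.
move=> E; apply: (addIr T); rewrite -E scalerDr addrC -addrA; congr (_ + _).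
by rewrite scalerBl scale1r subrK.
Qed.

End QuadraticSum.

(** Iterating [F] from a constant function, the value at [j] is stable after $j+1$ rounds. It serves
    to solve for a series one degree at a time. *)
Lemma strong_recursion (T : Type) (t0 : T) (F : nat -> (nat -> T) -> T) :
  (forall m G G', (forall j, (j < m)%N -> G j = G' j) -> F m G = F m G') ->
  exists G, forall m, G m = F m G.
Proof.
move=> Fext; pose approx m := iter m (fun G j => F j G) (fun=> t0).
have stable m k j : (j < m)%N -> approx (m + k)%N j = approx m j.
  elim/ltn_ind: j m => j IH [//|m]; rewrite ltnS addSn => jm.
  apply: Fext => l lj; apply: IH => //; exact: leq_trans lj jm.
exists (fun j => approx j.+1 j) => m; apply: Fext => j jm.
by have := stable j.+1 (m - j.+1)%N j (ltnSn j); rewrite subnKC.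
Qed.

(** * Scalars and series acting on a module *)

Section ScalarAction.
Variables (K : fieldType) (A : algType K) (L : lmodType A).
Implicit Types (a b : K) (y : A) (u : L).

Lemma algZ a y u : a%:A *: (y *: u) = (a *: y) *: u.
Proof. by rewrite scalerA mulr_algl. Qed.

Lemma algZr a y u : y *: (a%:A *: u) = (a *: y) *: u.
Proof. by rewrite scalerA mulr_algr. Qed.

Lemma algZC a y u : y *: (a%:A *: u) = a%:A *: (y *: u).
Proof. by rewrite algZr algZ. Qed.

Lemma algZA a b u : a%:A *: (b%:A *: u) = (a * b)%:A *: u.
Proof. by rewrite algZ scalerA. Qed.

Lemma algZ_eq0 a u : a != 0 -> a%:A *: u = 0 -> u = 0.
Proof.
move=> a0 /(congr1 (fun w => (a^-1)%:A *: w)).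
by rewrite algZA mulVf // !scale1r scaler0.
Qed.

Definition scalars (f : fps K) : fps A := fun m => (f m)%:A.

Lemma scalarsM f g : scalars (f * g) = scalars f * scalars g.
Proof.
apply/funext => m; rewrite /scalars !fpsM scaler_suml.
by apply: eq_bigr => k _; rewrite mulr_algl scalerA.
Qed.

Lemma scalars_comm f (g : fps A) : scalars f * g = g * scalars f.
Proof.
apply/funext => m; rewrite !fpsM [RHS](reindex_inj rev_ord_inj) /=.
apply: eq_bigr => k _; rewrite /scalars subSS subKn -1?ltnS //.
by rewrite mulr_algl mulr_algr.
Qed.

(** Equality of series only when applied to [u]: preserved by multiplication on the left, but not in
    general on the right. *)
Definition agree_on u (f g : fps A) := forall m, f m *: u = g m *: u.

Lemma agree_mull u (f g h : fps A) : agree_on u f g -> agree_on u (h * f) (h * g).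
Proof.
move=> fg m; rewrite !fpsM !scaler_suml; apply: eq_bigr => k _.
by rewrite -!scalerA fg.
Qed.

End ScalarAction.

Section ExponentialSeries.
Variables (K : fieldType) (A : algType K).
Hypothesis char0 : forall m, m.+1%:R != 0 :> K.

Lemma exp_exists (h : fps A) : h 0%N = 0 ->
  exists E : fps A, E 0%N = 1 /\ fps_theta E = h * E.
Proof.
move=> h0.
pose F m (G : fps A) := if m is _.+1 then (m%:R^-1 : K) *: (h * G) m else 1.
have [|E EE] := strong_recursion 0 (F := F).
  move=> [//|m] G G' GG; congr (_ *: _); rewrite !fpsM 2![\sum_(_ < _.+2) _]big_ord_recl h0 !mul0r.
  by congr (_ + _); apply: eq_bigr => k _; rewrite GG // subSS ltnS leq_subr.
exists E; split; first exact: EE.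
apply/funext => -[|m]; first by rewrite fpsM big_ord1 h0 mul0r.
by rewrite /fps_theta EE -scaler_nat scalerA divff // scale1r.
Qed.

Lemma exp_comm (h E : fps A) u : h 0%N = 0 -> E 0%N = 1 ->
  fps_theta E = h * E -> (forall j, u * h j = h j * u) ->
  forall m, u * E m = E m * u.
Proof.
move=> h0 E0 dE uh; elim/ltn_ind => -[|m] IH; first by rewrite E0 mulr1 mul1r.
apply/eqP; rewrite -subr_eq0; apply/eqP/(@natmul_eq0 _ char0 _ _ m).
rewrite mulrnBl -mulrnAr -mulrnAl -[E _ *+ _]/(fps_theta E m.+1) dE fpsM.
rewrite mulr_sumr mulr_suml -sumrB big1 // => j _.
have [->|j0] := eqVneq (nat_of_ord j) 0%N; first by rewrite h0 !(mul0r, mulr0) subrr.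
rewrite mulrA uh -!mulrA IH ?subrr //.
by rewrite ltnS; case: (nat_of_ord j) j0 => // k _; rewrite subSS leq_subr.
Qed.

Lemma exp_fix (L : lmodType A) (h E : fps A) (v : L) : h 0%N = 0 -> E 0%N = 1 ->
  fps_theta E = h * E -> (forall j, h j *: v = 0) ->
  forall m, E m *: v = (m == 0%N)%:R *: v.
Proof.
move=> h0 E0 dE hv; elim/ltn_ind => -[|m] IH; first by rewrite E0.
rewrite scale0r.
suff : E m.+1 *+ m.+1 *: v = 0.
  move=> E0v; apply: (algZ_eq0 (char0 m)); rewrite algZ.
  by rewrite scaler_nat E0v.
rewrite -[E _ *+ _]/(fps_theta E m.+1) dE fpsM scaler_suml big1 // => j _.
have [->|j0] := eqVneq (nat_of_ord j) 0%N; first by rewrite h0 mul0r scale0r.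
rewrite -scalerA IH; first by case: eqP => _; rewrite ?scale0r ?scale1r ?hv ?scaler0.
by rewrite ltnS; case: (nat_of_ord j) j0 => // k _; rewrite subSS leq_subr.
Qed.

(** Newton's identities read backwards: $mE_m=h_m+\sum_{0<j<m}h_jE_{m-j}$, and every term but $h_m$
    is already known to act on [v] by a scalar. *)
Lemma exp_eigen (L : lmodType A) (h E : fps A) (v : L) : h 0%N = 0 ->
  E 0%N = 1 -> fps_theta E = h * E ->
  (forall m, exists a : K, E m *: v = a%:A *: v) ->
  forall j, exists a : K, h j *: v = a%:A *: v.
Proof.
move=> h0 E0 dE Ev; elim/ltn_ind => m IH; case: m IH => [|m] IH.
  by exists 0; rewrite h0 !scale0r.
have := congr1 (fun f : fps A => f m.+1 *: v) dE.
rewrite /fps_theta fpsM big_ord_recr /= subnn E0 mulr1 scalerDl.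
rewrite big_ord_recl h0 mul0r add0r.
have [a aE] : exists a : K, (\sum_(i < m) h (bump 0 i) * E (m.+1 - bump 0 i)%N) *: v
    = a%:A *: v.
  elim/big_ind: _ => [|y1 y2 [a1 e1] [a2 e2]|i _].
  - by exists 0; rewrite !scale0r.
  - by exists (a1 + a2); rewrite scalerDl e1 e2 -scalerDl -scalerDl.
  - have [|b bE] := IH (bump 0 i); first by rewrite ltnS.
    have [b' b'E] := Ev (m.+1 - bump 0 i)%N.
    by exists (b' * b); rewrite -scalerA b'E algZC bE algZA.
have [b bE] := Ev m.+1.
rewrite aE => e; exists (b *+ m.+1 - a).
apply: (addrI (a%:A *: v)); rewrite -e !scalerBl [RHS]addrC subrK.
by rewrite -!scalerMnl bE.
Qed.

End ExponentialSeries.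

(** * Highest weight vectors for the loop algebra of sl2 *)

Section LoopSl2.
Variables (K : fieldType) (A : algType K) (L : lmodType A) (z : K).
Hypothesis char0 : forall m, m.+1%:R != 0 :> K.
Hypothesis z0 : z != 0.
Hypothesis z_root : forall m, (0 < m)%N -> z ^+ m != 1.
Local Notation c := (z ^+ 2).

Variables (xm xp : int -> A) (h E phi : fps A) (k k' : A).
Hypothesis h0 : h 0%N = 0.
Hypothesis hC : forall i j, h i * h j = h j * h i.
Hypothesis hxm : forall j r,
  h j * xm r - xm r * h j = - (c ^+ j - c^-1 ^+ j) *: xm (r + j%:Z).
Hypothesis hxp : forall j r,
  h j * xp r - xp r * h j = (c ^+ j - c^-1 ^+ j) *: xp (r + j%:Z).
Hypothesis E0 : E 0%N = 1.
Hypothesis dE : fps_theta E = h * E.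
Hypothesis phiE : phi = fps_const k * E.
Hypothesis k'k : k' * k = 1.
Hypothesis kxm : forall r, k * xm r = c^-1 *: (xm r * k).
Hypothesis k'xm : forall r, k' * xm r = c *: (xm r * k').
Hypothesis quad : forall r s,
  xm (r + 1) * xm s - c^-1 *: (xm s * xm (r + 1)) =
  c^-1 *: (xm r * xm (s + 1)) - xm (s + 1) * xm r.
Hypothesis xpxm : forall p : nat,
  xp p%:Z * xm 0 - xm 0 * xp p%:Z =
  (z - z^-1)^-1 *: (phi p - (p == 0%N)%:R *: k').

Variables (v : L) (Psi : fps K).
Hypothesis xpv : forall r, xp r *: v = 0.
Hypothesis phiv : forall m, phi m *: v = (Psi m)%:A *: v.
Hypothesis k'v : k' *: v = (Psi 0%N)^-1%:A *: v.

Let c0 : c != 0. Proof. by rewrite expf_neq0. Qed.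

Lemma c_root m : (0 < m)%N -> c ^+ m != 1.
Proof. by move=> m0; rewrite -exprM z_root // muln_gt0. Qed.

Lemma h_eigen : exists chi : fps K, forall j, h j *: v = (chi j)%:A *: v.
Proof.
suff eig : forall j, exists a : K, h j *: v = a%:A *: v.
  by have [f fE] := choice eig; exists f.
have Ev m : E m *: v = (Psi m / Psi 0%N)%:A *: v.
  have := phiv m; rewrite phiE fps_constM => /(congr1 (fun w => k' *: w)) /=.
  rewrite scalerA mulrA k'k mul1r => ->.
  by rewrite algZC k'v algZA.
by apply: (exp_eigen h0 E0 dE) => m; eexists; exact: Ev.
Qed.

Let bgeom : fps K := fps_var K * geom 1.

Lemma bgeomE j : bgeom j = (j != 0%N)%:R.
Proof. by rewrite /bgeom fps_varM; case: j => // j; rewrite /geom expr1n. Qed.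

(** The relation between $\phi^+$ and $x^-$. The factor is the solution with constant term 1 whose
    logarithmic derivative is $-\sum_j(c^j-c^{-j})z^j$, as prescribed by [hxm]. *)
Lemma phi_twist : exists a : fps K, 
  a = (1 - fps_const c * fps_var K) * geom c^-1 /\ twists xm E a.
Proof.
eexists; split; first by [].
apply: (exp_twists char0 (b := - (geom c - geom c^-1)) E0 h0 dE) => [||j r].
- by rewrite fpsM big_ord1 fpsB fps_constM /geom /fps_var !fps1 !mulr0 subr0 mulr1.
- rewrite fps_theta_mul fps_thetaB fps_theta_mul !fps_theta_const fps_theta_var.
  rewrite fps_theta_geom.
  have := geomE c^-1; have := geomE c.
  set w := geom c; set w' := geom c^-1; set u := fps_const c * _.
  set u' := fps_const c^-1 * _ => e e'.
  have -> : (- (w - w')) * ((1 - u) * w') = - ((1 - u) * w * w') + (1 - u) * w' ^+ 2.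
    by ring.
  have -> : (1 - u) * w' ^+ 2 = (1 - u) * (u' * w' ^+ 2) + (1 - u) * ((1 - u') * w') * w'.
    by ring.
  by rewrite e e'; ring.
- by rewrite fpsN fpsB hxm.
Qed.

(** Polynomials in the [h j]. Membership is what the representation theory needs to know of the
    coefficients of $H$: they preserve weights, word lengths and annihilation by the raising
    currents of other indices. *)
Inductive h_algebra : A -> Prop :=
| h_algebra1 : h_algebra 1
| h_algebraD y1 y2 : h_algebra y1 -> h_algebra y2 -> h_algebra (y1 + y2)
| h_algebraZ a y : h_algebra y -> h_algebra (a *: y)
| h_algebraM j y : h_algebra y -> h_algebra (h j * y).

Lemma h_algebra_sum n (F : 'I_n -> A) :
  (forall j, h_algebra (F j)) -> h_algebra (\sum_(j < n) F j).
Proof.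
move=> hF; elim/big_ind: _ => [|y1 y2|j _] //.
  by rewrite -(scale0r (1 : A)); apply/h_algebraZ/h_algebra1.
exact: h_algebraD.
Qed.

(* On xm(z_1) ... xm(z_N) v the operator h_j acts, up to a scalar, by the
   j-th power sum of the z's; B and D generate the corresponding complete and
   signed elementary symmetric functions. *)
Lemma symmetric_functions : exists B D : fps A,
  [/\ [/\ B 0%N = 1, twists xm B (geom 1) & twists xm D (1 - fps_var K)],
      [/\ agree_on v B 1, agree_on v D 1 & forall m, h_algebra (B m)],
      forall u, (forall j, u * h j = h j * u) ->
        forall m, u * B m = B m * u /\ u * D m = D m * u
    & forall s m, xp s * B m = \sum_(j < m.+1) B j * xp (s + (m - j)%N%:Z)].
Proof.
have [chi hv] := h_eigen.
(* Rescaling makes the commutator coefficients $\pm1$ for $j>0$, and subtracting [chi] makes [e j]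
   kill [v]. At [j = 0] the inverse of 0 is 0, so [e] has no constant term. *)
pose e : fps A := fun j => (c ^+ j - c^-1 ^+ j)^-1 *: (h j - (chi j)%:A).
have e0 : e 0%N = 0 by rewrite /e subrr invr0 scale0r.
have cj j : (0 < j)%N -> c ^+ j - c^-1 ^+ j != 0.
  move=> j0; rewrite subr_eq0 exprVn; apply/eqP => /(congr1 (fun a => a * c ^+ j)).
  rewrite mulVf ?expf_neq0 // -exprD; apply/eqP/c_root.
  by rewrite addn_gt0 j0.
have ev j : e j *: v = 0.
  by rewrite /e -algZ scalerBl hv subrr scaler0.
have ecomm u j (x : int -> A) b : (forall r, h j * x r - x r * h j = b *: x (r + j%:Z)) ->
    e j * x u - x u * e j = ((c ^+ j - c^-1 ^+ j)^-1 * b) *: x (u + j%:Z).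
  move=> hx; rewrite /e -scalerAl -scalerAr -scalerBr mulrBl mulrBr.
  by rewrite mulr_algl mulr_algr opprB addrA subrK hx scalerA.
have exm j r : e j * xm r - xm r * e j = - bgeom j *: xm (r + j%:Z).
  rewrite (ecomm _ _ _ _ (hxm j)) bgeomE; case: j => [|j].
    by rewrite subrr oppr0 mulr0.
  by rewrite mulrN mulVf // cj.
have exp' j r : e j * xp r - xp r * e j = bgeom j *: xp (r + j%:Z).
  rewrite (ecomm _ _ _ _ (hxp j)) bgeomE; case: j => [|j].
    by rewrite subrr mulr0.
  by rewrite mulVf // cj.
have ne0 : (- e) 0%N = 0 by rewrite fpsN e0 oppr0.
have [B [B0 dB]] := exp_exists char0 ne0.
have [D [D0 dD]] := exp_exists char0 e0.
have dvar : fps_theta (1 - fps_var K) = - fps_var K.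
  by rewrite fps_thetaB fps_theta_var fps_theta_const sub0r.
have bvar : - bgeom * (1 - fps_var K) = - fps_var K.
  have := geomE (1 : K); rewrite -[fps_const 1]/(1 : fps K) mul1r => e1.
  by rewrite /bgeom mulNr -mulrA [geom 1 * _]mulrC e1 mulr1.
have Bxp : twists xp B (1 - fps_var K).
  apply: (exp_twists char0 (b := - bgeom) B0 ne0 dB) => [||j r].
  - by rewrite fpsB fps1 /fps_var subr0.
  - by rewrite dvar bvar.
  - by rewrite !fpsN mulNr mulrN -opprB -[in LHS]opprD opprK scaleNr -exp' opprB addrC.
exists B, D; split.
- split=> //.
    apply: (exp_twists char0 (b := bgeom) B0 ne0 dB) => [||j r].
    + by rewrite /geom expr0.
    + by rewrite fps_theta_geom -[fps_const 1]/(1 : fps K) mul1r expr2 mulrA.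
    + by rewrite !fpsN mulNr mulrN -opprB -[in LHS]opprD opprK -[RHS]opprK -scaleNr -exm opprB addrC.
  apply: (exp_twists char0 (b := - bgeom) D0 e0 dD) => [||j r].
  + by rewrite fpsB fps1 /fps_var subr0.
  + by rewrite dvar bvar.
  + by rewrite fpsN exm.
- split=> m; rewrite ?fps1.
  + by apply: (exp_fix char0 ne0 B0 dB) => j; rewrite fpsN scaleNr ev oppr0.
  + exact: (exp_fix char0 e0 D0 dD ev).
  elim/ltn_ind: m => -[|m] IH; first by rewrite B0; exact: h_algebra1.
  have -> : B m.+1 = (m.+1%:R^-1 : K) *: (fps_theta B m.+1).
    by rewrite /fps_theta -[B _ *+ _]scaler_nat scalerA mulVf // scale1r.
  apply: h_algebraZ; rewrite dB fpsM; apply: h_algebra_sum => j.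
  have [->|j0] := posnP j; first by rewrite ne0 mul0r -(scale0r (1 : A));
    apply/h_algebraZ/h_algebra1.
  have hB : h_algebra (B (m.+1 - j)%N).
    by apply: IH; rewrite ltn_subrL j0.
  rewrite fpsN /e -scaleNr -scalerAl mulrBl mulr_algl -scaleNr.
  by apply/h_algebraZ/h_algebraD; [exact: h_algebraM|exact: h_algebraZ].
- move=> u uh m.
  have ue j : u * e j = e j * u.
    by rewrite /e -scalerAl -scalerAr mulrBl mulrBr uh mulr_algl mulr_algr.
  split; last exact: (exp_comm char0 e0 D0 dD ue).
  by apply: (exp_comm char0 ne0 B0 dB) => j; rewrite !fpsN mulrN mulNr ue.
(* [Bxp] amounts to $x^+_sB_{m+1}=B_{m+1}x^+_s+x^+_{s+1}B_m$; iterating it moves every coefficient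
   of [B] to the left. *)
- move=> s m; elim: m s => [|m IH] s.
    by rewrite big_ord1 B0 mulr1 mul1r addr0.
  have : B m.+1 * xp s = xp s * B m.+1 - xp (s + 1) * B m.
    rewrite (twistsE _ _ Bxp) 2!big_ord_recl big1 => [|j _].
      rewrite !fpsB !fps1 /fps_var subr0 !subn0 scale1r sub0r scaleN1r !addr0.
      by rewrite subSS subn0.
    by rewrite fpsB fps1 /fps_var subrr scale0r.
  move=> /(congr1 (fun y => y + xp (s + 1) * B m)); rewrite subrK => <-.
  rewrite big_ord_recr /= subnn addr0 addrC IH; congr (_ + _).
  apply: eq_bigr => j _; rewrite -addrA -PoszD add1n -subSn //.
  by rewrite -ltnS.
Qed.

Section HalfCurrents.
Variables B D : fps A.
Hypothesis B0 : B 0%N = 1.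
Hypothesis Bxm : twists xm B (geom 1).
Hypothesis Dxm : twists xm D (1 - fps_var K).
Hypothesis Bv : agree_on v B 1.
Hypothesis Dv : agree_on v D 1.
Hypothesis BDcomm : forall u, (forall j, u * h j = h j * u) ->
  forall m, u * B m = B m * u /\ u * D m = D m * u.
Hypothesis xpB : forall s m,
  xp s * B m = \sum_(j < m.+1) B j * xp (s + (m - j)%N%:Z).

Local Notation w := (geom c^-1).
Local Notation cur := (current xm 0).
Local Notation X0 := (fps_const (xm 0)).
Local Notation Y := (cur (w - 1)).
Local Notation y := (cur ((1 - fps_var K) * w)).

Let rescaled (f : fps A) : fps A := fun m => c^-1 ^+ m *: f m.

Let varw : fps_var K * w = fps_const c * (w - 1).
Proof.
have := geomE c^-1; rewrite mulrBl mul1r => e.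
have -> : w - 1 = fps_const c^-1 * fps_var K * w by rewrite -e; ring.
by rewrite !mulrA -rmorphM /= divff // rmorph1 mul1r.
Qed.

Lemma current_y : y = X0 + (1 - c) *: Y.
Proof.
rewrite -current1 -currentZ -currentD; congr (current _ _ _).
have -> : fps_const (1 - c) = 1 - fps_const c by rewrite rmorphB rmorph1.
by rewrite mulrBl varw; ring.
Qed.

Lemma current_phi :
  cur ((1 - fps_const c * fps_var K) * w) = X0 + (1 - c ^+ 2) *: Y.
Proof.
rewrite -current1 -currentZ -currentD; congr (current _ _ _).
have -> : fps_const (1 - c ^+ 2) = 1 - fps_const c ^+ 2.
  by rewrite rmorphB rmorphXn rmorph1.
by rewrite mulrBl -mulrA varw; ring.
Qed.

(** [quad_sum] as an identity of series: its terms have equal total index, so the weights $c^{-m}$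
    in [Y] match. It brings [X0] and [Y] under the exchange identities. *)
Lemma current_exchange :
  X0 * Y = c *: (Y * X0) - (1 - c) *: (Y * Y).
Proof.
have Y0 : Y 0%N = 0 by rewrite /current fpsB fps1 /geom subrr scale0r.
have YS j : Y j.+1 = c^-1 ^+ j.+1 *: xm j.+1%:Z.
  by rewrite /current fpsB fps1 subr0 add0r.
apply/funext => -[|m]; rewrite fps_constM fpsB !fpsZ fpsMconst.
  by rewrite Y0 fpsM big_ord1 Y0 !(mulr0, mul0r, scaler0) subrr.
rewrite fpsM big_ord_recl Y0 mul0r add0r big_ord_recr /= subnn Y0 mulr0 addr0.
rewrite YS -scalerAr (quad_sum c0 char0 quad) -scalerAl scalerDr !scalerA.
rewrite [c * _]mulrC; congr (_ + _).
rewrite !scaler_sumr -sumrN; apply: eq_bigr => i _.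
rewrite YS subSS -[(m - i)%N]prednK ?subn_gt0 // YS prednK ?subn_gt0 //.
rewrite -scalerAl -scalerAr !scalerA -scaleNr; congr (_ *: _).
rewrite -mulrA -exprD addSn subnKC 1?ltnW //; ring.
Qed.

Lemma phi_X0 : phi * X0 = (c^-1 *: (X0 + (1 - c ^+ 2) *: Y)) * phi.
Proof.
have [a [aE Ea]] := phi_twist.
rewrite -current_phi -aE phiE -mulrA (Ea 0) mulrA [RHS]mulrA; congr (_ * E).
apply/funext => m; rewrite fps_constM fpsMconst fpsZ /current add0r.
by rewrite -scalerAr kxm -!scalerAl !scalerA mulrC.
Qed.

(** The sum of all $X_0^a\,\phi\,X_0^b$ with $a+b=N-1$, as the Leibniz rule produces it. *)
Fixpoint phi_sum N : fps A :=
  if N is N'.+1 then phi_sum N' * X0 + X0 ^+ N' * phi else 0.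

Lemma phi_sumE N : phi_sum N.+1 = geom_sum c N.+1 *: (y ^+ N * phi).
Proof.
have -> : forall M, phi_sum M = exchange_sum c X0 Y M * phi.
  elim=> [|M IH]; first by rewrite mul0r.
  by rewrite /= IH mulrDl -!mulrA phi_X0.
by rewrite (exchange_sumE c0 current_exchange) current_y scalerAl.
Qed.

(** Leibniz rule. For $p\ge0$, $\phi^-$ contributes only at $p=0$, through the single operator [k'];
    each passage of [k'] to the right across [xm 0] costs a factor $c$. *)
Lemma xp_xm_pow N (p : nat) :
  xp p%:Z * xm 0 ^+ N.+1 - xm 0 ^+ N.+1 * xp p%:Z =
  (z - z^-1)^-1 *: (phi_sum N.+1 p -
    (p == 0%N)%:R *: ((\sum_(j < N.+1) c ^+ j) *: (xm 0 ^+ N * k'))).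
Proof.
have k'pow j : k' * xm 0 ^+ j = c ^+ j *: (xm 0 ^+ j * k').
  elim: j => [|j IH]; first by rewrite mulr1 mul1r scale1r.
  by rewrite exprSr mulrA IH -scalerAl -(mulrA _ k') k'xm -scalerAr scalerA [c ^+ j.+1]exprSr -[in RHS]mulrA.
elim: N => [|N IH].
  by rewrite expr1 xpxm big_ord1 /= mul0r add0r mul1r scale1r mul1r.
rewrite exprSr mulrA -[X in X * xm 0](subrK (xm 0 ^+ N.+1 * xp p%:Z)) IH.
rewrite mulrDl -addrA -!mulrA -mulrBr xpxm -scalerAl -scalerAr -scalerDr.
congr (_ *: _); rewrite mulrBl mulrBr.
rewrite [RHS]/= -/(phi_sum N.+1) fpsD fpsMconst addrACA; congr (_ + _).
  by congr (_ + _); rewrite -rmorphXn fps_constM.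
rewrite -opprD -[in LHS]scalerAl -[in LHS]scalerAr -scalerDr; congr (- (_ *: _)).
rewrite [in RHS]big_ord_recl scalerDl scale1r -[in LHS]scalerAl -mulrA.
rewrite [RHS]addrC; congr (_ + _).
rewrite k'xm -scalerAr scalerA [xm 0 ^+ N * _]mulrA -exprSr mulr_suml; congr (_ *: _).
by apply: eq_bigr => j _; rewrite -exprSr.
Qed.

Lemma rescaledM f g : rescaled (f * g) = rescaled f * rescaled g.
Proof.
apply/funext => m; rewrite /rescaled !fpsM scaler_sumr.
apply: eq_bigr => j _; rewrite -scalerAl -scalerAr scalerA -exprD.
by rewrite subnKC // -ltnS.
Qed.

Lemma twists_rescaled : twists xm (rescaled B) w.
Proof.
move=> r; have -> : fps_const (xm r) = rescaled (fps_const (xm r)).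
  by apply/funext => -[|m]; rewrite /rescaled /fps_const /= ?scaler0 ?scale1r.
rewrite -rescaledM Bxm rescaledM; congr (_ * _); apply/funext => m.
by rewrite /rescaled /current /geom scalerA expr1n mulr1.
Qed.

Lemma pow_intertwine (S : pzRingType) (e a b : S) N :
  e * a = b * e -> e * a ^+ N = b ^+ N * e.
Proof.
move=> eab; elim: N => [|N IH]; first by rewrite mulr1 mul1r.
by rewrite exprSr mulrA IH -mulrA eab mulrA -exprSr.
Qed.

(** The factor $1/(1-z)$ of [B] cancels the numerator of [y] and leaves [cur w], to which
    [rescaled B] conjugates [X0]. *)
Lemma B_y_pow N : B * y ^+ N = cur w ^+ N * B.
Proof.
apply: pow_intertwine; rewrite (twists_current _ Bxm) mulrA.
have := geomE (1 : K); rewrite rmorph1 mul1r mulrC => ->.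
by rewrite mul1r.
Qed.

Lemma rescaled_X0_pow N : rescaled B * X0 ^+ N = cur w ^+ N * rescaled B.
Proof. exact/pow_intertwine/twists_rescaled. Qed.

(** Here [D] restores the numerator $1-z$, so the product conjugates [X0] to [y] itself. *)
Lemma D_X0_pow N :
  D * rescaled B * X0 ^+ N = y ^+ N * (D * rescaled B).
Proof.
apply: pow_intertwine.
by rewrite -mulrA twists_rescaled !mulrA (twists_current _ Dxm).
Qed.

Lemma agree_rescaled : agree_on v (rescaled B) 1.
Proof.
move=> m; rewrite /rescaled -algZ Bv fps1.
by case: m => [|m]; rewrite ?scale0r ?scaler0 ?expr0 ?scale1r.
Qed.

Variable G : fps K.
Let H : fps A := scalars A G * B.

Lemma H_comm u : (forall j, u * h j = h j * u) -> forall m, u * H m = H m * u.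
Proof.
move=> uh m; rewrite /H fpsM mulr_sumr mulr_suml; apply: eq_bigr => j _.
by rewrite /scalars mulr_algl -scalerAl -scalerAr (BDcomm uh _).1.
Qed.

Lemma xpH s m : xp s * H m = \sum_(j < m.+1) H j * xp (s + (m - j)%N%:Z).
Proof.
pose F l k := G l *: (B k * xp (s + (m - (l + k))%N%:Z)).
transitivity (\sum_(l < m.+1) \sum_(k < (m - l).+1) F l k).
  rewrite /H fpsM mulr_sumr; apply: eq_bigr => l _.
  rewrite /scalars mulr_algl -scalerAr xpB scaler_sumr.
  by apply: eq_bigr => j _; rewrite /F subnDA.
rewrite sum_triangle; apply: eq_bigr => i _.
rewrite /H scalars_comm fpsM mulr_suml; apply: eq_bigr => j _.
by rewrite /F subnK -1?ltnS // /scalars mulr_algr -scalerAl.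
Qed.

Lemma H_v m : H m *: v = (G m)%:A *: v.
Proof.
by rewrite (agree_mull (scalars A G) Bv) mulr1.
Qed.

Hypothesis GPsi : forall m,
  (G * Psi) m = Psi 0%N * (c^-1 ^+ m * G m).

(** On [v], [phi] is the scalar series $\Psi$ and [B] is 1. So [B], once moved through $y^N$, may be
    replaced by [rescaled B], which moves back and turns [cur w] into [X0]; then
    $G\Psi=\Psi_0G(z/c)$ completes $H(z/c)$. *)
Lemma H_y_phi N m : (H * (y ^+ N * phi)) m *: v =
  (Psi 0%N * c^-1 ^+ m)%:A *: (H m *: (xm 0 ^+ N *: v)).
Proof.
have agree1 : agree_on v phi (scalars A Psi * 1) by move=> j; rewrite mulr1 phiv.
rewrite mulrA (agree_mull _ agree1) mulrA.
have -> : H * y ^+ N * scalars A Psi = scalars A (G * Psi) * cur w ^+ N * B.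
  by rewrite /H -scalars_comm scalarsM -!mulrA B_y_pow mulrA scalars_comm -!mulrA.
rewrite mulr1 (agree_mull _ Bv) -(agree_mull _ agree_rescaled).
rewrite -mulrA -rescaled_X0_pow mulrA.
have -> : scalars A (G * Psi) * rescaled B = (Psi 0%N) *: rescaled H.
  rewrite /H rescaledM scalerAl; congr (_ * _); apply/funext => j.
  by rewrite /scalars GPsi fpsZ /rescaled !scalerA mulrA.
rewrite -rmorphXn fpsMconst fpsZ /rescaled [RHS]algZ [RHS]scalerA.
by rewrite scalerA.
Qed.

Lemma xp_pow_v N (p : nat) : xp p%:Z *: (xm 0 ^+ N.+1 *: v) =
  (z - z^-1)^-1%:A *: ((geom_sum c N.+1)%:A *: ((y ^+ N * phi) p *: v) -
    ((p == 0%N)%:R * ((\sum_(j < N.+1) c ^+ j) / Psi 0%N))%:A *: (xm 0 ^+ N *: v)).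
Proof.
transitivity ((xp p%:Z * xm 0 ^+ N.+1 - xm 0 ^+ N.+1 * xp p%:Z) *: v).
  by rewrite scalerBl -[in X in _ - X]scalerA xpv scaler0 subr0 scalerA.
rewrite xp_xm_pow -[LHS]algZ phi_sumE; congr (_ *: _).
rewrite scalerBl fpsZ -algZ; congr (_ - _).
rewrite scalerA -[LHS]algZ -[(_ * k') *: v]scalerA k'v algZC algZA.
by congr (_%:A *: _); ring.
Qed.

(** The two terms of the scalar come from $\phi^+$ and from [k']. By [geom_sum_geometric] it is a
    nonzero multiple of $\Psi_0c^{-N-m}-\Psi_0^{-1}$. *)
Lemma xp0_H N m : xp 0 *: (H m *: (xm 0 ^+ N.+1 *: v)) =
  ((z - z^-1)^-1 * (geom_sum c N.+1 * (Psi 0%N * c^-1 ^+ m) -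
     (\sum_(j < N.+1) c ^+ j) / Psi 0%N))%:A *: (H m *: (xm 0 ^+ N *: v)).
Proof.
rewrite scalerA xpH scaler_suml.
under eq_bigr => j _ do rewrite add0r -scalerA xp_pow_v algZC scalerBr scalerBr.
rewrite sumrB -!scaler_sumr.
have -> : \sum_(j < m.+1) H j *: ((geom_sum c N.+1)%:A *:
    ((y ^+ N * phi) (m - j)%N *: v)) =
    (geom_sum c N.+1 * (Psi 0%N * c^-1 ^+ m))%:A *: (H m *: (xm 0 ^+ N *: v)).
  rewrite -algZA -H_y_phi fpsM; move: (geom_sum c N.+1) => gs.
  rewrite scaler_suml scaler_sumr; apply: eq_bigr => j _.
  by rewrite algZC [H j *: _]scalerA.
rewrite big_ord_recr big1 => [|j _] /=; last first.
  by rewrite subn_eq0 leqNgt ltn_ord mul0r !scale0r scaler0.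
rewrite add0r subnn eqxx mul1r [H m *: (_%:A *: _)]algZC !algZA -!scalerBl.
by congr (_%:A *: _); ring.
Qed.

(** Trades $y^N\phi$ for a series in [D] and [B], whose coefficients commute with those of $H$. *)
Lemma y_phi_v N p : (y ^+ N * phi) p *: v =
  (scalars A Psi * (D * rescaled B)) p *: (xm 0 ^+ N *: v).
Proof.
have agree1 : agree_on v phi (scalars A Psi * 1) by move=> j; rewrite mulr1 phiv.
rewrite (agree_mull _ agree1) mulrA -scalars_comm mulr1.
have agree2 : agree_on v (D * rescaled B) 1.
  by move=> j; rewrite (agree_mull _ agree_rescaled) mulr1 Dv.
rewrite -[_ * y ^+ N]mulr1 -(agree_mull _ agree2) -mulrA -D_X0_pow mulrA.
by rewrite -rmorphXn fpsMconst scalerA.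
Qed.

Lemma xp_H_vanish (d N : nat) :
  (forall m, (d < m + N)%N -> H m *: (xm 0 ^+ N *: v) = 0) ->
  forall m (s : nat), (d < m + N.+1)%N -> (0 < s)%N ->
  xp s%:Z *: (H m *: (xm 0 ^+ N.+1 *: v)) = 0.
Proof.
move=> HN m s dm s0; set Q := scalars A Psi * (D * rescaled B).
(* [H j] commutes with [Q p], and $j>m$ puts $H_jV_N$ in the range where it vanishes. *)
have HQ j p : (m < j)%N -> H j *: (Q p *: (xm 0 ^+ N *: v)) = 0.
  move=> mj; have QH : Q p * H j = H j * Q p.
    apply: H_comm => i; rewrite /Q fpsM mulr_suml mulr_sumr.
    apply: eq_bigr => l _; rewrite /scalars mulr_algl -scalerAl -scalerAr.
    congr (_ *: _); rewrite fpsM mulr_suml mulr_sumr; apply: eq_bigr => a _.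
    rewrite /rescaled -scalerAr -scalerAl -scalerAr; congr (_ *: _).
    have hBD := BDcomm (hC i); rewrite mulrA (hBD _).2 -!mulrA; congr (_ * _).
    by rewrite (hBD _).1.
  rewrite scalerA -QH -scalerA HN ?scaler0 //.
  by rewrite (leq_trans dm) // addnS -addSn leq_add2r.
(* The coefficient of degree $m+s$ of $Hy^N\phi v$ is a multiple of $H_{m+s}V_N=0$. Its terms with
   $j>m$ vanish, so those with $j\le m$ sum to 0, and these are what $x^+_sH_m$ produces. Since
   $s>0$, there is no [k'] term. *)
have := H_y_phi N (m + s); rewrite HN; last first.
  by rewrite addnAC (leq_trans dm) // addnS -addn1 leq_add2l.
rewrite scaler0 fpsM scaler_suml.
rewrite -(big_mkord xpredT (fun j => (H j * (y ^+ N * phi) (m + s - j)%N) *: v)).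
rewrite (big_cat_nat (n := m.+1)) //=; last by rewrite ltnS leq_addr.
rewrite [X in _ + X]big_nat_cond [X in _ + X]big1 ?addr0; last first.
  by move=> j /andP[/andP[mj _] _]; rewrite -scalerA y_phi_v HQ.
rewrite big_mkord => E0'; rewrite scalerA xpH scaler_suml.
transitivity ((z - z^-1)^-1%:A *: ((geom_sum c N.+1)%:A *:
    \sum_(j < m.+1) (H j * (y ^+ N * phi) (m + s - j)%N) *: v)); last first.
  by rewrite E0' !scaler0.
under eq_bigr => j _.
  have jm : (j <= m)%N by rewrite -ltnS.
  rewrite -PoszD -scalerA xp_pow_v addn_eq0 (gtn_eqF s0) mul0r !scale0r subr0.
  over.
move: (geom_sum c N.+1) => gs; rewrite !scaler_sumr; apply: eq_bigr => j _.
have jm : (j <= m)%N by rewrite -ltnS.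
by rewrite 2![H j *: (_%:A *: _)]algZC [H j *: _]scalerA [(m + s)%N]addnC addnBA.
Qed.

End HalfCurrents.

Lemma geometric_neq0 N : \sum_(j < N.+1) c ^+ j != 0.
Proof.
apply: contraTneq (c_root (ltn0Sn N)) => e; rewrite negbK.
by rewrite -subr_eq0 subrX1 e mulr0.
Qed.

Lemma geom_sum_geometric N :
  geom_sum c N.+1 = c^-1 ^+ N * \sum_(j < N.+1) c ^+ j.
Proof.
rewrite mulr_sumr /geom_sum (reindex_inj rev_ord_inj) /=.
apply: eq_bigr => j _; have jN : (j <= N)%N by rewrite -ltnS.
have -> : c^-1 ^+ N = c^-1 ^+ (N - j) * c^-1 ^+ j by rewrite -exprD subnK.
by rewrite subSS -mulrA -exprMn mulVf // expr1n mulr1.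
Qed.

Lemma z_expI m1 m2 : z ^+ m1 = z ^+ m2 -> m1 = m2.
Proof.
wlog le12 : m1 m2 / (m1 <= m2)%N => [IH e|].
  by have [/IH/(_ e)//|/ltnW/IH/(_ (esym e))] := leqP m1 m2.
move=> e; apply/eqP; rewrite eqn_leq le12 -subn_eq0 -leqn0 leqNgt.
apply/negP => /z_root/eqP; apply.
apply: (mulfI (expf_neq0 m1 z0)); rewrite mulr1 -exprD subnKC //.
Qed.

Lemma zz_neq0 : z - z^-1 != 0.
Proof.
rewrite subr_eq0; apply: contraTneq (z_root (isT : 0 < 2)%N) => e.
by rewrite negbK expr2 [X in X * _]e mulVf.
Qed.

Hypothesis v0 : v != 0.

Lemma algZ_v_eq0 a : a%:A *: v = 0 -> a = 0.
Proof.
move=> e; apply/eqP; apply: contraNT v0 => a0; apply/eqP.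
exact: algZ_eq0 a0 e.
Qed.

(** In degree $m>0$ the unknown [G m] carries the factor $\Psi_0(c^{-m}-1)$, which is invertible
    because $c$ is not a root of unity. *)
Lemma ratio_exists d : Psi 0%N = z ^+ d ->
  exists G : fps K, G 0%N = 1 /\
    forall m, (G * Psi) m = Psi 0%N * (c^-1 ^+ m * G m).
Proof.
move=> Psi0.
pose F m (G : fps K) := if m is m'.+1 then
  (Psi 0%N * (c^-1 ^+ m - 1))^-1 * \sum_(j < m) G j * Psi (m - j)%N else 1.
have [|G GE] := @strong_recursion _ 0 F.
  move=> [//|m] G G' GG; congr (_ * _); apply: eq_bigr => j _.
  by rewrite GG.
exists G; split; first exact: GE.
case=> [|m]; first by rewrite fpsM big_ord1 expr0 mul1r mulrC.
rewrite fpsM big_ord_recr /= subnn; set S := \sum_(j < _) _.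
have -> : S = Psi 0%N * (c^-1 ^+ m.+1 - 1) * G m.+1.
  rewrite (GE m.+1) /F -/S mulrA divff ?mul1r // mulf_neq0 ?Psi0 ?expf_neq0 //.
  rewrite subr_eq0 exprVn; apply/eqP => /(congr1 (fun a => a * c ^+ m.+1)).
  by rewrite mulVf ?expf_neq0 // mul1r => /esym/eqP; apply/negP/c_root.
by ring.
Qed.

Theorem nilpotent_rational d : Psi 0%N = z ^+ d -> xm 0 ^+ d.+1 *: v = 0 ->
  exists G : fps K,
  [/\ G 0%N = 1, forall m, (d < m)%N -> G m = 0,
      forall m, (G * Psi) m = Psi 0%N * (c^-1 ^+ m * G m)
    & forall m, (d <= m)%N ->
        \sum_(j < m.+1) (G j)%:A *: (xm (m - j)%N%:Z *: v) = 0].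
Proof.
move=> Psi0 xd; have [G [G0 GPsi]] := ratio_exists Psi0.
have [B [D [[B0 Bxm Dxm] [Bv Dv _] BD xpB]]] := symmetric_functions.
pose H : fps A := scalars A G * B.
have Hv N m : (N <= d.+1)%N -> (d < m + N)%N -> H m *: (xm 0 ^+ N *: v) = 0.
  move=> Nd; rewrite -(subKn Nd); move: (d.+1 - N)%N (leq_subr N d.+1) => k1.
  elim: k1 m {N Nd} => [|k1 IH] m k1d; first by rewrite subn0 xd scaler0.
  rewrite subSS; move: IH => /(_ m (ltnW k1d)); rewrite subSn //.
  set N := (d - k1)%N => IH dm.
  have {}IH : H m *: (xm 0 ^+ N.+1 *: v) = 0.
    by apply: IH; rewrite addnS (ltn_trans dm).
  have := congr1 (fun u => xp 0 *: u) IH; rewrite scaler0.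
  rewrite (xp0_H Bxm Bv xpB GPsi) => /algZ_eq0; apply.
  have S0 := geometric_neq0 N; move: (geom_sum_geometric N).
  set S := \sum_(j < _) _ in S0 *; move=> gsE.
  rewrite mulf_neq0 ?invr_eq0 ?zz_neq0 // gsE Psi0 subr_eq0; apply/eqP => e.
  (* A vanishing scalar would force $z^{2d}=z^{2(N+m)}$, hence $d=N+m$, against $d<m+N$. *)
  have {}e : z ^+ (2 * d) = z ^+ (2 * (N + m)).
    move: e => /(congr1 (fun a => a * S^-1 * z ^+ d * c ^+ N * c ^+ m)).
    rewrite !exprVn (mulnC 2 d) (exprM z d 2) (exprM z 2) [c ^+ (_ + _)]exprD.
    move: (z ^+ d) (c ^+ N) (c ^+ m) (expf_neq0 d z0) (expf_neq0 N c0)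
      (expf_neq0 m c0) => zd cN cm zd0 cN0 cm0 e.
    have -> : cN * cm = S / zd / S * zd * cN * cm by field; rewrite ?zd0 ?S0.
    rewrite -e; field; by rewrite ?cm0 ?cN0 ?S0.
  have /eqP := z_expI e; rewrite eqn_pmul2l // => /eqP dE'.
  by move: dm; rewrite dE' addnC ltnn.
have Gd m : (d < m)%N -> G m = 0.
  move=> dm; apply: algZ_v_eq0.
  by rewrite -(H_v Bv) -[v]scale1r -(expr0 (xm 0)) Hv // addn0.
exists G; split=> // m dm.
(* The case $N=1$ made explicit: all coefficients of the twist [Bxm] are 1 and [B] fixes [v], so
   $H_mx^-_0v=\sum_jG_jx^-_{m-j}v$. *)
have := Hv 1%N m; rewrite addn1 ltnS => /(_ (leq0n _) dm) e.
rewrite -[RHS]e.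
rewrite expr1 /H fpsM scaler_suml; apply: eq_bigr => j _.
rewrite -[in RHS]scalerA; congr (_ *: _).
rewrite scalerA (twistsE _ _ Bxm) scaler_suml big_ord_recr big1 /= => [|k1 _].
  by rewrite subnn B0 mulr1 add0r /geom expr1n scale1r add0r.
rewrite -algZ -scalerA Bv fps1 subn_eq0 leqNgt ltn_ord.
by rewrite !(scale0r, scaler0).
Qed.

(** The vanishing of singular vectors is left as a hypothesis because it depends on the whole
    algebra and on the simplicity of the module, not on one index alone. *)
Theorem rational_nilpotent d (G : fps K) : G 0%N = 1 ->
  (forall m, (d < m)%N -> G m = 0) ->
  (forall m, (G * Psi) m = Psi 0%N * (c^-1 ^+ m * G m)) ->
  (forall y N, h_algebra y ->
     (forall s : nat, (0 < s)%N -> xp s%:Z *: (y *: (xm 0 ^+ N.+1 *: v)) = 0) ->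
     y *: (xm 0 ^+ N.+1 *: v) = 0) ->
  xm 0 ^+ d.+1 *: v = 0.
Proof.
move=> G0 Gd GPsi sing.
have [B [D [[B0 Bxm Dxm] [Bv Dv Bh] BD xpB]]] := symmetric_functions.
pose H : fps A := scalars A G * B.
have Hh m : h_algebra (H m).
  rewrite /H fpsM; apply: h_algebra_sum => j; rewrite /scalars mulr_algl.
  exact: h_algebraZ.
have Hv N : forall m, (d < m + N)%N -> H m *: (xm 0 ^+ N *: v) = 0.
  elim: N => [|N IH] m dm.
    by rewrite expr0 scale1r /H (H_v Bv) Gd ?scale0r ?scale0r // -[m]addn0.
  apply: sing => // s s0.
  exact: (xp_H_vanish Bxm Dxm Bv Dv BD xpB GPsi IH).
have := Hv d.+1 0%N; rewrite add0n ltnSn => /(_ isT).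
by rewrite /H fpsM big_ord1 B0 /scalars G0 mulr1 !scale1r.
Qed.

End LoopSl2.

(** * The exponential in the defining relations *)

Section ExpCoef.
Variables (K : fieldType) (A : algType K) (f : nat -> A).
Hypothesis char0 : forall m, m.+1%:R != 0 :> K.
Hypothesis fC : forall i j, f i * f j = f j * f i.

Let s : fps A := fun k => if k == 0%N then 0 else f k.

Lemma coef_exponent T N j : (j <= T)%N ->
  ((\sum_(1 <= k < T.+1) f k *: 'X^k) ^+ N : {poly A})`_j = (s ^+ N) j.
Proof.
elim: N j => [|N IH] j jT; first by rewrite !expr0 coef1 fps1.
rewrite !exprS coefM fpsM; apply: eq_bigr => i _.
have iT : (i <= T)%N by apply: leq_trans jT; rewrite -ltnS.
rewrite IH; last exact: leq_trans (leq_subr _ _) jT.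
congr (_ * _); rewrite coef_sum; under eq_bigr do rewrite coefZ coefXn.
rewrite /s; case: eqP => [->|/eqP i0].
  by rewrite big_nat big1 // => k /andP[k0 _]; rewrite eq_sym (gtn_eqF k0) mulr0.
rewrite (bigD1_seq (nat_of_ord i)) ?iota_uniq ?mem_index_iota ?lt0n ?i0 ?ltnS //=.
rewrite eqxx mulr1 big1 ?addr0 // => k /negbTE ki.
by rewrite eq_sym ki mulr0.
Qed.

Lemma exponent_val N m : (m < N)%N -> (s ^+ N) m = 0.
Proof.
elim: N m => // N IH m; rewrite ltnS => mN.
rewrite exprS fpsM big_ord_recl mul0r add0r big1 // => j _.
rewrite IH ?mulr0 // (leq_trans _ mN) // ltn_subrL /=.
by case: j => j /= jm; rewrite (leq_ltn_trans _ jm).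
Qed.

(** $s^N$ starts in degree $N$, so every cut-off $M\ge m$ gives the same coefficient. A cut-off
    common to several degrees is what products and derivatives need. *)
Lemma exp_coefE M m : (m <= M)%N ->
  exp_coef f m = (\sum_(N < M.+1) (N`!%:R^-1 : K) *: s ^+ N) m.
Proof.
move=> mM; rewrite fps_sum /exp_coef; under eq_bigr do rewrite coef_exponent //.
rewrite (big_ord_widen_cond M.+1 xpredT
  (fun N => (N`!%:R^-1 : K) *: (s ^+ N) m)) // big_mkcond.
apply: eq_bigr => N _; case: ifP => // /negbT; rewrite -leqNgt => mN.
by rewrite fpsZ exponent_val // scaler0.
Qed.

Lemma exp_coef0 : exp_coef f 0 = 1.
Proof.
by rewrite (exp_coefE (leqnn 0)) big_ord1 expr0 fact0 invr1 scale1r.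
Qed.

Lemma theta_exp_coef :
  fps_theta (exp_coef f) = (fps_theta s : fps A) * (exp_coef f : fps A).
Proof.
have sC i j : s i * s j = s j * s i.
  by rewrite /s; case: eqP; case: eqP; rewrite ?mulr0 ?mul0r.
have sdC : s * fps_theta s = fps_theta s * s.
  apply/funext => m; rewrite !fpsM [LHS](reindex_inj rev_ord_inj) /=.
  apply: eq_bigr => j _; rewrite subSS subKn -1?ltnS //.
  by rewrite /fps_theta mulrnAr mulrnAl sC.
apply/funext => -[|m].
  by rewrite fpsM big_ord1 {1 2}/fps_theta !mulr0n mul0r.
rewrite {1}/fps_theta (exp_coefE (leqnn m.+1)).
rewrite fps_sum -sumrMnl big_ord_recl fpsZ expr0 fps1 scaler0 mul0rn add0r.
transitivity ((fps_theta s * \sum_(N < m.+1) (N`!%:R^-1 : K) *: s ^+ N) m.+1).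
  rewrite mulr_sumr fps_sum; apply: eq_bigr => N _.
  rewrite -scalerAr !fpsZ scalerMnr -[_ *+ m.+1]/(fps_theta (s ^+ N.+1) m.+1).
  rewrite (fps_theta_exp _ sdC) factS.
  have -> : ((fps_theta s * s ^+ N) *+ N.+1) m.+1 = (fps_theta s * s ^+ N) m.+1 *+ N.+1.
    by elim: (N.+1) => // k IH; rewrite !mulrS fpsD IH.
  rewrite -scaler_nat scalerA natrM invfM mulrAC mulVf ?mul1r //.
(* Differentiation has lowered the cut-off to [m]; this suffices in degree $m+1$ because
   [fps_theta s] has no constant term. *)
rewrite !fpsM 2![\sum_(_ < m.+2) _]big_ord_recl; congr (_ + _).
  by rewrite /fps_theta !mulr0n !mul0r.
apply: eq_bigr => k _; rewrite (@exp_coefE m) //.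
by rewrite lift0 subSS leq_subr.
Qed.

End ExpCoef.

(** * The relations of the quantum affinization *)

Section RationalPowers.
Variables (K : fieldType) (q : K) (qp : rat -> K).
Hypothesis q_root : forall m, (0 < m)%N -> q ^+ m != 1.
Hypothesis q0 : q != 0.
Hypothesis qpD : forall a b, qp (a + b) = qp a * qp b.
Hypothesis qp1 : qp 1 = q.

Lemma qp0 : qp 0 = 1.
Proof.
by apply: (mulfI q0); rewrite -{1}qp1 -qpD addr0 qp1 mulr1.
Qed.

Lemma qpNK a : qp (- a) * qp a = 1.
Proof. by rewrite -qpD addNr qp0. Qed.

Lemma qp_neq0 a : qp a != 0.
Proof. by apply: contra_eq_neq (qpNK a) => ->; rewrite mulr0 eq_sym oner_eq0. Qed.

Lemma qpN a : qp (- a) = (qp a)^-1.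
Proof. by apply: (mulIf (qp_neq0 a)); rewrite qpNK mulVf ?qp_neq0. Qed.

Lemma qpMn a m : qp (a *+ m) = qp a ^+ m.
Proof. by elim: m => [|m IH]; rewrite ?qp0 // mulrS qpD IH exprS. Qed.

Lemma qp_nat m : qp m%:R = q ^+ m.
Proof. by rewrite qpMn qp1. Qed.

Lemma qp_int (m : int) : qp m%:~R = q ^ m.
Proof.
by case: m => m; rewrite ?qp_nat // NegzE mulrNz qpN qp_nat.
Qed.

Lemma qp_eq1 a : qp a = 1 -> a = 0.
Proof.
move=> qa; have : qp (numq a)%:~R = 1.
  rewrite numqE -[denq a]gez0_abs ?denq_ge0 // -pmulrn mulr_natr qpMn qa.
  by rewrite expr1n.
rewrite qp_int => qn; apply/eqP; rewrite -numq_eq0.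
case: (numq a) qn => m.
  by case: m => // m /eqP; rewrite (negPf (q_root _)).
rewrite NegzE => /(congr1 GRing.inv); rewrite invr1 invr_expz opprK => /eqP.
by rewrite (negPf (q_root _)).
Qed.

Lemma qp_inj : injective qp.
Proof.
move=> a b ab; apply/eqP; rewrite -subr_eq0; apply/eqP/qp_eq1.
by rewrite qpD ab -qpD subrr qp0.
Qed.

End RationalPowers.

Section LoopRelations.
Variables (K : fieldType) (q : K) (qp : rat -> K).
Variables (n : nat) (A : symmetrizable_gcm n) (H : realization A).
Hypothesis char0 : forall m, m.+1%:R != 0 :> K.
Hypothesis q_root : forall m, (0 < m)%N -> q ^+ m != 1.
Hypothesis q0 : q != 0.
Hypothesis qpD : forall a b, qp (a + b) = qp a * qp b.
Hypothesis qp1 : qp 1 = q.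
Variables (U : algType K) (g : gen H -> U).
Hypothesis rel : forall u w : U, defrel q qp g u w -> u = w.

Local Notation X := (ux g).
Local Notation k := (uk g).
Local Notation h := (uh g).
Local Notation phi := (uphi q g).
Local Notation d := (gcm_r A).

Lemma qi_neq0 i : qi q A i != 0. Proof. exact: expf_neq0. Qed.

Lemma qi_root i m : (0 < m)%N -> qi q A i ^+ m != 1.
Proof. by move=> m0; rewrite -exprM q_root // muln_gt0 gcm_r_gt0. Qed.

Lemma q_sub_inv_neq0 : q - q^-1 != 0.
Proof.
rewrite subr_eq0; apply: contraTneq (q_root (isT : 0 < 2)%N) => e.
by rewrite negbK expr2 [X in X * _]e mulVf.
Qed.

Lemma symB_diag i : symB A i i = (2 * d i)%N%:Z.
Proof. by rewrite /symB gcm_diag mulrC PoszM. Qed.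

Lemma k_opp a : k (- a) * k a = 1.
Proof. by rewrite (rel (rel_kk _ _ _ _ _)) addNr (rel (rel_k0 _ _ _)). Qed.

Lemma kX a s j r : k a * X s j r = qp ((sg s)%:~R * Defs.root H j a) *: (X s j r * k a).
Proof.
by rewrite scalerAl -(rel (rel_kx _ _ _ s a j r)) -[RHS]mulrA k_opp mulr1.
Qed.

Lemma h0 i : h i 0 = 0.
Proof. by rewrite /uh insubF // eqxx. Qed.

Lemma hC i j m m' : h i m * h j m' = h j m' * h i m.
Proof.
have [->|m0] := eqVneq m 0; first by rewrite h0 mulr0 mul0r.
have [->|m'0] := eqVneq m' 0; first by rewrite h0 mulr0 mul0r.
exact: rel (rel_hh _ _ _ _ _ m0 m'0).
Qed.

Lemma kh a i m : k a * h i m = h i m * k a.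
Proof.
have [->|m0] := eqVneq m 0; first by rewrite h0 mulr0 mul0r.
exact: rel (rel_kh _ _ _ _ _ m0).
Qed.

Lemma hX s i j m r : m != 0 ->
  h i m * X s j r = X s j r * h i m +
    ((sg s)%:~R * m%:~R^-1 * qint q (m * symB A i j)) *: X s j (m + r).
Proof.
by move=> m0; rewrite -(rel (rel_hx _ _ _ s i j r m0)) addrC subrK.
Qed.

Variable i : 'I_n.
Local Notation z := (qi q A i).
Local Notation c := (z ^+ 2).

(** Without the factor $j$ these are the coefficients of the exponent of $\phi^s$; the factor turns
    the exponent into the logarithmic derivative of [theta_phi_exp]. *)
Definition hseries s : fps U :=
  fun j => (((sg s)%:~R * (q - q^-1)) *+ j) *: h i (sg s * j%:Z).

Lemma hseries0 s : hseries s 0%N = 0.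
Proof. by rewrite /hseries mulr0n scale0r. Qed.

Lemma hseriesC s j1 j2 : hseries s j1 * hseries s j2 = hseries s j2 * hseries s j1.
Proof. by rewrite /hseries -!scalerAl -!scalerAr hC scalerA mulrC -scalerA. Qed.

(** The normalization $j(q-q^{-1})$ cancels $1/j$ and the denominator of the quantum integer; as
    $B_{i,i}=2r_i$, its numerator is $c^j-c^{-j}$. *)
Lemma hseriesX s j r :
  hseries true j * X s i r - X s i r * hseries true j =
  ((sg s)%:~R * (c ^+ j - c^-1 ^+ j)) *: X s i (r + j%:Z).
Proof.
case: j => [|j]; first by rewrite hseries0 mulr0 mul0r !expr0 !subrr mulr0 scale0r.
rewrite /hseries !mul1r -scalerAl -scalerAr -scalerBr hX // addrAC subrr add0r.
rewrite scalerA [j.+1%:Z + r]addrC; congr (_ *: _).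
rewrite symB_diag /qint -PoszM -exprnN !exprVn.
have -> : c ^+ j.+1 = q ^+ (j.+1 * (2 * d i)).
  by rewrite -!exprM; rewrite mulnCA [in RHS]mulnCA (mulnC (d i)).
rewrite -[_ ^ _%:Z]/(q ^+ _) -[j.+1%:~R]/(j.+1%:R : K).
rewrite -[(q - q^-1) *+ _]mulr_natr.
move: (sg s)%:~R (q ^+ _) (expf_neq0 (j.+1 * (2 * d i)) q0) => e a a0.
move: (q - q^-1) q_sub_inv_neq0 (j.+1%:R) (char0 j) => b b0 m m0.
by field; rewrite m0 b0 a0.
Qed.

Local Notation kp := (k (((sg true)%:~R * (d i)%:R : rat) *: coroot H i)).
Local Notation km := (k (((sg false)%:~R * (d i)%:R : rat) *: coroot H i)).

Definition phi_exp s : fps U :=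
  exp_coef (fun j => ((sg s)%:~R * (q - q^-1)) *: h i (sg s * j%:Z)).

Lemma phi_exp0 s : phi_exp s 0%N = 1.
Proof. exact: exp_coef0. Qed.

Lemma theta_phi_exp s : fps_theta (phi_exp s) = hseries s * phi_exp s.
Proof.
rewrite /phi_exp theta_exp_coef // => [|j1 j2]; last first.
  by rewrite -!scalerAl -!scalerAr hC scalerA mulrC -scalerA.
congr (_ * _); apply/funext => -[|j]; rewrite /fps_theta /hseries //=.
  by rewrite mulr0n mulr0n scale0r.
by rewrite scalerMnl.
Qed.

Local Notation kd s := (k (((sg s)%:~R * (d i)%:R : rat) *: coroot H i)).

Lemma phi_exp_phi s (m : nat) : phi s i (sg s * m%:Z) = kd s * phi_exp s m.
Proof.
have ss : sg s * (sg s * m%:Z) = m%:Z by rewrite mulrA; case: s; rewrite ?mulrNN !mul1r.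
by rewrite /uphi ss; congr (_ * exp_coef _ _); case: s {ss}; rewrite ?mul1r ?mulN1r ?abszN.
Qed.

Lemma phi_pos (m : nat) : phi true i m%:Z = kp * phi_exp true m.
Proof. by rewrite -phi_exp_phi mul1r. Qed.

Lemma phi_neg (m : nat) : phi false i m%:Z = (m == 0%N)%:R *: km.
Proof.
rewrite /uphi mulN1r oppr_ge0; case: m => [|m] /=; last by rewrite scale0r.
by rewrite exp_coef0 mulr1 scale1r.
Qed.

Lemma kmp : km * kp = 1.
Proof. by rewrite -[RHS](k_opp ((d i)%:R *: coroot H i)) !mul1r mulN1r scaleNr. Qed.

Lemma root_kp j : Defs.root H j ((d i)%:R *: coroot H i) = (symB A i j)%:~R.
Proof. by rewrite linearZ /= root_coroot /symB rmorphM. Qed.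

Lemma kpX r : kp * X false i r = c^-1 *: (X false i r * kp).
Proof.
rewrite kX mul1r root_kp symB_diag -rmorphM (qp_int q0 qpD qp1) mulN1r.
by rewrite -exprnN /qi -exprM mulnC.
Qed.

Lemma kmX r : km * X false i r = c *: (X false i r * km).
Proof.
rewrite kX !mulN1r scaleNr linearN /= opprK root_kp symB_diag.
by rewrite (qp_int q0 qpD qp1) /qi -exprM mulnC.
Qed.

Lemma quadX r s : X false i (r + 1) * X false i s -
    c^-1 *: (X false i s * X false i (r + 1)) =
  c^-1 *: (X false i r * X false i (s + 1)) - X false i (s + 1) * X false i r.
Proof.
have := rel (rel_quad q qp g false i i r s).
suff -> : q ^ (sg false * symB A i i) = c^-1 by [].
by rewrite symB_diag mulN1r -exprnN /qi -exprM mulnC.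
Qed.

Lemma commXX (p : nat) : X true i p%:Z * X false i 0 - X false i 0 * X true i p%:Z =
  (z - z^-1)^-1 *: (kp * phi_exp true p - (p == 0%N)%:R *: km).
Proof.
rewrite (rel (rel_xx q qp g i i p%:Z 0)) eqxx addr0 phi_pos phi_neg.
by rewrite [true%:R / _]mul1r.
Qed.

End LoopRelations.

(** * Spans, stabilizers and linear dependence *)

Section LinearSpan.
Variables (K : fieldType) (U : algType K) (L : lmodType U).
Implicit Types (P Z : L -> Prop) (u w : L).

Definition subspace P :=
  [/\ P 0, forall u w, P u -> P w -> P (u + w) & forall (a : K) u, P u -> P (a%:A *: u)].

Lemma subspaceN P u : subspace P -> P u -> P (- u).
Proof. by move=> [_ _ PZ] /(PZ (-1)); rewrite !scaleN1r. Qed.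

Inductive lspan Z : L -> Prop :=
| lspan0 : lspan Z 0
| lspan_cons (a : K) u w : Z u -> lspan Z w -> lspan Z (a%:A *: u + w).

Lemma lspan_subspace Z : subspace (lspan Z).
Proof.
split=> [|u w|a u]; first exact: lspan0.
  elim=> [|a u1 w1 Zu _ IH] Zw; first by rewrite add0r.
  by rewrite -addrA; apply: lspan_cons => //; apply: IH.
elim=> [|b u1 w1 Zu _ IH]; first by rewrite scaler0; exact: lspan0.
by rewrite scalerDr algZA; apply: lspan_cons.
Qed.

Lemma lspanD Z u w : lspan Z u -> lspan Z w -> lspan Z (u + w).
Proof. by have [_ + _] := lspan_subspace Z; apply. Qed.

Lemma lspanZ Z (a : K) u : lspan Z u -> lspan Z (a%:A *: u).
Proof. by have [_ _ +] := lspan_subspace Z; apply. Qed.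

Lemma lspanN Z u : lspan Z u -> lspan Z (- u).
Proof. by apply: subspaceN; exact: lspan_subspace. Qed.

Lemma lspanB Z u w : lspan Z u -> lspan Z w -> lspan Z (u - w).
Proof. by move=> Zu Zw; apply/lspanD => //; apply: lspanN. Qed.

Lemma lspan_in Z u : Z u -> lspan Z u.
Proof.
move=> Zu; rewrite -[u]addr0 -[X in X + _]scale1r.
by rewrite -(scale1r (1 : U)); apply: lspan_cons => //; exact: lspan0.
Qed.

Lemma lspan_min Z P : subspace P -> (forall u, Z u -> P u) ->
  forall u, lspan Z u -> P u.
Proof.
by move=> [P0 PD PZ] ZP u; elim=> // a w w' Zw _ Pw'; apply: PD => //; apply/PZ/ZP.
Qed.

Lemma lspan_mono Z Z' u : (forall w, Z w -> lspan Z' w) -> lspan Z u -> lspan Z' u.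
Proof. by move=> ZZ'; apply: lspan_min ZZ' _; exact: lspan_subspace. Qed.

Lemma lspan_map Z Z' (y : U) u : (forall w, Z w -> lspan Z' (y *: w)) ->
  lspan Z u -> lspan Z' (y *: u).
Proof.
move=> yZ; elim=> [|a w w' Zw _ IH]; first by rewrite scaler0; exact: lspan0.
by rewrite scalerDr algZC; apply: lspanD => //; apply/lspanZ/yZ.
Qed.

Lemma lspan_sum Z n (F : 'I_n -> L) :
  (forall j, lspan Z (F j)) -> lspan Z (\sum_(j < n) F j).
Proof.
by move=> ZF; apply: big_ind => //; [exact: lspan0|exact: lspanD].
Qed.

Section Stabilizer.
Variable P : L -> Prop.
Hypothesis subP : subspace P.

Definition stab (y : U) := forall u, P u -> P (y *: u).

Lemma stab0 : stab 0.
Proof. by move=> u _; rewrite scale0r; case: subP. Qed.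

Lemma stab1 : stab 1. Proof. by move=> u Pu; rewrite scale1r. Qed.

Lemma stabD y1 y2 : stab y1 -> stab y2 -> stab (y1 + y2).
Proof.
by case: subP => _ PD _ s1 s2 u Pu; rewrite scalerDl; apply: PD; [apply: s1|apply: s2].
Qed.

Lemma stabZ (a : K) y : stab y -> stab (a *: y).
Proof. by case: subP => _ _ PZ sy u Pu; rewrite -algZ; apply/PZ/sy. Qed.

Lemma stabN y : stab y -> stab (- y).
Proof. by rewrite -scaleN1r; exact: stabZ. Qed.

Lemma stabM y1 y2 : stab y1 -> stab y2 -> stab (y1 * y2).
Proof. by move=> s1 s2 u Pu; rewrite -scalerA; apply/s1/s2. Qed.

Lemma stab_sum n (F : 'I_n -> U) : (forall j, stab (F j)) -> stab (\sum_(j < n) F j).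
Proof. by move=> sF; apply: big_ind => //; [exact: stab0|exact: stabD]. Qed.

Lemma stab_coef_exp (p : {poly U}) N l :
  (forall j, stab p`_j) -> stab (p ^+ N)`_l.
Proof.
move=> sp; elim: N l => [|N IH] l.
  by rewrite expr0 coef1; case: eqP => _; [exact: stab1|exact: stab0].
by rewrite exprS coefM; apply: stab_sum => j; apply: stabM.
Qed.

Lemma stab_exp_coef f m : (forall j, stab (f j)) -> stab (exp_coef f m).
Proof.
move=> sf; apply: stab_sum => N; apply/stabZ/stab_coef_exp => j.
rewrite coef_sum; apply: big_ind => [||k _]; [exact: stab0|exact: stabD|].
by rewrite coefZ coefXn; case: eqP => _; rewrite ?mulr1 ?mulr0 //; exact: stab0.
Qed.

End Stabilizer.

Lemma lspan_seq_coord (b : seq L) u : lspan (fun w => w \in b) u ->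
  exists r : 'rV[K]_(size b), u = \sum_(j < size b) (r 0 j)%:A *: b`_j.
Proof.
elim=> [|a w w' wb _ [r ->]].
  by exists 0; rewrite big1 // => j _; rewrite mxE !scale0r.
have wi : (index w b < size b)%N by rewrite index_mem.
exists (r + a *: delta_mx 0 (Ordinal wi)).
under [RHS]eq_bigr do rewrite !mxE !scalerDl.
rewrite big_split addrC; congr (_ + _).
rewrite (bigD1 (Ordinal wi)) //= big1 => [|j /negbTE ji].
  by rewrite addr0 !eqxx mulr1 nth_index.
by rewrite ji ?andbF mulr0 !scale0r.
Qed.

(** The coordinate matrix of the first [size b + 1] vectors has more rows than columns, hence a
    nonzero left kernel vector; the largest index in its support is [m]. The list [b] need not be
    free. *)
Lemma krylov_relation (b : seq L) (u : nat -> L) :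
  (forall k, lspan (fun w => w \in b) (u k)) ->
  exists (m : nat) (a : nat -> K), u m = \sum_(k < m) (a k)%:A *: u k.
Proof.
move=> ub; have [r rE] := choice (fun k => lspan_seq_coord (ub k)).
pose M := \matrix_(k < (size b).+1) r k.
have : ~~ row_free M by rewrite -row_leq_rank -ltnNge ltnS rank_leq_col.
rewrite -kermx_eq0 => /rowV0Pn[s /sub_kermxP sM s0].
have [k0 sk0] : exists k0, s 0 k0 != 0.
  apply/existsP; apply: contraNT s0; rewrite negb_exists => /forallP s0.
  by apply/eqP/rowP => k; rewrite mxE; apply/eqP; rewrite -[_ == _]negbK.
have su : \sum_(k < (size b).+1) (s 0 k)%:A *: u k = 0.
  transitivity (\sum_(j < size b) ((s *m M) 0 j)%:A *: b`_j).
    under eq_bigr do rewrite rE scaler_sumr.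
    rewrite exchange_big; apply: eq_bigr => j _; rewrite mxE !scaler_suml.
    by apply: eq_bigr => k _; rewrite algZA !mxE.
  by rewrite sM big1 // => j _; rewrite mxE !scale0r.
have [m sm max] := @arg_maxnP _ k0 (fun k => s 0 k != 0) (fun k => nat_of_ord k) sk0.
exists m, (fun k => - (s 0 m)^-1 * s 0 (inord k)).
have E : \sum_(k < (size b).+1) (s 0 k)%:A *: u k =
    \sum_(k < m) (s 0 (inord k))%:A *: u k + (s 0 m)%:A *: u m.
  rewrite (bigID (fun k : 'I__ => (k < m.+1)%N)) /= [X in _ + X]big1 ?addr0 => [|k].
    transitivity (\sum_(k < m.+1) (s 0 (inord k))%:A *: u k); last first.
      by rewrite big_ord_recr /= inord_val.
    rewrite (big_ord_widen _ (fun k => (s 0 (inord k))%:A *: u k) (ltn_ord m)).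
    by apply: eq_bigr => k _; rewrite inord_val.
  rewrite -leqNgt => mk; suff /eqP-> : s 0 k == 0 by rewrite !scale0r.
  by apply: contraTT mk => /max; rewrite -ltnNge ltnS.
move/eqP: su; rewrite E addr_eq0 => /eqP su.
transitivity ((- (s 0 m)^-1)%:A *: (- ((s 0 m)%:A *: u m))).
  by rewrite scalerN algZA mulNr mulVf // scaleNr scaleNr opprK !scale1r.
rewrite -su scaler_sumr; apply: eq_bigr => k _; exact: algZA.
Qed.

End LinearSpan.

Lemma sum_undup_single (T : eqType) (V : nmodType) (s : seq T) t (z : V) :
  \sum_(w <- undup (t :: s)) (if w == t then z else 0) = z.
Proof.
rewrite (bigD1_seq t) ?undup_uniq ?mem_undup ?mem_head // eqxx big1.
  exact: addr0.
by move=> w /negbTE->.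
Qed.

Lemma sum_undup_mem (T : eqType) (V : nmodType) (s : seq T) t (u : T -> V) : uniq s ->
  \sum_(w <- undup (t :: s)) (if w \in s then u w else 0) = \sum_(w <- s) u w.
Proof.
move=> us; rewrite [RHS]big_seq /= (undup_id us).
case: ifP => ts; last rewrite big_cons ts add0r;
  by rewrite big_seq; apply: eq_bigr => w ->.
Qed.

(** * Simple modules of l-highest weight *)

Section HighestWeightModule.
Variables (K : fieldType) (q : K) (qp : rat -> K).
Variables (n : nat) (A : symmetrizable_gcm n) (H : realization A).
Hypothesis char0 : forall m, m.+1%:R != 0 :> K.
Hypothesis q_root : forall m, (0 < m)%N -> q ^+ m != 1.
Hypothesis q0 : q != 0.
Hypothesis qpD : forall a b, qp (a + b) = qp a * qp b.
Hypothesis qp1 : qp 1 = q.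
Variables (U : algType K) (g : gen H -> U).
Hypothesis rel : forall u w : U, defrel q qp g u w -> u = w.
Variable L : lmodType U.

Local Notation hdual := 'Hom(cartan H, rat^o).
Local Notation X := (ux g).
Local Notation k := (uk g).
Local Notation h := (uh g).
Local Notation phi := (uphi q g).
Local Notation alpha := (Defs.root H).

Definition has_weight (w : hdual) (u : L) :=
  forall a, k a *: u = (qp (w a))%:A *: u.

Lemma has_weight_subspace w : subspace (has_weight w).
Proof.
split=> [a|u1 u2 w1 w2 a|b u wu a]; first by rewrite !scaler0.
  by rewrite !scalerDr w1 w2.
by rewrite algZC wu !algZA mulrC.
Qed.

Lemma has_weight_sum w (J : Type) (s : seq J) (F : J -> L) :
  (forall j, has_weight w (F j)) -> has_weight w (\sum_(j <- s) F j).
Proof.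
by move=> wF; have [W0 WD _] := has_weight_subspace w; apply: big_ind.
Qed.

Lemma has_weightX s w u j r : has_weight w u ->
  has_weight (w + (sg s)%:~R *: alpha j) (X s j r *: u).
Proof.
move=> wu a; rewrite scalerA (kX rel) -algZ -scalerA wu algZC algZA -qpD addrC.
by rewrite add_lfunE scale_lfunE.
Qed.

Lemma has_weightXm w u j r : has_weight w u -> has_weight (w - alpha j) (X false j r *: u).
Proof. by move=> /(has_weightX false j r); rewrite scaleN1r. Qed.

Lemma has_weighth w u i m : has_weight w u -> has_weight w (h i m *: u).
Proof. by move=> wu a; rewrite scalerA (kh rel) -scalerA wu algZC. Qed.

Lemma weight_separation (w w' : hdual) : w != w' ->
  exists a, qp (w a) != qp (w' a).
Proof.
move=> ww'; have [a wa] : exists a, w a != w' a.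
  apply: contrapT => /forallNP e; move/eqP: ww'; apply; apply/lfunP => a.
  by have /negP := e a; rewrite negbK => /eqP.
exists a; apply: contraNneq wa => /(qp_inj q_root q0 qpD qp1)->//.
Qed.

(** Apply $k_a-q^{w_0(a)}$, with [a] separating [w] from [w0]: the [w0] component disappears and the
    others are rescaled, that of [w] by a nonzero scalar. Induction on the number of weights
    concludes. *)
Lemma has_weight_direct (s : seq hdual) (u : hdual -> L) : uniq s ->
  (forall w, has_weight w (u w)) -> \sum_(w <- s) u w = 0 ->
  forall w, w \in s -> u w = 0.
Proof.
elim: s u => [//|w0 s IH] u /= /andP[w0s us] wu; rewrite big_cons => su.
have us0 w : w \in s -> u w = 0.
  move=> ws; have [|a ab] := @weight_separation w w0.
    by apply: contraNneq w0s => <-.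
  pose u' (w : hdual) := (qp (w a) - qp (w0 a))%:A *: u w.
  have wu' (w1 : hdual) : has_weight w1 (u' w1).
    by have [_ _ wZ] := has_weight_subspace w1; apply: wZ.
  have su' : \sum_(w1 <- s) u' w1 = 0.
    have := congr1 (fun t => k a *: t - (qp (w0 a))%:A *: t) su.
    rewrite !scaler0 subrr scalerDr wu scalerDr opprD addrACA subrr add0r => e.
    rewrite -[RHS]e.
    rewrite scaler_sumr scaler_sumr -sumrB; apply: eq_bigr => w1 _.
    by rewrite wu /u' scalerBl scalerBl.
  have := IH u' us wu' su' w ws.
  by apply: algZ_eq0; rewrite subr_eq0.
move=> w; rewrite inE => /orP[/eqP->|]; last exact: us0.
by rewrite -su big_seq big1 ?addr0.
Qed.

Lemma lspan_weights Z t : (forall u, Z u -> exists w, has_weight w u) -> lspan Z t ->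
  exists (s : seq hdual) (u : hdual -> L),
  [/\ uniq s, forall w, has_weight w (u w) /\ lspan (fun z => Z z /\ has_weight w z) (u w)
    & t = \sum_(w <- s) u w].
Proof.
move=> Zw; elim=> [|a z t' Zz _ [s [u [us wu ->]]]].
  exists [::], (fun=> 0); split; rewrite ?big_nil // => w; split; last exact: lspan0.
  by case: (has_weight_subspace w).
have [w0 zw0] := Zw z Zz.
pose u' (w : hdual) := (if w == w0 then a%:A *: z else 0) + (if w \in s then u w else 0).
exists (undup (w0 :: s)), u'; split; first exact: undup_uniq.
  move=> w; have [W0 WD WZ] := has_weight_subspace w; split.
    apply: WD; first by case: eqP => // ->; have [_ _] := has_weight_subspace w0; apply.
    by case: ifP => // _; have [] := wu w.
  apply: lspanD; first by case: eqP => [->|_]; [apply/lspanZ/lspan_in|exact: lspan0].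
  by case: ifP => _; [have [] := wu w|exact: lspan0].
by rewrite /u' big_split sum_undup_single sum_undup_mem.
Qed.

(** Subtracting [t] from its own decomposition gives a vanishing sum of weight vectors. By
    directness its component of weight [w] is 0, so [t] is the component taken from the span. *)
Lemma lspan_weight Z w t : (forall u, Z u -> exists w, has_weight w u) ->
  has_weight w t -> lspan Z t -> lspan (fun z => Z z /\ has_weight w z) t.
Proof.
move=> Zw wt /(lspan_weights Zw)[s [u [us wu tE]]].
pose u' (w' : hdual) := (if w' == w then - t else 0) + (if w' \in s then u w' else 0).
have : u' w = 0.
  apply: (@has_weight_direct (undup (w :: s))); rewrite ?undup_uniq ?mem_undup ?mem_head //.
    move=> w'; have [W0 WD WZ] := has_weight_subspace w'; apply: WD.
      by case: eqP => // ->; exact: subspaceN (has_weight_subspace w) wt.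
    by case: ifP => // _; have [] := wu w'.
  by rewrite big_split sum_undup_single sum_undup_mem // -tE; exact: addNr.
rewrite /u' eqxx; move/eqP; rewrite addrC subr_eq0 => /eqP<-.
by case: ifP => _; [have [] := wu w|exact: lspan0].
Qed.

Lemma has_weight_unique w w' u : has_weight w u -> has_weight w' u -> u != 0 -> w = w'.
Proof.
move=> wu w'u; apply: contraNeq => /weight_separation[a ab].
apply/eqP; apply: (@algZ_eq0 _ _ _ (qp (w a) - qp (w' a))); first by rewrite subr_eq0.
by rewrite scalerBl scalerBl -wu -w'u subrr.
Qed.

Lemma lspan_other_weight Z w t :
  (forall u, Z u -> exists2 w', has_weight w' u & w' != w) ->
  has_weight w t -> lspan Z t -> t = 0.
Proof.
move=> Zw wt /(lspan_weight _ wt) tE.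
have {}tE := tE (fun u Zu => let: ex_intro2 w' wu _ := Zw u Zu in ex_intro _ w' wu).
apply: (lspan_min (Z := fun z => Z z /\ has_weight w z) (P := fun t => t = 0)) tE.
  by split=> [|u1 u2 -> ->|a u ->]; rewrite ?addr0 ?scaler0.
move=> u [Zu wu]; apply: contrapT => /eqP u0.
by have [w' w'u /eqP] := Zw u Zu; apply; exact: has_weight_unique w'u wu u0.
Qed.

(** * Words in the lowering operators *)

Local Notation word := (seq ('I_n * int)).

Definition lower (w : word) (u : L) : L :=
  foldr (fun p t => X false p.1 p.2 *: t) u w.

Definition word_weight (w : word) : hdual := \sum_(p <- w) alpha p.1.

Definition words (Z : L -> Prop) (t : L) := exists w u, Z u /\ t = lower w u.

Lemma word_weight_cat w1 w2 : word_weight (w1 ++ w2) = word_weight w1 + word_weight w2.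
Proof. exact: big_cat. Qed.

Lemma lowerZ w (a : K) u : lower w (a%:A *: u) = a%:A *: lower w u.
Proof. by elim: w => //= p w ->; rewrite algZC. Qed.

Lemma has_weight_lower om u w : has_weight om u -> has_weight (om - word_weight w) (lower w u).
Proof.
move=> omu; elim: w => [|p w IH]; first by rewrite /word_weight big_nil subr0.
rewrite /word_weight big_cons opprD addrCA addrC; exact: has_weightXm.
Qed.

Lemma word_weight_count w :
  word_weight w = \sum_(i < n) (count (fun p => p.1 == i) w)%:R *: alpha i.
Proof.
elim: w => [|p w IH].
  by rewrite /word_weight big_nil big1 // => i _; rewrite scale0r.
rewrite /word_weight big_cons -/(word_weight w) IH /=.
under [RHS]eq_bigr do rewrite natrD scalerDl.
rewrite big_split /=; congr (_ + _).
rewrite (bigD1 p.1) //= eqxx scale1r big1 ?addr0 // => i /negbTE ip.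
by rewrite eq_sym ip scale0r.
Qed.

Lemma alpha_free (a : 'I_n -> rat) : \sum_(i < n) a i *: alpha i = 0 -> forall i, a i = 0.
Proof.
have sz : size (codom alpha) == n by rewrite size_codom card_ord.
have := root_free H; rewrite -[codom _]/(Tuple sz : seq _) => /freeP fr s0.
apply: fr; rewrite -[RHS]s0; apply: eq_bigr => i _; congr (_ *: _).
by rewrite /= codomE (nth_map i) ?size_enum_ord // nth_ord_enum.
Qed.

(** Linear independence of the simple roots: a weight remembers how often each index occurs, and so
    the length of the word. *)
Lemma word_weight_eq w1 w2 : word_weight w1 = word_weight w2 ->
  forall i, count (fun p => p.1 == i) w1 = count (fun p => p.1 == i) w2.
Proof.
rewrite !word_weight_count => /eqP; rewrite -subr_eq0 -sumrB => /eqP e i.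
have := @alpha_free (fun i => (count (fun p => p.1 == i) w1)%:R -
  (count (fun p => p.1 == i) w2)%:R).
under eq_bigr do rewrite scalerBl.
by move=> /(_ e i)/eqP; rewrite subr_eq0 eqr_nat => /eqP.
Qed.

Lemma word_weight_size w1 w2 : word_weight w1 = word_weight w2 -> size w1 = size w2.
Proof.
move=> /word_weight_eq e.
have sz (w : word) : size w = (\sum_(i < n) count (fun p => p.1 == i) w)%N.
  elim: w => [|p w IH]; first by rewrite big1.
  rewrite /= IH big_split /= -add1n; congr (_ + _)%N.
  rewrite (bigD1 p.1) //= eqxx big1 ?addn0 // => i /negbTE ip.
  by rewrite eq_sym ip.
by rewrite !sz; apply: eq_bigr => i _; rewrite e.
Qed.

Lemma stab_phi (P : L -> Prop) s i m : subspace P ->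
  (forall a, stab P (k a)) -> (forall j m, stab P (h j m)) -> stab P (phi s i m).
Proof.
move=> subP kP hP; rewrite /uphi; case: ifP => _; last exact: stab0.
by apply: stabM => //; apply: stab_exp_coef => // j; apply: stabZ.
Qed.

Definition gen_stable (P : L -> Prop) := forall x u, P u -> P (g x *: u).

Lemma gen_stableP (P : L -> Prop) :
  (forall s i r, stab P (X s i r)) -> (forall a, stab P (k a)) ->
  (forall i m, stab P (h i m)) -> gen_stable P.
Proof.
move=> xP kP hP [[[[s i] r]|a]|[i m]]; [exact: xP|exact: kP|].
by have := hP i (val m); rewrite /uh valK.
Qed.

(* The form of the triangular decomposition that is needed here. *)
Lemma words_stable (Z : L -> Prop) :
  (forall i m u, Z u -> lspan Z (h i m *: u)) -> (forall a u, Z u -> lspan Z (k a *: u)) ->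
  (forall i r u, Z u -> X true i r *: u = 0) ->
  gen_stable (lspan (words Z)).
Proof.
move=> hZ kZ xZ; set P := lspan (words Z).
have subP : subspace P := lspan_subspace _.
have xmP i r : stab P (X false i r).
  move=> u; apply: lspan_map => _ [w [t [Zt ->]]].
  by apply: lspan_in; exists ((i, r) :: w), t.
have kP a : stab P (k a).
  move=> u; apply: lspan_map => _ [w [t [Zt ->]]].
  elim: w => [|[i r] w IH] /=.
    apply: lspan_mono (kZ a t Zt) => z Zz.
    by apply: lspan_in; exists [::], z.
  by rewrite scalerA (kX rel) -algZ -scalerA; apply/lspanZ/xmP.
have hP i m : stab P (h i m).
  move=> u; apply: lspan_map => _ [w [t [Zt ->]]].
  elim: w => [|[j r] w IH] /=.
    apply: lspan_mono (hZ i m t Zt) => z Zz.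
    by apply: lspan_in; exists [::], z.
  have [->|m0] := eqVneq m 0; first by rewrite h0 scale0r; exact: lspan0.
  rewrite scalerA (hX rel) // scalerDl; apply: lspanD.
    by rewrite -scalerA; exact: xmP.
  by apply: stabZ => //; apply: lspan_in; exists w, t.
apply: gen_stableP => // -[] i r; last exact: xmP.
move=> u; apply: lspan_map => _ [w [t [Zt ->]]].
elim: w => [|[j r'] w IH] /=; first by rewrite (xZ _ _ _ Zt); exact: lspan0.
(* A raising operator passes a lowering letter at the cost of $\phi$ terms, which are built from the
   stable operators $k_a$ and $h_{i,m}$. *)
have := rel (rel_xx q qp g i j r r') => /(congr1 (fun y => y *: lower w t)).
rewrite scalerBl => /eqP; rewrite subr_eq scalerA => /eqP->.
apply: lspanD; last by rewrite -scalerA; exact: xmP.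
apply: stabZ => //; last by apply: lspan_in; exists w, t.
by apply: stabD => //; [|apply: stabN => //]; exact: stab_phi.
Qed.

Hypothesis generated : forall P : L -> Prop, subspace P -> gen_stable P ->
  forall y u, P u -> P (y *: u).
Hypothesis simple : forall P : L -> Prop, subspace P -> gen_stable P ->
  (exists2 u, P u & u != 0) -> forall u, P u.

Variables (lam : hdual) (v : L) (psi : bool -> 'I_n -> nat -> K).
Hypothesis v0 : v != 0.
Hypothesis v_gen : forall u, exists y : U, u = y *: v.
Hypothesis v_raise : forall i r, X true i r *: v = 0.
Hypothesis v_phi : forall s i (m : nat),
  phi s i (sg s * m%:Z) *: v = (psi s i m)%:A *: v.
Hypothesis v_weight : has_weight lam v.

Definition highest_vector om u := has_weight om u /\ forall i r, X true i r *: u = 0.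

Lemma highest_vectorh om u i m : highest_vector om u -> highest_vector om (h i m *: u).
Proof.
move=> [wu xu]; split=> [|j r]; first exact: has_weighth.
have [->|m0] := eqVneq m 0; first by rewrite h0 scale0r scaler0.
have := hX rel true i j r m0 => /(congr1 (fun y => y *: u)).
rewrite scalerDl -[(h i m * _) *: u]scalerA -[(_ * h i m) *: u]scalerA.
by rewrite -[(_ *: X _ _ _) *: u]algZ !xu !scaler0 addr0.
Qed.

(** Words applied to all such vectors span a submodule. Were it nonzero, it would contain [v] by
    simplicity, yet its weights all differ from [lam] by the weight of a nonempty word. *)
Lemma singular_eq0 w0 t : w0 != [::] -> highest_vector (lam - word_weight w0) t -> t = 0.
Proof.
move=> w00 tw; apply: contrapT => /eqP t0.
pose Z := highest_vector (lam - word_weight w0).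
have Zstab : gen_stable (lspan (words Z)).
  apply: words_stable => [i m u Zu|a u [wu xu]|i r u [_]] //.
    by apply/lspan_in/highest_vectorh.
  by rewrite wu; apply/lspanZ/lspan_in.
have /simple : exists2 u, lspan (words Z) u & u != 0.
  by exists t => //; apply: lspan_in; exists [::], t.
move=> /(_ (lspan_subspace _) Zstab v) vZ.
move/eqP: v0; apply; apply: lspan_other_weight v_weight vZ => _ [w [u [[wu _] ->]]].
exists (lam - word_weight w0 - word_weight w); first exact: has_weight_lower.
rewrite -addrA -opprD -word_weight_cat -subr_eq0 addrAC subrr add0r oppr_eq0.
apply: contra_neq w00 => e.
have := @word_weight_size (w0 ++ w) [::]; rewrite e /word_weight big_nil size_cat.
by move=> /(_ erefl); case: (w0).
Qed.

(** The highest weight condition speaks only of $\phi^\pm$; [exp_eigen] recovers the $h_{i,m}$ from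
    it, for each sign of $m$ separately. *)
Lemma v_eigen i m : exists a : K, h i m *: v = a%:A *: v.
Proof.
suff eig s (j : nat) : exists a : K, h i (sg s * j%:Z) *: v = a%:A *: v.
  case: m => m; first by have := eig true m; rewrite mul1r.
  by have := eig false m.+1; rewrite mulN1r NegzE.
case: j => [|j]; first by exists 0; rewrite mulr0 h0 !scale0r.
have [m'|a aE] := @exp_eigen _ _ _ (hseries q g i s) (phi_exp q g i s) v
    (hseries0 q g i s) (phi_exp0 q g i s) (theta_phi_exp char0 rel i s) _ j.+1.
  set b := ((sg s)%:~R * (gcm_r A i)%:R : rat) *: coroot H i.
  exists (qp (lam (- b)) * psi s i m').
  have -> : phi_exp q g i s m' = k (- b) * phi s i (sg s * m'%:Z).
    by rewrite phi_exp_phi mulrA (k_opp rel) mul1r.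
  by rewrite -[LHS]scalerA v_phi algZC v_weight algZA mulrC.
have ne : ((sg s)%:~R * (q - q^-1)) *+ j.+1 != 0.
  rewrite -mulr_natr !mulf_neq0 ?char0 // ?(q_sub_inv_neq0 q_root q0) //.
  by case: (s); rewrite ?oppr_eq0 ?oner_eq0.
move: aE ne; rewrite /hseries -algZ; set b := _ *+ _ => e b0.
by exists (b^-1 * a); rewrite -algZA -e algZA mulVf // !scale1r.
Qed.

(** Sorting by length rather than by weight allows induction one letter at a time; weight spaces are
    recovered because a weight fixes the length. *)
Definition level d : L -> Prop := lspan (fun u => exists2 w, size w = d & u = lower w v).

Lemma levelX d i r u : level d u -> level d.+1 (X false i r *: u).
Proof.
apply: lspan_map => _ [w wd ->]; apply: lspan_in.
by exists ((i, r) :: w) => //=; rewrite wd.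
Qed.

Lemma levelh d i m u : level d u -> level d (h i m *: u).
Proof.
apply: lspan_map => _ [w wd ->].
have [->|m0] := eqVneq m 0; first by rewrite h0 scale0r; exact: lspan0.
elim: w d wd => [|[j r] w IH] d wd /=.
  have [a ->] := v_eigen i m.
  by apply/lspanZ/lspan_in; exists [::].
rewrite scalerA (hX rel) // scalerDl -[(_ * h i m) *: _]scalerA.
case: d wd => // d [wd]; apply: lspanD; first exact/levelX/IH.
rewrite -algZ; apply/lspanZ/lspan_in.
by exists ((j, m + r) :: w) => //=; rewrite wd.
Qed.

Lemma words_span t : lspan (fun u => exists w, u = lower w v) t.
Proof.
pose Z u := exists a : K, u = a%:A *: v.
have Zstab : gen_stable (lspan (words Z)).
  apply: words_stable => [i m _ [a ->]|b _ [a ->]|i r _ [a ->]].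
  - have [b bE] := v_eigen i m.
    by rewrite algZC bE algZA; apply: lspan_in; exists (a * b).
  - by rewrite algZC v_weight algZA; apply: lspan_in; eexists.
  - by rewrite algZC v_raise scaler0.
have [y ->] := v_gen t.
have : lspan (words Z) (y *: v).
  apply: generated => //; first exact: lspan_subspace.
  by apply: lspan_in; exists [::], v; split=> //; exists 1; rewrite !scale1r.
apply: lspan_mono => _ [w [_ [[a ->] ->]]].
by rewrite lowerZ; apply/lspanZ/lspan_in; exists w.
Qed.

Lemma weight_of_nonzero om t : has_weight om t -> t != 0 ->
  exists w, om = lam - word_weight w.
Proof.
move=> wt; apply: contra_neqP => /forallNP e.
apply: lspan_other_weight wt (words_span t) => _ [w ->].
exists (lam - word_weight w); first exact: has_weight_lower.
by apply/eqP => e'; apply: (e w).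
Qed.

(** * Strings for the rank-one subalgebras *)

Local Notation z i := (qi q A i).

Lemma commXX0 i : X true i 0 * X false i 0 - X false i 0 * X true i 0 =
  (z i - (z i)^-1)^-1 *: (k (((sg true)%:~R * (gcm_r A i)%:R : rat) *: coroot H i) -
                          k (((sg false)%:~R * (gcm_r A i)%:R : rat) *: coroot H i)).
Proof. by have := commXX rel i 0; rewrite phi_exp0 mulr1 scale1r. Qed.

Lemma has_weight_pow s i om u m : has_weight om u ->
  has_weight (om + ((sg s)%:~R * m%:R) *: alpha i) (X s i 0 ^+ m *: u).
Proof.
move=> wu; elim: m => [|m IH]; first by rewrite mulr0 scale0r addr0 scale1r.
rewrite exprS -[(_ * _) *: u]scalerA; have := has_weightX s i 0 IH; congr has_weight.
rewrite -addrA -scalerDl; congr (_ + _ *: _).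
by rewrite -natr1 mulrDr mulr1.
Qed.

(** The opposite operator sends $x_s^{m+1}u$ to an explicit multiple of $x_s^mu$ ([raise]); at $m=N$
    that multiple must vanish, which fixes the weight. With [s = false] this determines [lam], with
    [s = true] it measures strings from their lowest vector. *)
Lemma sl2_string s i om u N : has_weight om u ->
  X (~~ s) i 0 *: u = 0 -> X s i 0 ^+ N.+1 *: u = 0 -> X s i 0 ^+ N *: u != 0 ->
  om (coroot H i) = - (sg s)%:~R * N%:R.
Proof.
move=> wu eu fN1 fN.
pose kk b := k (((sg b)%:~R * (gcm_r A i)%:R : rat) *: coroot H i).
have ef : X (~~ s) i 0 * X s i 0 - X s i 0 * X (~~ s) i 0 =
    (z i - (z i)^-1)^-1 *: (kk (~~ s) - kk s).
  by case: (s) (commXX0 i) => //= e; rewrite -opprB e -scalerN opprB.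
have zi0 := qi_neq0 A q0 i; have ziroot m := qi_root A q_root i (m := m).
have kw b m : kk b *: (X s i 0 ^+ m *: u) =
    (qp (((sg b)%:~R * (gcm_r A i)%:R) * om (coroot H i)) *
     z i ^ (sg s * sg b * (2 * m)%N%:Z))%:A *: (X s i 0 ^+ m *: u).
  have := has_weight_pow s i m wu.
  move=> ->; congr (_%:A *: _); rewrite add_lfunE scale_lfunE qpD linearZ /=; congr (_ * _).
  rewrite linearZ /= root_coroot gcm_diag.
  have -> : ((sg s)%:~R * m%:R : rat) *: (((sg b)%:~R * (gcm_r A i)%:R) *: (2%:~R : rat^o))
     = (sg s * sg b * (gcm_r A i * (2 * m))%N%:Z)%:~R.
    by rewrite !rmorphM /=; rewrite /GRing.scale /=; ring.
  by rewrite (qp_int q0 qpD qp1) /qi exprnP exprz_exp; congr (q ^ _); rewrite PoszM mulrCA.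
set c := z i ^+ 2.
(* The eigenvalue on [u] of the [kk] of sign opposite to [s]; the one of sign [s] has the inverse
   eigenvalue. *)
pose kappa := qp ((sg (~~ s))%:~R * (gcm_r A i)%:R * om (coroot H i)).
have kappa0 : kappa != 0 by exact: qp_neq0 q0 qpD qp1 _.
have kwe m : kk (~~ s) *: (X s i 0 ^+ m *: u) =
    (kappa * c^-1 ^+ m)%:A *: (X s i 0 ^+ m *: u).
  rewrite kw -/kappa; congr ((_ * _)%:A *: _).
  have -> : sg s * sg (~~ s) = -1 by case: (s).
  by rewrite mulN1r -exprnN exprVn exprM.
have kws m : kk s *: (X s i 0 ^+ m *: u) =
    (kappa^-1 * c ^+ m)%:A *: (X s i 0 ^+ m *: u).
  rewrite kw; congr ((_ * _)%:A *: _).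
    rewrite /kappa -(qpN q0 qpD qp1); congr (qp _).
    by case: (s); rewrite /sg /=; ring.
  have -> : sg s * sg s = 1 by case: (s).
  by rewrite mul1r -exprnP exprM.
have raise m : X (~~ s) i 0 *: (X s i 0 ^+ m.+1 *: u) =
   ((z i - (z i)^-1)^-1 * (kappa * \sum_(j < m.+1) c^-1 ^+ j -
      kappa^-1 * \sum_(j < m.+1) c ^+ j))%:A *: (X s i 0 ^+ m *: u).
  have step m' : X (~~ s) i 0 *: (X s i 0 ^+ m'.+1 *: u) =
      X s i 0 *: (X (~~ s) i 0 *: (X s i 0 ^+ m' *: u)) +
      ((z i - (z i)^-1)^-1 * (kappa * c^-1 ^+ m' - kappa^-1 * c ^+ m'))%:A *:
        (X s i 0 ^+ m' *: u).
    rewrite exprS -[(_ * _) *: u]scalerA.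
    have := congr1 (fun y => y *: (X s i 0 ^+ m' *: u)) ef.
    rewrite scalerBl => /eqP; rewrite subr_eq -[(X (~~ s) i 0 * _) *: _]scalerA.
    rewrite -[(X s i 0 * _) *: _]scalerA => /eqP->.
    rewrite addrC; congr (_ + _); rewrite -[LHS]algZ scalerBl kwe kws.
    by rewrite -scalerBl -scalerBl algZA.
  elim: m => [|m IH].
    by rewrite step scale1r eu scaler0 add0r !big_ord1.
  rewrite step IH algZC [X s i 0 *: (_ *: _)]scalerA -exprS -scalerDl -scalerDl.
  by rewrite -mulrDr ![\sum_(_ < m.+2) _]big_ord_recr /=; congr ((_ * _)%:A *: _); ring.
have c0 : c != 0 by rewrite expf_neq0.
have := raise N; rewrite fN1 scaler0 => /esym e.
have {e} : (z i - (z i)^-1)^-1 * (kappa * \sum_(j < N.+1) c^-1 ^+ j -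
      kappa^-1 * \sum_(j < N.+1) c ^+ j) = 0.
  by apply: contraNeq fN => e0; apply/eqP; apply: algZ_eq0 e0 e.
move/eqP; rewrite mulf_eq0 invr_eq0 (negPf (zz_neq0 zi0 ziroot)) /=.
rewrite -[\sum_(_ < _) c^-1 ^+ _]/(geom_sum c N.+1) (geom_sum_geometric zi0).
rewrite mulrA -mulrBl mulf_eq0 (negPf (geometric_neq0 ziroot N)) orbF subr_eq0.
move=> /eqP/(congr1 (fun a => a * kappa * c ^+ N)).
rewrite mulVf // mul1r exprVn mulrAC [_ * c ^+ N]mulrAC mulfK ?expf_neq0 //.
rewrite /c /kappa -exprM /qi -exprM -(qp_nat q0 qpD qp1) -qpD.
move=> /(qp_inj q_root q0 qpD qp1).
have r0 : (gcm_r A i)%:R != 0 :> rat by rewrite pnatr_eq0 -lt0n gcm_r_gt0.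
rewrite !natrM -mulrDl => e; apply: (mulfI r0).
have two0 : 2%:R != 0 :> rat by [].
case: (s) e; rewrite /sg /= => e; apply: (mulfI two0).
  by transitivity (- ((-1)%:~R * (gcm_r A i)%:R + (-1)%:~R * (gcm_r A i)%:R) *
    om (coroot H i)); [ring|rewrite mulNr e; ring].
by rewrite [LHS](_ : _ = (1%:~R * (gcm_r A i)%:R + 1%:~R * (gcm_r A i)%:R) *
    om (coroot H i)); [rewrite e; ring|ring].
Qed.

(** * Local nilpotency of the lowering operators *)

Definition nilpotent_at i (u : L) := exists N, X false i 0 ^+ N *: u = 0.

Lemma nilpotent_le i (u : L) N M : X false i 0 ^+ N *: u = 0 -> (N <= M)%N ->
  X false i 0 ^+ M *: u = 0.
Proof. by move=> e NM; rewrite -(subnK NM) exprD -scalerA e scaler0. Qed.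

Lemma nilpotent_subspace i : subspace (nilpotent_at i).
Proof.
split=> [|u1 u2 [N1 e1] [N2 e2]|a u [N e]]; first by exists 0%N; rewrite scaler0.
  exists (N1 + N2)%N; rewrite scalerDr (nilpotent_le e1) ?leq_addr //.
  by rewrite (nilpotent_le e2) ?leq_addl // addr0.
by exists N; rewrite algZC e scaler0.
Qed.

Lemma nilpotent_pow i (u : L) m : nilpotent_at i (X false i 0 ^+ m *: u) <-> nilpotent_at i u.
Proof.
split=> -[N e]; first by exists (N + m)%N; rewrite exprD -scalerA.
by exists N; rewrite scalerA -exprD addnC exprD -scalerA e scaler0.
Qed.

Lemma qbin_diag i d : qbin (z i) d d = 1.
Proof.
rewrite /qbin subnn [qfact _ 0]big_geq // mulr1 divff //.
rewrite /qfact prodf_seq_neq0; apply/allP => m; rewrite mem_index_iota => /andP[m0 _] /=.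
have ziroot l := qi_root A q_root i (m := l); have zi0 := qi_neq0 A q0 i.
rewrite /qint mulf_neq0 ?invr_eq0 ?(zz_neq0 zi0 ziroot) //.
rewrite subr_eq0 -exprnN; apply/eqP => /(congr1 (fun a => a * z i ^+ m)).
rewrite mulVf ?expf_neq0 // -exprD; apply/eqP/ziroot.
by rewrite addn_gt0 m0.
Qed.

Lemma prod_below (S : pzRingType) (e : S) d k : (k <= d)%N ->
  \prod_(l < d | (l < k)%N) e = e ^+ k.
Proof.
by move=> kd; rewrite -(big_ord_widen d (fun=> e) kd) prodr_const card_ord.
Qed.

Lemma prod_above (S : pzRingType) (e : S) d k : (k <= d)%N ->
  \prod_(l < d | (k <= l)%N) e = e ^+ (d - k).
Proof.
move=> kd; pose B := [pred l : 'I_d | (l < k)%N].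
have -> : \prod_(l < d | (k <= l)%N) e = \prod_(l in [predC B]) e.
  by apply: eq_bigl => l; rewrite !inE -leqNgt.
have Bk : #|B| = k.
  by rewrite -sum1_card -(big_ord_widen d (fun=> 1%N) kd) sum1_card card_ord.
by rewrite prodr_const; congr (_ ^+ _); rewrite -[in RHS](card_ord d) -(cardC B) Bk addKn.
Qed.

(** With all $r_l=0$ the permutations give equal terms, and their number is invertible. Isolating
    the term $k=s$ of the Serre relation, whose binomial is 1, leaves terms with at least one
    $x_{i,0}$ to the right of $x_{j,r'}$. *)
Lemma serre_zero i j r' : i != j ->
  exists (d : nat) (a : nat -> K), X false i 0 ^+ d.+1 * X false j r' =
    \sum_(m < d.+1) a m *: (X false i 0 ^+ m * X false j r' * X false i 0 ^+ (d.+1 - m)).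
Proof.
move=> ij; have Aij := gcm_offdiag A ij.
pose d := `|1 - A i j|%N.
have dE : d%:Z = 1 - A i j by rewrite /d gez0_abs // subr_ge0 (le_trans Aij).
have := rel (rel_serre q qp g false (fun _ : 'I_d => 0) r' ij dE).
rewrite /serre sumr_const => S0.
have {S0} : \sum_(k < d.+1) ((-1) ^+ k * qbin (z i) d k) *:
    (X false i 0 ^+ k * X false j r' * X false i 0 ^+ (d - k)) = 0.
  have : (0 < #|(xpredT : pred {perm 'I_d})|)%N.
    by apply/card_gt0P; exists (perm_one 'I_d).
  move: S0; case: #|_| => // l /(natmul_eq0 char0) S0 _.
  rewrite -[RHS]S0; apply: eq_bigr => k _.
  by rewrite prod_below ?prod_above // -ltnS.
have [d' ->] : exists d', d = d'.+1.
  case: (d) dE => [|d' _]; last by exists d'.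
  by move=> e; move: Aij; rewrite -[A i j](subKr 1) -e subr0.
rewrite big_ord_recr /= subnn mulr1 qbin_diag mulr1 => /eqP; rewrite addrC addr_eq0 => /eqP e.
exists d', (fun m => - (-1) ^+ d'.+1 * ((-1) ^+ m * qbin (z i) d'.+1 m)).
transitivity ((-1) ^+ d'.+1 *: ((-1 : K) ^+ d'.+1 *: (X false i 0 ^+ d'.+1 * X false j r'))).
  by rewrite scalerA -exprMn mulrNN mulr1 expr1n scale1r.
rewrite e scalerN -scaleNr scaler_sumr; apply: eq_bigr => m _.
by rewrite scalerA.
Qed.

(** Every term of [serre_zero] first applies a positive power of $x_{i,0}$ to [u], leaving a vector
    killed by a smaller power; hence induction on [N]. *)
Lemma nilpotent_lower_other i j r' u : i != j ->
  nilpotent_at i u -> nilpotent_at i (X false j r' *: u).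
Proof.
move=> ij [N]; have [d [a S]] := serre_zero r' ij.
elim: N u => [|N IH] u.
  by rewrite scale1r => ->; exists 0%N; rewrite !scaler0.
move=> e; apply/(nilpotent_pow _ _ d.+1); rewrite scalerA S scaler_suml.
have [N0 ND NZ] := nilpotent_subspace i; apply: big_ind => // m _.
rewrite -algZ; apply: (NZ); rewrite -!scalerA; apply/nilpotent_pow/IH.
rewrite scalerA -exprD; apply: nilpotent_le e _.
by rewrite (subSn (leq_ord m)) addnS ltnS leq_addr.
Qed.

Lemma nilpotent_lower_same i r u :
  nilpotent_at i u -> nilpotent_at i (X false i r *: u).
Proof.
have [N0 ND NZ] := nilpotent_subspace i.
have zi0 := qi_neq0 A q0 i; set c := z i ^+ 2; have c0 : c != 0 by rewrite expf_neq0.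
(* An exchange relation with x_{i,0} is enough: the powers of x_{i,0} then
   pass to the right at the cost of currents with smaller index. *)
have key (x : nat -> U) (b b' : K) : x 0%N = X false i 0 ->
    (forall m, x 0%N * x m.+1 = b *: (x m.+1 * x 0%N) +
       b' *: \sum_(l < m) x l.+1 * x (m - l)%N) ->
    forall m u, nilpotent_at i u -> nilpotent_at i (x m *: u).
  move=> x0 xS; elim/ltn_ind => -[_|m IH] {}u.
    by rewrite x0 => ?; apply/(nilpotent_pow i u 1).
  case=> N; elim: N u => [|N IHN] u.
    by rewrite scale1r => ->; exists 0%N; rewrite !scaler0.
  move=> e; apply/(nilpotent_pow _ _ 1); rewrite expr1 -x0 scalerA xS scalerDl.
  apply: (ND); rewrite -algZ; apply: (NZ).
    by rewrite -scalerA; apply: IHN; rewrite x0 scalerA -exprSr.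
  rewrite scaler_suml; apply: (big_ind (nilpotent_at i) N0 ND) => l _; rewrite -scalerA.
  apply: (IH); first by rewrite ltnS.
  by apply: (IH); [rewrite ltnS leq_subr|exists N.+1].
case: r => r.
  apply: (key (fun m => X false i m%:Z) c (c - 1)) => // m.
  exact: (quad_sum (x := X false i) c0 char0 (quadX rel i) m).
(* For negative indices the reflection $r\mapsto-r$ gives the same quadratic relation with $c^{-1}$
   in place of $c$. *)
rewrite NegzE; move: r.+1 u.
apply: (key (fun m => X false i (- m%:Z)) c^-1 (c^-1 - 1)); first by rewrite oppr0.
move=> m; apply: (quad_sum (x := fun r => X false i (- r)) (c := c^-1)) => //.
  by rewrite invr_eq0.
move=> r1 s1; have := quadX rel i (- r1 - 1) (- s1 - 1).
rewrite !subrK -!opprD -/c invrK => /(congr1 (fun y => - c *: y)).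
rewrite !scaleNr !scalerBr !scalerA divff // !scale1r !opprB => e.
by rewrite -[LHS]opprB -e opprB.
Qed.

Lemma nilpotent_all i u : nilpotent_at i v -> nilpotent_at i u.
Proof.
move=> nv; apply: lspan_min (nilpotent_subspace i) _ u (words_span u) => _ [w ->].
elim: w => [//|[j r] w IH] /=; have [->|ij] := eqVneq j i.
  exact: nilpotent_lower_same.
by apply: nilpotent_lower_other => //; rewrite eq_sym.
Qed.

Lemma last_nonzero (y : U) (u : L) : u != 0 -> (exists N, y ^+ N *: u = 0) ->
  exists2 N, y ^+ N *: u != 0 & y ^+ N.+1 *: u = 0.
Proof.
move=> u0 [N yN]; have : exists N, y ^+ N *: u == 0 by exists N; apply/eqP.
move=> ex; case: (ex_minnP ex) => -[|M] /eqP yM min.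
  by move: u0; rewrite -[u]scale1r -(expr0 y) yM eqxx.
by exists M => //; apply/negP => /min; rewrite ltnn.
Qed.

(** * Bounds on weights along root strings *)

Lemma word_weight_nseq i m r : word_weight (nseq m (i, r)) = alpha i *+ m.
Proof.
elim: m => [|m IH]; first by rewrite /word_weight big_nil.
by rewrite /word_weight big_cons -/(word_weight _) IH mulrS.
Qed.

(** Weights are [lam] minus word weights. From one occurring weight, adding $\alpha_i$ removes a
    letter [i] each time, so the number of further steps is at most the number of letters [i]. *)
Lemma vanish_above mu i : exists N, forall r, (N <= r)%N ->
  forall u, has_weight (mu + alpha i *+ r) u -> u = 0.
Proof.
have [[r0 [u0 [wu0 u00]]]|none] := pselect (exists r0 u0,
    has_weight (mu + alpha i *+ r0) u0 /\ u0 != 0); last first.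
  exists 0%N => r _ u wu; apply: contrapT => /eqP u0.
  by apply: none; exists r, u.
have [w0 e0] := weight_of_nonzero wu0 u00.
exists (r0 + (count (fun p => p.1 == i) w0).+1)%N => r rN u wu.
apply: contrapT => /eqP u1; have [w1 e1] := weight_of_nonzero wu u1.
have r0r : (r0 <= r)%N by rewrite (leq_trans _ rN) // leq_addr.
have : word_weight w0 = word_weight (w1 ++ nseq (r - r0) (i, 0)).
  rewrite word_weight_cat word_weight_nseq mulrnBr //.
  have -> : alpha i *+ r0 = lam - word_weight w0 - mu by rewrite -e0 addrC addKr.
  have -> : alpha i *+ r = lam - word_weight w1 - mu by rewrite -e1 addrC addKr.
  rewrite [X in _ + X](_ : _ = word_weight w0 - word_weight w1).
    by rewrite [RHS]addrC subrK.
  by rewrite opprB addrA subrK opprB addrC addrA subrK.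
move/word_weight_eq/(_ i); rewrite count_cat count_nseq /= eqxx mul1n => e.
by move: rN; rewrite -leq_subRL // e -addnS leqNgt ltn_addl.
Qed.

(** Lower [u] by $b$ steps to the bottom of its string, then raise to the top. By [sl2_string] the
    raise takes $2(r+b)-\mu(\alpha_i^\vee)$ steps, so the top has weight
    $\mu+(r+b-\mu(\alpha_i^\vee))\alpha_i$; for large [r] this contradicts [vanish_above]. *)
Lemma vanish_below mu i : nilpotent_at i v -> exists N, forall r, (N <= r)%N ->
  forall u, has_weight (mu - alpha i *+ r) u -> u = 0.
Proof.
move=> nv; have [M above] := vanish_above mu i.
set m := mu (coroot H i); exists (Num.bound `|m| + M)%N => r rN u wu.
apply: contrapT => /eqP u0.
have [b u1 u1z] := last_nonzero u0 (nilpotent_all u nv).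
set u' := X false i 0 ^+ b *: u in u1.
have wu' : has_weight (mu - alpha i *+ (r + b)) u'.
  have := has_weight_pow false i b wu; congr has_weight.
  by rewrite /sg mulN1r scaleNr scaler_nat mulrnDr opprD addrA.
have wup N' : has_weight (mu - alpha i *+ (r + b) + alpha i *+ N') (X true i 0 ^+ N' *: u').
  by have := has_weight_pow true i N' wu'; rewrite mul1r scaler_nat.
have [|N1 uN uNz] := @last_nonzero (X true i 0) u' u1.
  exists (r + b + M)%N; apply: (above M) => //.
  by have := wup (r + b + M)%N; rewrite [in X in _ + X]mulrnDr addrA subrK.
have eu' : X false i 0 *: u' = 0 by rewrite /u' scalerA -exprS.
have := sl2_string (s := true) wu' eu' uNz uN.
rewrite -[alpha i *+ _](scaler_nat (R := rat)) add_lfunE opp_lfunE scale_lfunE.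
rewrite root_coroot gcm_diag -/m /GRing.scale /= => e.
have N1E : N1%:R = (2 * (r + b))%N%:R - m :> rat.
  rewrite natrM mulr_natl -[LHS]opprK.
  have -> : - N1%:R = m - (r + b)%:R * 2%:R :> rat by rewrite e; ring.
  by ring.
have N1M : (r + b + M <= N1)%N.
  rewrite -(ler_nat rat) N1E natrM !natrD.
  have mb : `|m| < (Num.bound `|m|)%:R by apply: archi_boundP.
  have : (Num.bound `|m|)%:R + M%:R <= r%:R :> rat by rewrite -natrD ler_nat.
  have b0 : 0 <= b%:R :> rat by [].
  move: (ler_norm m) mb b0; lra.
have rbN : (r + b <= N1)%N by rewrite (leq_trans _ N1M) // leq_addr.
move/eqP: uN; apply; apply: (above (N1 - (r + b))%N); first by rewrite leq_subRL.
by have := wup N1; rewrite mulrnBr // addrA addrAC.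
Qed.

(** * Drinfeld polynomials *)

Hypothesis psi0 : forall s i,
  psi s i 0%N = qp ((gcm_r A i)%:R * ((sg s)%:~R * lam (coroot H i))).

Lemma nilpotent_weight i d : X false i 0 ^+ d *: v != 0 ->
  X false i 0 ^+ d.+1 *: v = 0 -> lam (coroot H i) = d%:R.
Proof.
move=> vd vd1; have := sl2_string (s := false) v_weight (v_raise i 0) vd1 vd.
by rewrite /sg opprK mul1r.
Qed.

Lemma psi0_nat i d : lam (coroot H i) = d%:R ->
  psi true i 0%N = z i ^+ d /\ psi false i 0%N = (z i ^+ d)^-1.
Proof.
move=> ld; rewrite !psi0 ld /sg mul1r mulN1r mulrN (qpN q0 qpD qp1) -natrM.
by rewrite (qp_nat q0 qpD qp1) /qi -exprM.
Qed.

(** The coefficient of $z^m$ in $\Psi^+(z)-\Psi^-(z)$; at $m=0$ both series contribute. *)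
Definition dpsi i (m : int) : K :=
  (if 0 <= m then psi true i `|m|%N else 0) - (if m <= 0 then psi false i `|m|%N else 0).

Lemma raise_lower i j s r : X true j s *: (X false i r *: v) =
  ((j == i)%:R / (z j - (z j)^-1) * dpsi j (s + r))%:A *: v.
Proof.
have := rel (rel_xx q qp g j i s r) => /(congr1 (fun y => y *: v)).
rewrite scalerBl -[(X false i r * _) *: v]scalerA v_raise scaler0 subr0 scalerA => ->.
rewrite -[LHS]algZ -[RHS]algZA; congr (_ *: _).
have phiE b m : phi b j m *: v = (if 0 <= sg b * m then psi b j `|m|%N else 0)%:A *: v.
  case: ifP => bm; last by rewrite /uphi bm !scale0r.
  have {1}-> : m = sg b * `|m|%N%:Z; last exact: v_phi.
  case: b bm => /=; rewrite ?mul1r ?mulN1r => bm; first by rewrite gez0_abs.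
  by rewrite lez0_abs ?opprK // -oppr_ge0.
rewrite scalerBl !phiE /dpsi mul1r mulN1r oppr_ge0.
by rewrite scalerBl scalerBl.
Qed.

(* The relation G(z) D(z) = 0 with the formal distribution D = Psi^+ - Psi^-. *)
Definition annihilates i (G : fps K) d :=
  forall N : int, \sum_(j < d.+1) G j * dpsi i (N - j%:Z) = 0.

Section Loop.
Variables (i : 'I_n) (d : nat).
Hypothesis lam_d : lam (coroot H i) = d%:R.

Local Notation c := (z i ^+ 2).
Local Notation kp := (k (((sg true)%:~R * (gcm_r A i)%:R : rat) *: coroot H i)).
Local Notation km := (k (((sg false)%:~R * (gcm_r A i)%:R : rat) *: coroot H i)).
Local Notation hs := (hseries q g i true).

Let zi0 := qi_neq0 A q0 i.
Let ziroot m := qi_root A q_root i (m := m).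

Let hsX s j r : hs j * X s i r - X s i r * hs j =
  ((sg s)%:~R * (c ^+ j - c^-1 ^+ j)) *: X s i (r + j%:Z).
Proof. exact: (hseriesX char0 q_root q0 rel). Qed.

Let hsXm j r : hs j * X false i r - X false i r * hs j =
  - (c ^+ j - c^-1 ^+ j) *: X false i (r + j%:Z).
Proof. by rewrite hsX /sg mulN1r. Qed.

Let hsXp j r : hs j * X true i r - X true i r * hs j =
  (c ^+ j - c^-1 ^+ j) *: X true i (r + j%:Z).
Proof. by rewrite hsX /sg mul1r. Qed.

Let phiv m : (fps_const kp * phi_exp q g i true) m *: v = (psi true i m)%:A *: v.
Proof. by rewrite fps_constM -phi_pos -(v_phi true) mul1r. Qed.

Let kmv : km *: v = (psi true i 0%N)^-1%:A *: v.
Proof.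
rewrite v_weight linearZ /= (psi0_nat lam_d).1; congr (_%:A *: _).
rewrite lam_d /sg mulN1r /GRing.scale /= mulNr (qpN q0 qpD qp1) -natrM.
by rewrite (qp_nat q0 qpD qp1) /qi -exprM.
Qed.

Let commloop (p : nat) : X true i p%:Z * X false i 0 - X false i 0 * X true i p%:Z =
  (z i - (z i)^-1)^-1 *:
    ((fps_const kp * phi_exp q g i true) p - (p == 0%N)%:R *: km).
Proof. by rewrite fps_constM; exact: (commXX rel i p). Qed.

Lemma nilpotent_series : X false i 0 ^+ d.+1 *: v = 0 ->
  exists G : fps K,
  [/\ G 0%N = 1, forall m, (d < m)%N -> G m = 0,
      forall m, (G * psi true i : fps K) m = z i ^+ d * (c^-1 ^+ m * G m)
    & forall m, (d <= m)%N ->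
        \sum_(j < m.+1) (G j)%:A *: (X false i (m - j)%N%:Z *: v) = 0].
Proof.
move=> vd; have [Psi0 _] := psi0_nat lam_d.
have [G [G0 Gd GPsi Grec]] := nilpotent_rational char0 zi0 ziroot
  (hseries0 q g i true) hsXm hsXp (phi_exp0 q g i true)
  (theta_phi_exp char0 rel i true) erefl (kmp rel i)
  (kpX q0 qpD qp1 rel i) (kmX q0 qpD qp1 rel i) (quadX rel i) commloop
  (v_raise i) phiv kmv v0 Psi0 vd.
by exists G; split=> // m; rewrite GPsi Psi0.
Qed.

Lemma series_nilpotent (G : fps K) : G 0%N = 1 ->
  (forall m, (d < m)%N -> G m = 0) ->
  (forall m, (G * psi true i : fps K) m = z i ^+ d * (c^-1 ^+ m * G m)) ->
  (forall y N, h_algebra hs y ->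
     (forall s : nat, (0 < s)%N -> X true i s%:Z *: (y *: (X false i 0 ^+ N.+1 *: v)) = 0) ->
     y *: (X false i 0 ^+ N.+1 *: v) = 0) ->
  X false i 0 ^+ d.+1 *: v = 0.
Proof.
move=> G0 Gd GPsi sing; have [Psi0 _] := psi0_nat lam_d.
apply: (rational_nilpotent char0 zi0 ziroot
  (hseries0 q g i true) (hseriesC rel i true) hsXm hsXp (phi_exp0 q g i true)
  (theta_phi_exp char0 rel i true) erefl (kmp rel i)
  (kpX q0 qpD qp1 rel i) (kmX q0 qpD qp1 rel i) (quadX rel i) commloop
  (v_raise i) phiv kmv G0 Gd _ sing) => m.
by rewrite GPsi Psi0.
Qed.

(** Only the recurrence at $m=d$ is used: applying $x^+_{N-d}$ to it gives the coefficient of $z^N$,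
    for negative [N] too. *)
Lemma recurrence_annihilates (G : fps K) :
  (forall m, (d <= m)%N ->
     \sum_(j < m.+1) (G j)%:A *: (X false i (m - j)%N%:Z *: v) = 0) ->
  annihilates i G d.
Proof.
move=> Grec N; have zz0 := zz_neq0 zi0 ziroot.
have := congr1 (fun u => X true i (N - d%:Z) *: u) (Grec d (leqnn d)).
rewrite scaler0 scaler_sumr.
under eq_bigr do rewrite algZC raise_lower eqxx algZA.
move=> e; apply: (mulfI (invr_neq0 zz0)); rewrite mulr0.
apply: (algZ_v_eq0 v0); rewrite -[RHS]e mulr_sumr scaler_suml scaler_suml.
apply: eq_bigr => j _; congr (_%:A *: _).
have jd : (j <= d)%N by rewrite -ltnS.
rewrite div1r mulrCA; congr (_ * (_ * dpsi i _)).
by rewrite -subzn // addrA subrK.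
Qed.

(** Separates $\Psi^+$ from $\Psi^-$; when the left side vanishes, what remains is the identity
    required by [expansion_at_infty]. *)
Lemma dpsi_sum (G : fps K) (N : int) : (forall m, (d < m)%N -> G m = 0) ->
  \sum_(j < d.+1) G j * dpsi i (N - j%:Z) =
  (if N is Posz l then (G * psi true i : fps K) l else 0) -
  \sum_(j < d.+1 | N <= j%:Z) G j * psi false i `|j%:Z - N|%N.
Proof.
move=> Gd; rewrite /dpsi; under eq_bigr do rewrite mulrBr subr_ge0 subr_le0.
rewrite sumrB; congr (_ - _); last first.
  by rewrite [RHS]big_mkcond; apply: eq_bigr => j _; rewrite distnC; case: ifP; rewrite ?mulr0.
case: N => l; last by rewrite big1 // => j _; rewrite mulr0.
rewrite fpsM (big_ord_widen_cond (d + l).+1 xpredT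
  (fun j => G j * (if j%:Z <= l%:Z then psi true i `|l%:Z - j%:Z|%N else 0))) ?ltnS ?leq_addr //.
rewrite (big_ord_widen_cond (d + l).+1 xpredT
  (fun j => G j * psi true i (l - j)%N)) ?ltnS ?leq_addl //.
rewrite big_mkcond [RHS]big_mkcond; apply: eq_bigr => j _ /=.
rewrite ltnS lez_nat ltnS; case: (leqP j l) => jl.
  by rewrite distnEl //; case: ifP => // /negbT; rewrite -ltnNge => /Gd->; rewrite mul0r.
by rewrite mulr0; case: ifP.
Qed.

(** If $D$ is the degree of [G], the coefficient of $z^D$ in $G\Psi^+=G\Psi^-$ gives
    $q_i^dc^{-D}=q_i^{-d}$, hence $D=d$. *)
Lemma top_coef_neq0 (G : fps K) : G 0%N = 1 -> (forall m, (d < m)%N -> G m = 0) ->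
  (forall m, (G * psi true i : fps K) m = z i ^+ d * (c^-1 ^+ m * G m)) ->
  annihilates i G d -> G d != 0.
Proof.
move=> G0 Gd GPsi ann.
have exD : exists D, (G D != 0) && (D <= d)%N by exists 0%N; rewrite G0 oner_eq0.
have bnd D : (G D != 0) && (D <= d)%N -> (D <= d)%N by case/andP.
case: (ex_maxnP exD bnd) => D /andP[GD Dd] maxD.
have GD0 m : (D < m)%N -> G m = 0.
  move=> Dm; case: (leqP m d) => [md|/Gd//]; apply/eqP; apply: contraLR Dm => Gm.
  by rewrite -leqNgt maxD // Gm.
suff <- : D = d by [].
have := dpsi_sum D%:Z Gd; rewrite ann => /esym/eqP; rewrite subr_eq0 => /eqP.
rewrite GPsi (bigD1 (Ordinal (Dd : (D < d.+1)%N))) //= subrr absz0 big1 => [|j /andP[]].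
  rewrite addr0 (psi0_nat lam_d).2 => e.
  have {e} : z i ^+ (2 * d) = z i ^+ (2 * D).
    move: e => /(congr1 (fun a => a * (G D)^-1 * z i ^+ d * c ^+ D)).
    rewrite exprVn (exprM (z i) 2 D) (mulnC 2 d) (exprM (z i) d 2).
    move: (z i ^+ d) (c ^+ D) (G D) (expf_neq0 d zi0) (expf_neq0 D (expf_neq0 2 zi0)) GD.
    move=> zd cD GD' zd0 cD0 GD'0 e.
    have -> : cD = GD' / zd / GD' * zd * cD by field; rewrite zd0 GD'0.
    by rewrite -e; field; rewrite cD0 GD'0.
  by move=> /(z_expI zi0 ziroot)/eqP; rewrite eqn_pmul2l // => /eqP.
rewrite lez_nat => Dj jD; rewrite GD0 ?mul0r //.
by rewrite ltn_neqAle Dj andbT eq_sym; apply: contraNneq jD => e; apply/eqP/val_inj.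
Qed.

Lemma coef_comp_scaleX (P : {poly K}) a j : (P \Po (a *: 'X))`_j = a ^+ j * P`_j.
Proof.
rewrite comp_polyE coef_sum.
under eq_bigr do rewrite exprZn scalerA coefZ coefXn.
have [jP|jP] := ltnP j (size P).
  rewrite (bigD1 (Ordinal jP)) //= eqxx mulr1 big1 ?addr0 1?mulrC // => l /eqP lj.
  by case: eqP => [e|_]; [case: lj; apply: val_inj|rewrite mulr0].
rewrite (nth_default 0 jP) mulr0 big1 // => l _.
by case: eqP => [e|_]; [move: jP; rewrite e leqNgt ltn_ord|rewrite mulr0].
Qed.

Definition drinfeld_at (P : {poly K}) :=
  let F := z i ^+ (size P).-1 *: (P \Po ((z i)^-1 *: 'X)) in
  let G := P \Po (z i *: 'X) in
  [/\ P`_0 = 1, expansion_at_0 (psi true i) F G & expansion_at_infty (psi false i) F G].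

Lemma drinfeld_polynomial (G : fps K) : G 0%N = 1 -> (forall m, (d < m)%N -> G m = 0) ->
  (forall m, (G * psi true i : fps K) m = z i ^+ d * (c^-1 ^+ m * G m)) ->
  annihilates i G d -> exists P, drinfeld_at P.
Proof.
move=> G0 Gd GPsi ann; have Gd0 := top_coef_neq0 G0 Gd GPsi ann.
(* $P(z)=G(z/q_i)$, so that $P(zq_i)=G(z)$ and $P(zq_i^{-1})=G(z/c)$. *)
pose P := \poly_(j < d.+1) (z i ^- j * G j).
(* The nonzero top coefficient matters here: the prefactor $q_i^{\deg P}$ has to equal
   $\Psi^+_{i,0}=q_i^d$. *)
have sP : size P = d.+1 by rewrite size_poly_eq // mulf_neq0 ?invr_eq0 ?expf_neq0.
have PE j : P`_j = z i ^- j * G j.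
  by rewrite coef_poly; case: ltnP => // dj; rewrite Gd ?mulr0.
have GE j : (P \Po (z i *: 'X))`_j = G j.
  by rewrite coef_comp_scaleX PE mulrA divff ?mul1r // expf_neq0.
have FE j : (z i ^+ (size P).-1 *: (P \Po ((z i)^-1 *: 'X)))`_j =
    (G * psi true i : fps K) j.
  rewrite coefZ coef_comp_scaleX PE GPsi sP /=; congr (_ * _).
  by rewrite mulrA !exprVn -invfM -exprD addnn -mul2n exprM.
exists P; split; first by rewrite PE G0 expr0 invr1 mul1r.
  by move=> N; rewrite FE fpsM; apply: eq_bigr => j _; rewrite GE mulrC.
move=> N; have -> : size (P \Po (z i *: 'X)) = d.+1.
  by rewrite size_comp_poly2 // size_scale // size_polyX.
have := dpsi_sum N Gd; rewrite ann => /esym/eqP; rewrite subr_eq0 => /eqP e.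
transitivity (\sum_(j < d.+1 | N <= j%:Z) G j * psi false i `|j%:Z - N|%N).
  by apply: eq_bigr => j _; rewrite GE mulrC.
by rewrite -e; case: (N) => l //; rewrite FE.
Qed.

End Loop.

Lemma polynomial_series i P : drinfeld_at i P ->
  exists2 d, lam (coroot H i) = d%:R & exists G : fps K,
  [/\ G 0%N = 1, forall m, (d < m)%N -> G m = 0,
      forall m, (G * psi true i : fps K) m = z i ^+ d * ((z i ^+ 2)^-1 ^+ m * G m),
      G d != 0 & annihilates i G d].
Proof.
move=> [P0 e0 eoo].
have zi0 := qi_neq0 A q0 i.
have Pn0 : P != 0 by apply: contraTneq (oner_neq0 K) => P00; rewrite -P0 P00 coef0 eqxx.
set d := (size P).-1 in e0 eoo.
have sP : size P = d.+1 by rewrite /d prednK // lt0n size_poly_eq0.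
pose G : fps K := fun j => (P \Po (z i *: 'X))`_j.
have GE j : G j = z i ^+ j * P`_j by exact: coef_comp_scaleX.
have G0 : G 0%N = 1 by rewrite GE P0 mulr1.
have Gd m : (d < m)%N -> G m = 0 by move=> dm; rewrite GE nth_default ?mulr0 ?sP.
have FE j : (z i ^+ d *: (P \Po ((z i)^-1 *: 'X)))`_j = z i ^+ d * ((z i ^+ 2)^-1 ^+ j * G j).
  rewrite coefZ coef_comp_scaleX GE; congr (_ * _).
  by rewrite mulrA !exprVn -(exprM (z i) 2 j) mul2n -addnn exprD invfM mulfVK ?expf_neq0.
have GPsi m : (G * psi true i : fps K) m = z i ^+ d * ((z i ^+ 2)^-1 ^+ m * G m).
  by rewrite -FE -e0 fpsM; apply: eq_bigr => j _; rewrite mulrC.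
(* The constant term of the expansion at 0 reads $q_i^{\lambda(\alpha_i^\vee)}=q_i^{\deg P}$, and
   [qp_inj] compares the exponents. *)
have lam_d : lam (coroot H i) = d%:R.
  have := GPsi 0%N; rewrite fpsM big_ord1 G0 !mul1r mulr1 psi0 /sg mul1r /qi -exprM.
  rewrite -(qp_nat q0 qpD qp1) natrM => /(qp_inj q_root q0 qpD qp1)/mulfI; apply.
  by rewrite pnatr_eq0 -lt0n gcm_r_gt0.
exists d => //; exists G; split=> // [|N].
  by rewrite GE mulf_neq0 ?expf_neq0 // -/(lead_coef P) lead_coef_eq0.
rewrite dpsi_sum //; apply/eqP; rewrite subr_eq0; apply/eqP.
have := eoo N; rewrite size_comp_poly2; last by rewrite size_scale // size_polyX.
rewrite sP => e; transitivity (\sum_(j < d.+1 | N <= j%:Z) psi false i `|j%:Z - N|%N * G j).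
  by rewrite e; case: (N) => l //; rewrite GPsi -FE.
by apply: eq_bigr => j _; rewrite mulrC.
Qed.

Lemma nilpotent_drinfeld i : nilpotent_at i v -> exists P, drinfeld_at i P.
Proof.
move=> /(last_nonzero v0)[d vd vd1]; have lam_d := nilpotent_weight vd vd1.
have [G [G0 Gd GPsi Grec]] := nilpotent_series lam_d vd1.
apply: (drinfeld_polynomial lam_d G0 Gd GPsi).
exact: (recurrence_annihilates Grec).
Qed.

(** By [raise_lower], the relation [annihilates] makes this vector singular of weight
    [lam - alpha i]. *)
Lemma v_recurrence i (G : fps K) d : annihilates i G d -> forall N : int,
  \sum_(j < d.+1) (G j)%:A *: (X false i (N - j%:Z) *: v) = 0.
Proof.
move=> ann N; apply: (@singular_eq0 [:: (i, 0)]) => //; split=> [|j s].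
  rewrite /word_weight big_seq1; apply: has_weight_sum => l.
  have [_ _ wZ] := has_weight_subspace (lam - alpha i); apply: wZ.
  exact: has_weightXm.
rewrite scaler_sumr; under eq_bigr do rewrite algZC raise_lower algZA.
rewrite -scaler_suml -scaler_suml.
set S := \sum_(l < _) _; suff -> : S = 0 by rewrite !scale0r.
rewrite /S; have [->|ji] := eqVneq j i; last by rewrite big1 // => l _; rewrite !mul0r mulr0.
under eq_bigr do rewrite mulrCA addrA.
by rewrite -mulr_sumr ann mulr0.
Qed.

(** The recurrence can be solved for its first term because [G 0] is 1 and for its last because
    [G d] is nonzero, so indices are pushed inwards from both ends. *)
Lemma v_bounded i (G : fps K) d r : G 0%N = 1 -> G d != 0 -> annihilates i G d ->
  lspan (fun u => exists2 s : int, (`|s| <= d)%N & u = X false i s *: v) (X false i r *: v).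
Proof.
move=> G0 Gd ann; set Z := fun u => _.
have base s : (`|s| <= d)%N -> lspan Z (X false i s *: v).
  by move=> sd; apply: lspan_in; exists s.
case: r => r.
  elim/ltn_ind: r => r IH; have [rd|dr] := leqP r d; first exact: base.
  have := v_recurrence ann r%:Z; rewrite big_ord_recl G0 subr0 !scale1r => /eqP.
  rewrite addr_eq0 => /eqP->; apply/lspanN/lspan_sum => j; apply: lspanZ.
  rewrite lift0 subzn ?(leq_trans _ dr) ?ltnS ?ltn_ord //; last exact: ltnW.
  by apply: IH; rewrite ltn_subrL (leq_ltn_trans _ dr).
rewrite NegzE; move: r.+1 => {}r.
elim/ltn_ind: r => r IH; have [rd|dr] := leqP r d; first by apply: base; rewrite abszN.
have := v_recurrence ann (d%:Z - r%:Z).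
rewrite big_ord_recr /= [d%:Z - r%:Z - d%:Z]addrAC subrr add0r addrC => /eqP.
rewrite addr_eq0 => /eqP e.
have -> : X false i (- r%:Z) *: v = ((G d)^-1)%:A *: ((G d)%:A *: (X false i (- r%:Z) *: v)).
  by rewrite algZA mulVf // !scale1r.
rewrite e; apply/lspanZ/lspanN/lspan_sum => j; apply: lspanZ.
have -> : d%:Z - r%:Z - j%:Z = - (r - (d - j))%N%:Z.
  have jd : (j <= d)%N by exact/ltnW/ltn_ord.
  by rewrite -!subzn // ?(leq_trans (leq_subr _ _)) 1?ltnW //; ring.
apply: IH; rewrite ltn_subrL subn_gt0 ltn_ord /=; exact: leq_ltn_trans dr.
Qed.

(** * Finite-dimensional weight spaces *)

Definition head_bounded m N (t : L) := lspan (fun u => exists i (s : int) t',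
  [/\ (`|s| <= N)%N, level m t' & u = X false i s *: t']) t.

Lemma head_bounded_in m N i (s : int) t : (`|s| <= N)%N -> level m t ->
  head_bounded m N (X false i s *: t).
Proof. by move=> sN mt; apply: lspan_in; exists i, s, t. Qed.

Lemma quad_vec i j (r s : int) (t : L) :
  X false i (r + 1) *: (X false j s *: t) =
  (q ^ (sg false * symB A i j))%:A *: (X false j s *: (X false i (r + 1) *: t)) +
  ((q ^ (sg false * symB A i j))%:A *: (X false i r *: (X false j (s + 1) *: t)) -
   X false j (s + 1) *: (X false i r *: t)).
Proof.
have := rel (rel_quad q qp g false i j r s) => /(congr1 (fun y => y *: t)).
set e := q ^ _; rewrite !scalerBl => /eqP; rewrite subr_eq => /eqP E.
rewrite [LHS]scalerA E [LHS]addrC; congr (_ + (_ - _)).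
- by rewrite -[LHS]algZ -[(_ * X _ _ _) *: t]scalerA.
- by rewrite -[LHS]algZ -[(_ * X _ _ _) *: t]scalerA.
- by rewrite -[LHS]scalerA.
Qed.

(** Write [t] with a bounded head $x_{j,s}$. The quadratic relation moves [r] one step towards 0, up
    to terms whose head has index $s$ or $s\pm1$, within the larger bound. The induction on [r]
    ranges over all [t] because $x_{j,s\pm1}t'$ takes its place. *)
Lemma head_bounded_step m N :
  (forall t, level m.+1 t -> head_bounded m N t) ->
  forall i r t, level m.+1 t -> head_bounded m.+1 N.+1 (X false i r *: t).
Proof.
move=> IHm i r t mt.
have up (r' : nat) : head_bounded m.+1 N.+1 (X false i r'%:Z *: t).
  elim: r' t mt => [|r' IH] t mt; first exact: head_bounded_in.
  apply: lspan_map (IHm t mt) => _ [j [s [t' [sN mt' ->]]]].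
  have -> : r'.+1%:Z = r'%:Z + 1 by rewrite -addn1 PoszD.
  rewrite quad_vec; apply: lspanD; first apply: lspanZ.
    by apply: head_bounded_in; [exact: leqW|exact: levelX].
  apply: lspanB; first by apply/lspanZ/IH/levelX.
  apply: head_bounded_in; last exact: levelX.
  by move: sN; clear; lia.
case: r => r; first exact: up.
rewrite NegzE; move: r.+1 => {up} {}r.
elim: r t mt => [|r IH] t mt; first exact: head_bounded_in.
apply: lspan_map (IHm t mt) => _ [j [s [t' [sN mt' ->]]]].
have e0 : q ^ (sg false * symB A i j) != 0 by rewrite expfz_neq0.
have := quad_vec i j (- r.+1%:Z) (s - 1) t'; rewrite subrK.
have -> : - r.+1%:Z + 1 = - r%:Z by rewrite -addn1 PoszD opprD addrNK.
set e := q ^ _ in e0 * => E.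
have -> : X false i (- r.+1%:Z) *: (X false j s *: t') = (e^-1)%:A *:
   (X false i (- r%:Z) *: (X false j (s - 1) *: t') -
    e%:A *: (X false j (s - 1) *: (X false i (- r%:Z) *: t')) +
    X false j s *: (X false i (- r.+1%:Z) *: t')).
  transitivity ((e^-1)%:A *: (e%:A *: (X false i (- r.+1%:Z) *: (X false j s *: t')))).
    by rewrite algZA mulVf // !scale1r.
  by congr (_ *: _); rewrite E -[RHS]addrA addrACA subrr add0r subrK.
apply/lspanZ/lspanD; last by apply: head_bounded_in; [exact: leqW|exact: levelX].
apply: lspanB; first exact/IH/levelX.
apply/lspanZ/head_bounded_in; last exact: levelX.
by move: sN; clear; lia.
Qed.

Hypothesis dominant_v : forall i, exists P, drinfeld_at i P.

Lemma level_head_bounded m : exists N, forall t, level m.+1 t -> head_bounded m N t.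
Proof.
elim: m => [|m [N IH]].
  have [D DP] : exists D : 'I_n -> nat, forall i r, lspan
      (fun u => exists2 s : int, (`|s| <= D i)%N & u = X false i s *: v) (X false i r *: v).
    suff /choice[D DP] : forall i, exists d, forall r, lspan
      (fun u => exists2 s : int, (`|s| <= d)%N & u = X false i s *: v) (X false i r *: v).
      by exists D.
    move=> i; have [P /polynomial_series[d _ [G [G0 _ _ Gd ann]]]] := dominant_v i.
    by exists d => r; exact: v_bounded ann.
  exists (\max_(i < n) D i)%N => t; apply: lspan_mono => _ [[|[i r] [|//]] // _ ->] /=.
  apply: lspan_mono (DP i r) => _ [s sD ->]; apply: head_bounded_in.
    exact: leq_trans sD (leq_bigmax i).
  by apply: lspan_in; exists [::].
exists N.+1 => t; apply: lspan_mono => _ [[|[i r] w] // [wm] ->] /=.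
by apply: head_bounded_step => //; apply: lspan_in; exists w.
Qed.

Lemma level_findim m : exists b : seq L,
  (forall u, u \in b -> exists2 w, size w = m & u = lower w v) /\
  forall t, level m t -> lspan (fun u => u \in b) t.
Proof.
elim: m => [|m [b [bw bspan]]].
  exists [:: v]; split=> [u|t]; first by rewrite inE => /eqP->; exists [::].
  apply: lspan_mono => _ [w /size0nil -> ->]; apply: lspan_in; exact: mem_head.
have [N hb] := level_head_bounded m.
pose ints := [seq s%:Z | s <- iota 0 N.+1] ++ [seq - s%:Z | s <- iota 0 N.+1].
pose b' := flatten [seq [seq X false p.1 p.2 *: u | u <- b] |
  p <- [seq (i, s) | i <- enum 'I_n, s <- ints]].
exists b'; split=> [u /flatten_mapP[p _ /mapP[u' ub ->]]|t /hb].
  by have [w wm ->] := bw u' ub; exists (p :: w) => //=; rewrite wm.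
apply: lspan_mono => _ [i [s [t' [sN mt' ->]]]].
apply: lspan_map (bspan t' mt') => u ub; apply: lspan_in.
apply/flatten_mapP; exists (i, s); last by apply/mapP; exists u.
apply/allpairsP; exists (i, s); rewrite mem_enum; split=> //.
rewrite mem_cat; case: s sN => s sN; apply/orP; [left|right]; apply/mapP.
  by exists s => //; rewrite mem_iota add0n ltnS.
by exists s.+1; rewrite ?NegzE // mem_iota add0n ltnS.
Qed.

(** A weight fixes the word length, so its weight space lies in one level; the vectors of that
    weight among a finite spanning set of weight vectors then suffice. *)
Lemma weight_findim om : exists b : seq L,
  (forall u, u \in b -> has_weight om u) /\
  forall t, has_weight om t ->
    exists a : nat -> K, t = \sum_(j < size b) (a j)%:A *: b`_j.
Proof.
have [[w0 omE]|none] := pselect (exists w0, om = lam - word_weight w0); last first.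
  exists [::]; split=> // t wt; exists (fun=> 0); rewrite big_ord0.
  by apply: contrapT => /eqP /(weight_of_nonzero wt).
have [b0 [b0w b0span]] := level_findim (size w0).
exists [seq u <- b0 | `[< has_weight om u >]].
split=> [u|t wt]; first by rewrite mem_filter => /andP[/asboolP].
have lt : level (size w0) t.
  have := lspan_weight (fun u (Zu : exists w, u = lower w v) => let: ex_intro w uw := Zu in
    ex_intro _ (lam - word_weight w) (eq_ind_r _ (has_weight_lower w v_weight) uw)) wt (words_span t).
  apply: lspan_mono => _ [[w ->] wo].
  have [->|nz] := eqVneq (lower w v) 0; first exact: lspan0.
  apply: lspan_in; exists w => //; apply: word_weight_size.
  have := has_weight_unique (has_weight_lower w v_weight) wo nz.
  by rewrite omE => /addrI/oppr_inj.
have b0weight u : u \in b0 -> exists w, has_weight w u.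
  by move=> /b0w[w _ ->]; eexists; exact: has_weight_lower v_weight.
have := lspan_weight b0weight wt (b0span t lt).
have sub u : u \in b0 /\ has_weight om u ->
    lspan (fun u => u \in [seq u <- b0 | `[< has_weight om u >]]) u.
  by move=> [ub wu]; apply: lspan_in; rewrite mem_filter ub andbT; apply/asboolP.
move=> /(lspan_mono sub)/lspan_seq_coord[r ->].
exists (fun j => if insub j is Some j' then r 0 j' else 0).
by apply: eq_bigr => j _; rewrite valK.
Qed.

(** Commuting $h_{i,-1}$ with $x^+_s$ gives a nonzero multiple of $x^+_{s-1}$. The powers of
    $h_{i,-1}$ on [t] stay in a finite-dimensional level, and a linear dependence among them lets
    the vanishing descend to smaller [s]. *)
Lemma raise_eq0 i w0 t : w0 != [::] -> has_weight (lam - word_weight w0) t ->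
  level (size w0) t -> (forall s : nat, (0 < s)%N -> X true i s%:Z *: t = 0) ->
  (forall j r, j != i -> X true j r *: t = 0) -> t = 0.
Proof.
move=> w00 wt lt xt xj; apply: (@singular_eq0 w0) => //; split=> // j r.
have [->|/xj//] := eqVneq j i; move: {j} r.
set a := (sg true)%:~R * (-1)%:~R^-1 * qint q (-1 * symB A i i) : K.
have a0 : a != 0.
  rewrite !mulf_neq0 ?invr_eq0 ?oner_eq0 ?oppr_eq0 ?(q_sub_inv_neq0 q_root q0) //.
  rewrite symB_diag mulN1r opprK subr_eq0 -exprnN eq_sym.
  apply/eqP => /(congr1 (fun x => x * q ^+ (2 * gcm_r A i))).
  rewrite mulVf ?expf_neq0 // -exprD; apply/eqP; rewrite q_root //.
  by rewrite addn_gt0 muln_gt0 gcm_r_gt0.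
have xh s (u : L) : X true i s *: (h i (-1) *: u) =
    h i (-1) *: (X true i s *: u) - a%:A *: (X true i (s - 1) *: u).
  have := hX rel true i i s (isT : -1 != 0 :> int) => /(congr1 (fun y => y *: u)).
  rewrite scalerDl -algZ scalerA => e.
  by rewrite [h i (-1) *: _]scalerA e [-1 + s]addrC addrK.
have [b [_ bspan]] := level_findim (size w0).
have [m [e me]] : exists (m : nat) (e : nat -> K),
    h i (-1) ^+ m *: t = \sum_(l < m) (e l)%:A *: (h i (-1) ^+ l *: t).
  apply: (@krylov_relation _ _ _ b (fun l => h i (-1) ^+ l *: t)) => l; apply: bspan.
  elim: l => [|l IH]; first by rewrite scale1r.
  by rewrite exprS -scalerA; apply: levelh.
suff claim (p : nat) : forall s : int, - p%:Z < s -> X true i s *: t = 0.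
  by move=> s; apply: (claim `|s|.+1); rewrite -addn1 PoszD; lia.
elim: p => [|p IH] s ps; first by case: s ps => // s; rewrite oppr0 ltz_nat; exact: xt.
have [->|sp] := eqVneq s (- p%:Z); last by apply: IH; lia.
(* All other commutation terms contain some $x^+_{s'}t$ with $s'>-p$ and vanish by induction; only
   the one in which every $h_{i,-1}$ has been absorbed survives. *)
have key l : forall s : int, l%:Z - p%:Z <= s ->
    X true i s *: (h i (-1) ^+ l *: t) = ((- a) ^+ l)%:A *: (X true i (s - l%:Z) *: t).
  elim: l => [|l IHl] s1 ls; first by rewrite !scale1r subr0.
  rewrite exprS -[(_ * _) *: t]scalerA xh !IHl; [|lia|lia].
  rewrite (IH (s1 - l%:Z)) ?scaler0 ?add0r; last lia.
  rewrite algZA exprS mulNr scaleNr scaleNr; congr (- (_ *: (X true i _ *: t))); lia.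
(* At index $m-p$ the terms with $l<m$ involve $x^+_{m-p-l}t$ with $m-p-l>-p$ and vanish, while the
   left side is a nonzero multiple of $x^+_{-p}t$. *)
have := congr1 (fun u => X true i (m%:Z - p%:Z) *: u) me.
rewrite key // scaler_sumr big1 => [|l _].
  move/algZ_eq0; rewrite expf_neq0 ?oppr_eq0 // => /(_ isT).
  by have -> : m%:Z - p%:Z - m%:Z = - p%:Z by lia.
have := ltn_ord l => lm; rewrite algZC key; last lia.
by rewrite IH ?scaler0 //; lia.
Qed.

(** [raise_eq0] discharges the singular-vector hypothesis of [series_nilpotent]; its conditions on
    weight, level and the other raising currents follow by induction on the polynomial in the
    $h_{i,m}$. *)
Lemma dominant_nilpotent i : nilpotent_at i v.
Proof.
have [P /polynomial_series[d lam_d [G [G0 Gd GPsi _ _]]]] := dominant_v i.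
exists d.+1; apply: (series_nilpotent lam_d G0 Gd GPsi) => y N hy yt.
set t0 := X false i 0 ^+ N.+1 *: v.
have t0E : t0 = lower (nseq N.+1 (i, 0)) v.
  rewrite /t0; elim: (N.+1) => [|l IH]; first by rewrite scale1r.
  by rewrite exprS -scalerA IH.
apply: (@raise_eq0 i (nseq N.+1 (i, 0))) => //.
- elim: hy => [|y1 y2 _ IH1 _ IH2|a y' _ IH|j y' _ IH].
  + by rewrite scale1r t0E; exact: has_weight_lower.
  + by have [_ wD _] := has_weight_subspace (lam - word_weight (nseq N.+1 (i, 0)));
      rewrite scalerDl; apply: wD.
  + by have [_ _ wZ] := has_weight_subspace (lam - word_weight (nseq N.+1 (i, 0)));
      rewrite -algZ; apply: wZ.
  have [_ _ wZ] := has_weight_subspace (lam - word_weight (nseq N.+1 (i, 0))).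
  by rewrite -scalerA /hseries -algZ; apply: wZ; exact: has_weighth.
- elim: hy => [|y1 y2 _ IH1 _ IH2|a y' _ IH|j y' _ IH].
  + by rewrite scale1r t0E; apply: lspan_in; eexists; last reflexivity.
  + by rewrite scalerDl; apply: lspanD.
  + by rewrite -algZ; apply: lspanZ.
  by rewrite -scalerA /hseries -algZ; apply: lspanZ; exact: levelh.
move=> j r ji; elim: hy r => [|y1 y2 _ IH1 _ IH2|a y' _ IH|l y' _ IH] r.
- rewrite scale1r /t0; elim: (N.+1) r => [|m IH] r; first by rewrite scale1r v_raise.
  rewrite exprS -[(_ * _) *: v]scalerA.
  have := rel (rel_xx q qp g j i r 0) => /(congr1 (fun y => y *: (X false i 0 ^+ m *: v))).
  rewrite (negbTE ji) mul0r scale0r scale0r scalerBl => /eqP.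
  by rewrite subr_eq0 -!scalerA IH scaler0 => /eqP.
- by rewrite scalerDl scalerDr IH1 IH2 addr0.
- by rewrite -algZ algZC IH scaler0.
rewrite -scalerA /hseries -algZ algZC.
have [->|l0] := eqVneq (sg true * l%:Z) 0; first by rewrite h0 scale0r !scaler0.
have := hX rel true i j r l0 => /(congr1 (fun u => u *: (y' *: t0))).
rewrite scalerDl -[(h _ _ * _) *: _]scalerA -[(X _ _ _ * _) *: _]scalerA IH scaler0.
by rewrite -[(_ *: X _ _ _) *: _]algZ IH scaler0 addr0 => <-; rewrite scaler0.
Qed.

End HighestWeightModule.

(** * Transfer to the quantum affinization *)

Section UqModules.
Variables (K : fieldType) (q : K) (qp : rat -> K).
Variables (n : nat) (A : symmetrizable_gcm n) (H : realization A).
Hypothesis char0 : forall m, m.+1%:R != 0 :> K.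
Hypothesis q_root : forall m, (0 < m)%N -> q ^+ m != 1.
Hypothesis q0 : q != 0.
Hypothesis qpD : forall a b, qp (a + b) = qp a * qp b.
Hypothesis qp1 : qp 1 = q.

Local Notation U := (Uq q qp H : algType K).
Local Notation g := (@Ugen K q qp n A H).

Variable L : lmodType U.

Lemma Uq_generated (P : L -> Prop) : subspace P -> gen_stable g P ->
  forall (y : U) u, P u -> P (y *: u).
Proof.
move=> subP gP y; have [f <-] := Upi_surj y.
have mon (m : {fmonom gen H}) : stab P (Upi q qp (<< m >> : freeAlg K H) : U).
  rewrite -[m]fmK; elim: (m : seq _) => [|x s IH].
    have -> : FMonom [::] = mone :> {fmonom gen H} by apply/val_inj; rewrite /= fm1.
    exact: stab1.
  have -> : FMonom (x :: s) = mmul (fmu x) (FMonom s).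
    by apply/val_inj; rewrite /= fmM fmU.
  have -> : << mmul (fmu x) (FMonom s) >> = fgen K x * << FMonom s >> :> freeAlg K H.
    by rewrite -[RHS]/(fgmul _ _) fgmulUU mulr1.
  rewrite rmorphM; apply: stabM => // u Pu; exact: (gP x u Pu).
have : stab P (Upi q qp f : U); last exact.
rewrite [f]monalgE rmorph_sum; apply: big_ind => [||m _].
- exact: stab0.
- exact: stabD.
have -> : << f@_m *g m >> = f@_m *: << m >> :> freeAlg K H.
  by apply/malgP => m'; rewrite mcoeffZ !mcoeffU mulr_natr.
exact: (eq_ind_r (stab P) (stabZ subP (f@_m) (mon m)) (UpiZ q qp (f@_m) << m >>)).
Qed.

Lemma simple_subspace : simple_module L -> forall P : L -> Prop,
  subspace P -> gen_stable g P -> (exists2 u, P u & u != 0) -> forall u, P u.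
Proof.
move=> [_ simp] P subP gP [u Pu u0] w.
have Pgen := Uq_generated subP gP; have [P0 PD _] := subP.
have [|E|E] := simp (fun u => `[< P u >]).
- split; first exact/asboolP.
  by move=> y t1 t2 /asboolP Pt1 /asboolP Pt2; apply/asboolP/PD => //; apply: Pgen.
- have := E u; rewrite !inE (negbTE u0) => /asboolP; by [].
- by have := E w; rewrite inE => /asboolP.
Qed.

Variable x : lweight qp H.
Hypothesis L_simple : simple_module L.
Hypothesis L_highest : of_l_highest_weight x L.

Theorem integrable_dominant : integrable L <-> dominant q x.
Proof.
have [v [v_gen v_raise v_phi v_weight]] := L_highest.
have v0 : v != 0.
  have [[w w0] _] := L_simple; apply: contraNneq w0 => v00.
  by have [y ->] := v_gen w; rewrite v00 scaler0.
have rel (u w : U) : defrel q qp g u w -> u = w := @Ugen_rel K q qp n A H u w.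
have gen := @Uq_generated; have simp := simple_subspace L_simple.
have wt : has_weight qp g (lw_wt x) v := v_weight.
have psi0 := lw_psi0 x.
split.
  case=> _ _ _ van.
  have nilp i : nilpotent_at g i v.
    (* $(x^-_{i,0})^Nv$ has weight $\lambda-N\alpha_i$, where integrability leaves only 0. *)
    have [N vN] := van (lw_wt x) i; exists N.
    have [_] := vN N (leqnn N) (ux g false i 0 ^+ N *: v); apply.
    have := has_weight_pow qpD rel false i N wt.
    by rewrite /sg mulN1r scaleNr scaler_nat.
  have drin i := nilpotent_drinfeld char0 q_root q0 qpD qp1 rel v0 v_raise v_phi wt psi0 (nilp i).
  have [P PP] := choice drin.
  by exists P => i; exact: PP.
move=> [P PP].
have dom i : exists Q, drinfeld_at q A (lw_psi x) i Q by exists (P i); exact: PP.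
have nilp := dominant_nilpotent char0 q_root q0 qpD qp1 rel simp v0 v_raise v_phi wt psi0 dom.
split.
- move=> t.
  have Zw (u : L) : (exists w, u = lower g w v) -> exists w, has_weight qp g w u.
    by move=> [w ->]; eexists; exact: (has_weight_lower qpD rel w wt).
  have [s [u [_ uw tE]]] := lspan_weights Zw
    (words_span char0 q_root q0 rel gen v_gen v_raise v_phi wt t).
  by exists s, u; split=> // w; have [] := uw w.
- move=> s u us uw; exact: (has_weight_direct q_root q0 qpD qp1 us uw).
- move=> w; exact: (weight_findim char0 q_root q0 qpD qp1 rel gen simp v0 v_gen v_raise
    v_phi wt psi0 dom w).
- move=> mu i.
  have [N1 above] := vanish_above char0 q_root q0 qpD qp1 rel gen v_gen v_raise v_phi wt mu i.
  have [N2 below] := vanish_below char0 q_root q0 qpD qp1 rel gen v_gen v_raise v_phi wt mu (nilp i).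
  exists (N1 + N2)%N => r rN u; split=> wu.
    by apply: (above r) => //; exact: leq_trans (leq_addr _ _) rN.
  by apply: (below r) => //; exact: leq_trans (leq_addl _ _) rN.
Qed.

End UqModules.

(** * The complex exponential *)

Lemma cexpD (R : realType) (a b : R[i]) : cexp (a + b) = cexp a * cexp b.
Proof.
case: a b => [x1 y1] [x2 y2]; rewrite /cexp /= expRD cosD sinD.
by apply/eqP; rewrite eq_complex /=; apply/andP; split; apply/eqP; ring.
Qed.

Lemma cexp0 (R : realType) : cexp (0 : R[i]) = 1.
Proof. by rewrite /cexp /= expR0 cos0 sin0 mul1r. Qed.

Lemma cexp_neq0 (R : realType) (a : R[i]) : cexp a != 0.
Proof.
apply: contra_eq_neq (cexp0 R) => a0.
by rewrite -(addrN a) cexpD a0 mul0r eq_sym oner_eq0.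
Qed.

Theorem theorem4p9 (R : realType) (q l : R[i])
    (q_log : cexp l = q)
    (q_not_unity_root : forall m : nat, (0 < m)%N -> q ^+ m != 1)
    (n : nat) (A : symmetrizable_gcm n) (H : realization A)
    (x : lweight (cpow l) H)
    (L : lmodType (Uq q (cpow l) H)) :
  simple_module L -> of_l_highest_weight x L ->
  (integrable L <-> dominant q x).
Proof.
apply: integrable_dominant => //.
- by move=> m; rewrite pnatr_eq0.
- by rewrite -q_log cexp_neq0.
- by move=> a b; rewrite /cpow rmorphD mulrDl cexpD.
- by rewrite /cpow rmorph1 mul1r.
Qed.
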